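(* Let $(\xi_n)_{n\in\mathbb{Z}}$ be a stationary Markov chain with values in a measurable space $(S,\mathcal{A})$, with invariant distribution $\pi$, and let $f\in\mathbb{L}_0^2(\pi)$. Put $X_i=f(\xi_i)$ and $S_n=\sum_{i=1}^n X_i$. Assume that \[ \sum_{n\geq1}\frac{\|E(S_n\mid\xi_0)\|^2}{n^2}<\infty \quad\text{and}\quad \sum_{n\geq1}\frac{\|E(S_n\mid\xi_n)\|^2}{n^2}<\infty . \] Then: (a) there is $\sigma^2\in[0,\infty)$ such that $\lim_{n\to\infty} E(S_n^2)/n=\sigma^2$; (b) if the chain is totally ergodic, then the limit $\eta^2=\lim_{n\to\infty}\frac1n\|E(S_n\mid\xi_0,\xi_n)\|^2$ exists; and (c) if the chain is totally ergodic, then, with $\sigma^2$ from (a) and $\eta^2$ from (b), \[ \frac{S_n-E(S_n\mid\xi_0,\xi_n)}{\sqrt n}\Rightarrow N(0,\sigma^2-\eta^2), \] where $\Rightarrow$ denotes convergence in distribution.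
   Context: The chain is defined on a probability space $(\Omega,\mathcal{F},\mathbb{P})$ and admits a regular conditional distribution $Q(x,A)=\mathbb{P}(\xi_1\in A\mid\xi_0=x)$; $Q$ also denotes the Markov operator $(Qf)(x)=\int_S f(s)Q(x,ds)$. $\pi(A)=\mathbb{P}(\xi_0\in A)$ is the invariant distribution. $\mathbb{L}_0^2(\pi)$ is the set of measurable $f$ on $S$ with $\int f^2\,d\pi<\infty$ and $\int f\,d\pi=0$. $\|\cdot\|$ denotes the norm of $\mathbb{L}^2(\mathbb{P})$. The chain is called ergodic if the only functions with $Qf=f$ are constants, and totally ergodic if $Q^k$ is ergodic (only constants are $Q^k$-invariant) for every positive integer $k$. $N(0,s^2)$ denotes a centered normal random variable with variance $s^2$. *)

(* Defs.v *)
From HB Require Import structures.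
From mathcomp Require Import all_boot all_order all_algebra.
From mathcomp Require Import all_classical all_reals all_analysis.
Set Implicit Arguments. Unset Strict Implicit. Unset Printing Implicit Defensive.
Import Order.TTheory GRing.Theory Num.Theory.
Import numFieldNormedType.Exports.
Local Open Scope classical_set_scope.
Local Open Scope ring_scope.

Definition cexp_version {d dT} {Omega : measurableType d} {T : measurableType dT}
  {R : realType} (P : probability Omega R) (X : Omega -> R) (Y : Omega -> T)
  (g : T -> R) : Prop :=
  measurable_fun setT g /\
  P.-integrable setT (fun w => (g (Y w))%:E) /\
  forall B : set T, measurable B ->
    (\int[P]_(w in Y @^-1` B) (X w)%:E = \int[P]_(w in Y @^-1` B) (g (Y w))%:E)%E.

(* (xi_n)_{n in Z} is a Markov chain with transition kernel Q: each xi_n is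
   measurable and, for every n, the conditional law of xi_{n+1} given
   (xi_k)_{k <= n} is Q(xi_n, .) (tested on finite-dimensional past cylinders). *)
Definition markov_chain {d dS} {Omega : measurableType d} {S : measurableType dS}
  {R : realType} (P : probability Omega R) (xi : int -> Omega -> S)
  (Q : R.-pker S ~> S) : Prop :=
  (forall n, measurable_fun setT (xi n)) /\
  forall (n : int) (m : nat) (A : set S) (B : nat -> set S),
    measurable A -> (forall k, measurable (B k)) ->
    let past := [set w | forall k : nat, (k <= m)%N -> B k (xi (n - k%:Z) w)] in
    (P ([set w | A (xi (n + 1)%R w)] `&` past) = \int[P]_(w in past) Q (xi n w) A)%E.

Definition stationary {d dS} {Omega : measurableType d} {S : measurableType dS}
  {R : realType} (P : probability Omega R) (xi : int -> Omega -> S) : Prop :=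
  forall (t : int) (m : nat) (B : nat -> set S), (forall k, measurable (B k)) ->
    P [set w | forall k : nat, (k <= m)%N -> B k (xi (t + k%:Z) w)] =
    P [set w | forall k : nat, (k <= m)%N -> B k (xi k%:Z w)].

Definition L2_0 {dS} {S : measurableType dS} {R : realType}
  (pi : probability S R) (f : S -> R) : Prop :=
  measurable_fun setT f /\
  (\int[pi]_x ((f x) ^+ 2)%:E < +oo)%E /\
  (\int[pi]_x (f x)%:E = 0)%E.

Definition Qop {dS} {S : measurableType dS} {R : realType}
  (Q : R.-pker S ~> S) (g : S -> R) : S -> R :=
  fun x => fine (\int[Q x]_s (g s)%:E)%E.

Definition ergodic_pow {dS} {S : measurableType dS} {R : realType}
  (pi : probability S R) (Q : R.-pker S ~> S) (k : nat) : Prop :=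
  forall g : S -> R, measurable_fun setT g ->
    (\int[pi]_x ((g x) ^+ 2)%:E < +oo)%E ->
    {ae pi, forall x, iter k (Qop Q) g x = g x} ->
    exists c : R, {ae pi, forall x, g x = c}.

Definition totally_ergodic {dS} {S : measurableType dS} {R : realType}
  (pi : probability S R) (Q : R.-pker S ~> S) : Prop :=
  forall k : nat, (0 < k)%N -> ergodic_pow pi Q k.

(* E phi(Z) for Z ~ N(0, v), written as E phi(sqrt v * G), G standard normal
   (so that v = 0 gives the point mass at 0). *)
Definition normal_expect {R : realType} (v : R) (phi : R -> R) : \bar R :=
  (\int[@lebesgue_measure R]_x (phi (Num.sqrt v * x) * normal_pdf 0 1 x)%:E)%E.

Definition conv_in_dist_normal {d} {Omega : measurableType d} {R : realType}
  (P : probability Omega R) (Y : nat -> Omega -> R) (v : R) : Prop :=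
  forall phi : R -> R, continuous phi -> (exists M : R, forall x, `|phi x| <= M) ->
    ((fun n => \int[P]_w (phi (Y n w))%:E) @ \oo --> normal_expect v phi)%E.

Definition partial_sum {d dS} {Omega : measurableType d} {S : measurableType dS}
  {R : realType} (xi : int -> Omega -> S) (f : S -> R) (n : nat) (w : Omega) : R :=
  \sum_(1 <= i < n.+1) f (xi (i%:Z) w).

(* Main.v *)
(** Write [S_n] on the space of backward trajectories, where the block from time [m] to time
    [m + n] is a shift of the block of length [n].

    (a) By the Markov property the cross term in [E S_(m+n)^2] is bounded by
    [2 ||E(S_m | xi_0)|| ||E(S_n | xi_n)||], and both norms are subadditive, so the summability
    assumptions make [E S_n^2] an almost additive sequence.

    (b) The deviations [D_n = S_n - E(S_n | xi_0, xi_n)] of disjoint blocks are orthogonal to each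
    other, and [D_n] minus the sum of the deviations of its sub-blocks is orthogonal to that sum.
    Hence [E D_n^2] is superadditive, [E D_n^2 / n] converges to some [c], and [eta^2] is
    [sigma^2 - c].

    (c) For fixed [m] with [E D_m^2 / m] close to [c], [D_n / sqrt n] is close in mean square to a
    normalised sum of deviations over blocks of length [m].  Grouping [L] of these blocks, the
    mean ergodic theorem for [Q^m] makes the conditional variance of a group nearly constant, and
    expanding the cosine one group at a time gives the limit of [E cos (t D_n / sqrt n + th)].
    Trigonometric polynomials and tightness extend the convergence to bounded continuous
    functions. *)

Require Import Defs.
From HB Require Import structures.
From mathcomp Require Import all_boot all_order all_algebra.
From mathcomp Require Import all_classical all_reals all_analysis.
From mathcomp Require Import measurable_realfun zify ring lra.
Set Implicit Arguments. Unset Strict Implicit. Unset Printing Implicit Defensive.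
Import Order.TTheory GRing.Theory Num.Theory.
Import numFieldNormedType.Exports.
Local Open Scope classical_set_scope.
Local Open Scope ring_scope.

(** * Square-integrable functions *)

(** No Poisson equation is solved and no martingale approximation is built. Since [D_m] is centred
    given both end states of its block, the Markov property makes it centred given everything before
    and everything after the block, so deviations over consecutive blocks are exact martingale
    differences.

    Time is read backwards because then the path law does not depend on [n], coordinate 0 is the
    newest state, and the kernel [Q] is adjoint to the shift. A time-reversed kernel is never
    introduced: what is conditioned on the newest state is handled by pairing with [Q^m].

    Conditional expectations are used mostly through pairings with test functions. [Q] is applied to
    functions bounded everywhere, and square-integrable objects are reached by truncation.

    The block length [m] in the limit theorem is dictated by how close [E D_m^2 / m] must be to [c],
    so it is beyond control; the variance of a group of blocks is averaged by [Q^m], whose invariant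
    functions must therefore be constant for every [m]. This is why ergodicity of [Q] alone does not
    fit the argument and total ergodicity is assumed. *)

Section toolkit_defs.
Context {d} {T : measurableType d} {R : realType}.

(** The bound holds everywhere, not almost everywhere: [kop] and [Qop] are pointwise integrals, and
    such a function is integrable against [Q x] for every [x]. *)
Definition bmeas (F : T -> R) : Prop :=
  measurable_fun setT F /\ exists M, forall x, `|F x| <= M.

Definition sqint (P : probability T R) (F : T -> R) : Prop :=
  measurable_fun setT F /\ P.-integrable setT (EFin \o (fun x => F x ^+ 2)).

(** Large values are sent to 0 instead of being clamped, so that [y * trunc n y = trunc n y ^+ 2].
    This lets a conditional expectation be tested against its own truncation. *)
Definition trunc (n : nat) (y : R) : R := if `|y| <= n%:R then y else 0.

Lemma measurable_trunc n : measurable_fun setT (trunc n).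
Proof.
apply: measurable_fun_ifT => //; apply: measurable_fun_ler => //.
Qed.

Lemma trunc_bound n y : `|trunc n y| <= n%:R.
Proof. by rewrite /trunc; case: ifP => // _; rewrite normr0. Qed.

Lemma trunc_le n y : `|trunc n y| <= `|y|.
Proof. by rewrite /trunc; case: ifP => // _; rewrite normr0. Qed.

Lemma cvg_trunc y : trunc n y @[n --> \oo] --> y.
Proof.
apply: cvg_near_cst.
exists (Num.truncn `|y|).+1 => // n /= hn; rewrite /trunc ifT//.
apply/ltW/(lt_le_trans (truncnS_gt _)).
by rewrite ler_nat.
Qed.

Lemma bmeas_trunc (F : T -> R) n : measurable_fun setT F ->
  bmeas (fun x => trunc n (F x)).
Proof.
move=> mF; split; last by exists n%:R => x; exact: trunc_bound.
by apply: measurableT_comp mF; exact: measurable_trunc.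
Qed.

Lemma bmeas_cst c : bmeas (fun=> c).
Proof. by split=> //; exists `|c|. Qed.

Lemma bmeasD F G : bmeas F -> bmeas G -> bmeas (fun x => F x + G x).
Proof.
move=> [mF [M hM]] [mG [N hN]]; split; first exact: measurable_funD.
by exists (M + N) => x; rewrite (le_trans (ler_normD _ _))// lerD.
Qed.

Lemma bmeasN F : bmeas F -> bmeas (fun x => - F x).
Proof.
move=> [mF [M hM]]; split; first exact: measurableT_comp.
by exists M => x; rewrite normrN.
Qed.

Lemma bmeasB F G : bmeas F -> bmeas G -> bmeas (fun x => F x - G x).
Proof. by move=> ? ?; apply: bmeasD => //; exact: bmeasN. Qed.

Lemma bmeasM F G : bmeas F -> bmeas G -> bmeas (fun x => F x * G x).
Proof.
move=> [mF [M hM]] [mG [N hN]]; split; first exact: measurable_funM.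
by exists (M * N) => x; rewrite normrM ler_pM.
Qed.

Lemma bmeasZ c F : bmeas F -> bmeas (fun x => c * F x).
Proof. by move=> ?; apply: bmeasM => //; exact: bmeas_cst. Qed.

Lemma bmeas_sum (I : Type) (s : seq I) (F : I -> T -> R) :
  (forall i, bmeas (F i)) -> bmeas (fun x => \sum_(i <- s) F i x).
Proof.
move=> bF; elim: s => [|i s ih].
  under eq_fun do rewrite big_nil; exact: bmeas_cst.
under eq_fun do rewrite big_cons; exact: bmeasD.
Qed.

End toolkit_defs.

Lemma bmeas_comp {d d'} {T : measurableType d} {T' : measurableType d'}
    {R : realType} (F : T -> R) (g : T' -> T) :
  bmeas F -> measurable_fun setT g -> bmeas (fun x => F (g x)).
Proof.
move=> [mF [M hM]] mg; split; first exact: measurableT_comp.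
by exists M => x.
Qed.

Section toolkit.
Context {d} {T : measurableType d} {R : realType}.
Variable P : probability T R.
Notation "''E' F" := (Rintegral P setT F) (at level 10, F at level 9) : ring_scope.
Notation integ F := (P.-integrable setT (EFin \o F)).

Lemma integ_measurable (F : T -> R) : integ F -> measurable_fun setT F.
Proof. by move=> /measurable_int/measurable_EFinP. Qed.

Lemma integ_le (F G : T -> R) : measurable_fun setT F -> integ G ->
  (forall x, `|F x| <= G x) -> integ F.
Proof.
move=> mF iG h; apply: (le_integrable _ _ _ iG) => //; first exact/measurable_EFinP.
by move=> x _ /=; rewrite lee_fin (le_trans (h x))// ler_norm.
Qed.

Lemma integ_bmeas F : bmeas F -> integ F.
Proof.
move=> [mF [M hM]]; apply: (@integ_le _ (fun=> M)) => //.
by apply: finite_measure_integrable_cst.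
Qed.

Lemma integ_cst c : integ (fun=> c).
Proof. exact/integ_bmeas/bmeas_cst. Qed.

Lemma integD F G : integ F -> integ G -> integ (fun x => F x + G x).
Proof. by move=> iF iG; have := integrableD measurableT iF iG. Qed.

Lemma integZ c F : integ F -> integ (fun x => c * F x).
Proof. by move=> iF; have := integrableZl measurableT c iF. Qed.

Lemma integN F : integ F -> integ (fun x => - F x).
Proof.
move=> /(integZ (-1)); apply: eq_integrable => // x _ /=.
by rewrite mulN1r.
Qed.

Lemma integB F G : integ F -> integ G -> integ (fun x => F x - G x).
Proof. by move=> iF iG; apply: integD => //; exact: integN. Qed.

Lemma integ_abs F : integ F -> integ (fun x => `|F x|).
Proof. by move=> /integrable_abse. Qed.

Lemma integ_sum (I : Type) (s : seq I) (F : I -> T -> R) :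
  (forall i, integ (F i)) -> integ (fun x => \sum_(i <- s) F i x).
Proof.
move=> bF; elim: s => [|i s ih].
  under [X in EFin \o X]eq_fun do rewrite big_nil; exact: integ_cst.
under [X in EFin \o X]eq_fun do rewrite big_cons; exact: integD.
Qed.

Lemma integMb F G : integ F -> bmeas G -> integ (fun x => F x * G x).
Proof.
move=> iF [mG [M hM]].
apply: (@integ_le _ (fun x => M * `|F x|)).
- exact/measurable_funM/mG/integ_measurable.
- exact/integZ/integ_abs.
- by move=> x; rewrite normrM mulrC ler_wpM2r.
Qed.

Lemma sqintM F G : sqint P F -> sqint P G -> integ (fun x => F x * G x).
Proof.
move=> [mF iF] [mG iG]; apply: (@integ_le _ (fun x => F x ^+ 2 + G x ^+ 2)).
- exact: measurable_funM.
- exact: integD.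
move=> x; rewrite normrM -(real_normK (num_real (F x))) -(real_normK (num_real (G x))).
have := normr_ge0 (F x); have := normr_ge0 (G x); nra.
Qed.

Lemma sqint_bmeas F : bmeas F -> sqint P F.
Proof.
move=> bF; split; first by case: bF.
by apply: integ_bmeas; under eq_fun do rewrite expr2; exact: bmeasM.
Qed.

Lemma sqint_integ F : sqint P F -> integ F.
Proof.
move=> sF; have := sqintM sF (sqint_bmeas (bmeas_cst 1)).
by apply: eq_integrable => // x _ /=; rewrite mulr1.
Qed.

Lemma sqint_sqr F : sqint P F -> integ (fun x => F x ^+ 2).
Proof. by case. Qed.

Lemma sqintD F G : sqint P F -> sqint P G -> sqint P (fun x => F x + G x).
Proof.
move=> sF sG; split; first by apply: measurable_funD; [case: sF|case: sG].
apply: (@integ_le _ (fun x => 2 * F x ^+ 2 + 2 * G x ^+ 2)).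
- by apply: measurable_funX; apply: measurable_funD; [case: sF|case: sG].
- by apply: integD; apply: integZ; exact: sqint_sqr.
by move=> x; rewrite ger0_norm ?sqr_ge0//; have := sqr_ge0 (F x - G x); nra.
Qed.

Lemma sqintZ c F : sqint P F -> sqint P (fun x => c * F x).
Proof.
move=> [mF iF]; split; first exact: measurable_funM.
by under [X in EFin \o X]eq_fun do rewrite exprMn; exact: integZ.
Qed.

Lemma sqintN F : sqint P F -> sqint P (fun x => - F x).
Proof. by move=> /(sqintZ (-1)); under eq_fun do rewrite mulN1r. Qed.

Lemma sqintB F G : sqint P F -> sqint P G -> sqint P (fun x => F x - G x).
Proof. by move=> ? ?; apply: sqintD => //; exact: sqintN. Qed.

Lemma sqintMb F G : sqint P F -> bmeas G -> sqint P (fun x => F x * G x).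
Proof.
move=> [mF iF] bG; split; first by apply: measurable_funM => //; case: bG.
under [X in EFin \o X]eq_fun do rewrite exprMn.
by apply: integMb => //; under eq_fun do rewrite expr2; exact: bmeasM.
Qed.

Lemma sqint_sum (I : Type) (s : seq I) (F : I -> T -> R) :
  (forall i, sqint P (F i)) -> sqint P (fun x => \sum_(i <- s) F i x).
Proof.
move=> bF; elim: s => [|i s ih].
  by under eq_fun do rewrite big_nil; exact/sqint_bmeas/bmeas_cst.
by under eq_fun do rewrite big_cons; exact: sqintD.
Qed.

Lemma E_cst c : 'E (fun=> c) = c.
Proof. by rewrite Rintegral_cst// [X in fine X]probability_setT mulr1. Qed.

Lemma E_D F G : integ F -> integ G -> 'E (fun x => F x + G x) = 'E F + 'E G.
Proof. by move=> iF iG; rewrite RintegralD. Qed.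

Lemma E_B F G : integ F -> integ G -> 'E (fun x => F x - G x) = 'E F - 'E G.
Proof. by move=> iF iG; rewrite RintegralB. Qed.

Lemma E_Z c F : integ F -> 'E (fun x => c * F x) = c * 'E F.
Proof. by move=> iF; rewrite RintegralZl. Qed.

Lemma E_ge0 F : (forall x, 0 <= F x) -> 0 <= 'E F.
Proof. by move=> h; apply: Rintegral_ge0. Qed.

Lemma E_le F G : integ F -> integ G -> (forall x, F x <= G x) -> 'E F <= 'E G.
Proof. by move=> iF iG h; apply: le_Rintegral. Qed.

Lemma E_abs F : integ F -> `|'E F| <= 'E (fun x => `|F x|).
Proof. by move=> iF; apply: le_normr_Rintegral. Qed.

Lemma E_sum (I : Type) (s : seq I) (F : I -> T -> R) :
  (forall i, integ (F i)) -> 'E (fun x => \sum_(i <- s) F i x) = \sum_(i <- s) 'E (F i).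
Proof.
move=> bF; elim: s => [|i s ih].
  by under eq_Rintegral do rewrite big_nil; rewrite E_cst big_nil.
under eq_Rintegral do rewrite big_cons.
by rewrite big_cons E_D ?ih//; exact: integ_sum.
Qed.

Lemma E_EFin F : integ F -> (\int[P]_x (F x)%:E)%E = ('E F)%:E.
Proof. by move=> iF; rewrite /Rintegral fineK//; exact: integrable_fin_num. Qed.

(* the discriminant of [s |-> 'E ((F - s G)^2)], written without dividing by ['E (G^2)] *)
Lemma E_CS F G : sqint P F -> sqint P G ->
  ('E (fun x => F x * G x)) ^+ 2 <= 'E (fun x => F x ^+ 2) * 'E (fun x => G x ^+ 2).
Proof.
move=> sF sG; set a := 'E (fun x => F x ^+ 2); set c := 'E (fun x => G x ^+ 2); set b := 'E _.
have h s t : 0 <= s ^+ 2 * a - 2 * (s * t) * b + t ^+ 2 * c.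
  have -> : s ^+ 2 * a - 2 * (s * t) * b + t ^+ 2 * c =
      'E (fun x => (s * F x - t * G x) ^+ 2).
    rewrite /a /b /c -!E_Z; try exact: sqint_sqr; try exact: sqintM.
    have i1 : integ (fun x => s ^+ 2 * F x ^+ 2) by apply: integZ; exact: sqint_sqr.
    have i2 : integ (fun x => 2 * (s * t) * (F x * G x)) by apply: integZ; exact: sqintM.
    have i3 : integ (fun x => t ^+ 2 * G x ^+ 2) by apply: integZ; exact: sqint_sqr.
    rewrite -E_B// -E_D//; last exact: integB.
    by apply: eq_Rintegral => x _; ring.
  by apply: E_ge0 => x; exact: sqr_ge0.
have a0 : 0 <= a by apply: E_ge0 => x; exact: sqr_ge0.
have c0 : 0 <= c by apply: E_ge0 => x; exact: sqr_ge0.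
have [c_eq|cp] := eqVneq c 0.
  rewrite c_eq mulr0.
  have [->|bn] := eqVneq b 0; first by rewrite expr0n.
  (* When [c = 0] the form is affine in [t], and this [t] gives it the value [-1]. *)
  have := h 1 ((a + 1) / (2 * b)); rewrite c_eq mulr0 addr0 expr1n mul1r.
  have -> : 2 * (1 * ((a + 1) / (2 * b))) * b = a + 1 by field.
  lra.
have := h c b.
have -> : c ^+ 2 * a - 2 * (c * b) * b + b ^+ 2 * c = c * (a * c - b ^+ 2) by ring.
by rewrite pmulr_rge0 ?subr_ge0// lt_neqAle eq_sym cp.
Qed.

Definition nrm (F : T -> R) : R := Num.sqrt ('E (fun x => F x ^+ 2)).

Lemma nrm_ge0 F : 0 <= nrm F. Proof. exact: sqrtr_ge0. Qed.

Lemma nrm_sqr F : nrm F ^+ 2 = 'E (fun x => F x ^+ 2).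
Proof. by rewrite /nrm sqr_sqrtr// E_ge0// => x; exact: sqr_ge0. Qed.

Lemma E_CS_nrm F G : sqint P F -> sqint P G ->
  `|'E (fun x => F x * G x)| <= nrm F * nrm G.
Proof.
move=> sF sG; rewrite -(@ler_pXn2r _ 2)// ?nnegrE ?mulr_ge0 ?nrm_ge0//.
by rewrite real_normK ?num_real// exprMn !nrm_sqr; exact: E_CS.
Qed.

Lemma nrmD F G : sqint P F -> sqint P G -> nrm (fun x => F x + G x) <= nrm F + nrm G.
Proof.
move=> sF sG; rewrite -(@ler_pXn2r _ 2)// ?nnegrE ?addr_ge0 ?nrm_ge0//.
rewrite nrm_sqr sqrrD !nrm_sqr.
under eq_Rintegral do rewrite sqrrD mulr2n.
rewrite !E_D ?mulr2n; try exact: sqint_sqr; try exact: sqintM.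
- rewrite lerD2r lerD2l.
  by apply: lerD; exact: le_trans (ler_norm _) (E_CS_nrm _ _).
- by apply: integD; exact: sqintM.
- by apply: integD; [exact: sqint_sqr|apply: integD; exact: sqintM].
Qed.

Lemma E_abs_nrm F : sqint P F -> 'E (fun x => `|F x|) <= nrm F.
Proof.
move=> sF.
have sA : sqint P (fun x => `|F x|).
  split; first by apply: measurableT_comp => //; case: sF.
  by under [X in EFin \o X]eq_fun do rewrite real_normK ?num_real//; case: sF.
have := E_CS_nrm sA (sqint_bmeas (bmeas_cst 1)).
under eq_Rintegral do rewrite mulr1.
have -> : nrm (fun=> 1) = 1 by rewrite /nrm expr1n E_cst sqrtr1.
rewrite mulr1 => /(le_trans (ler_norm _)) /le_trans; apply.
by rewrite /nrm; under eq_Rintegral do rewrite real_normK ?num_real//.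
Qed.

Lemma E_DCT (Fn : nat -> T -> R) (F G : T -> R) :
  (forall n, measurable_fun setT (Fn n)) -> measurable_fun setT F ->
  integ G -> (forall n x, `|Fn n x| <= G x) ->
  {ae P, forall x, Fn n x @[n --> \oo] --> F x} ->
  'E (Fn n) @[n --> \oo] --> 'E F.
Proof.
move=> mFn mF iG dom cv.
have [||||| iF _ h] := @dominated_convergence _ _ _ P setT measurableT
   (fun n => EFin \o Fn n) (EFin \o F) (EFin \o G).
- by move=> n; apply/measurable_EFinP.
- exact/measurable_EFinP.
- by apply: filterS cv => x cx _; apply: cvg_EFin => //; exact: nearW.
- exact: iG.
- by apply: nearW => x n _ /=; rewrite lee_fin.
by apply: fine_cvg; rewrite -E_EFin.
Qed.

Lemma E_ae_eq F G : measurable_fun setT F -> measurable_fun setT G ->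
  {ae P, forall x, F x = G x} -> 'E F = 'E G.
Proof.
move=> mF mG h; congr fine; apply: ae_eq_integral => //;
  [exact/measurable_EFinP|exact/measurable_EFinP|].
by apply: filterS h => x -> _.
Qed.

Lemma E_abs_eq0 F : integ F -> 'E (fun x => `|F x|) = 0 -> {ae P, forall x, F x = 0}.
Proof.
move=> iF h.
have : (\int[P]_x `|(F x)%:E| = 0)%E.
  under eq_integral do rewrite abse_EFin.
  by rewrite E_EFin ?h//; exact: integ_abs.
move/(ae_eq_integral_abs P measurableT (measurable_int _ iF)).
by apply: filterS => x /(_ I) [].
Qed.

(** Monotone convergence: the squares of the truncations increase with [n]. Membership in L2 is thus
    derived from bounds on bounded functions. *)
Lemma sqint_of_trunc F C : measurable_fun setT F ->
  (forall n, 'E (fun x => trunc n (F x) ^+ 2) <= C) ->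
  sqint P F /\ 'E (fun x => F x ^+ 2) <= C.
Proof.
move=> mF hC.
have mt n : measurable_fun setT (fun x => trunc n (F x) ^+ 2).
  by apply: measurable_funX; have [] := bmeas_trunc n mF.
have it n : integ (fun x => trunc n (F x) ^+ 2).
  exact/sqint_sqr/sqint_bmeas/bmeas_trunc.
have cv : (\int[P]_x (trunc n (F x) ^+ 2)%:E @[n --> \oo] --> \int[P]_x (F x ^+ 2)%:E)%E.
  have -> : (fun x => (F x ^+ 2)%:E) = (fun x => limn (fun n => (trunc n (F x) ^+ 2)%:E)).
    apply/funext => x; apply/esym/cvg_lim => //; apply: cvg_EFin; first exact: nearW.
    rewrite expr2; under eq_fun do rewrite expr2.
    by apply: cvgM; exact: cvg_trunc.
  apply: cvg_monotone_convergence => //.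
  - by move=> n; apply/measurable_EFinP.
  - by move=> n x _; rewrite lee_fin sqr_ge0.
  - move=> x _ n m nm; rewrite lee_fin /trunc.
    case: ifP => [h1|_]; last by rewrite expr0n /= sqr_ge0.
    by rewrite ifT// (le_trans h1)// ler_nat.
have le : (\int[P]_x (F x ^+ 2)%:E <= C%:E)%E.
  rewrite -(cvg_lim _ cv)//; apply: lime_le; first by apply/cvg_ex; eexists; exact: cv.
  apply: nearW => n /=.
  by rewrite E_EFin// lee_fin.
have sF : sqint P F.
  split=> //; apply/integrableP; split; first exact/measurable_EFinP/measurable_funX.
  under eq_integral do rewrite gee0_abs ?lee_fin ?sqr_ge0//.
  exact: le_lt_trans le (ltry _).
by split=> //; rewrite -lee_fin -E_EFin//; case: sF.
Qed.

End toolkit.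

(** * Image laws and monotone classes *)

Section law.
Context {d d'} {T : measurableType d} {T' : measurableType d'} {R : realType}.
Variables (P : probability T R) (P' : probability T' R) (phi : T -> T').
Hypothesis mphi : measurable_fun setT phi.
Hypothesis law : forall A, measurable A -> P' A = P (phi @^-1` A).

Lemma ge0_integral_law (f : T' -> \bar R) : measurable_fun setT f ->
  (forall x, (0 <= f x)%E) -> (\int[P']_x f x = \int[P]_x f (phi x))%E.
Proof.
move=> mf f0; transitivity (\int[pushforward P phi]_x f x)%E.
  by apply: eq_measure_integral => A mA _; first [exact: law|exact/esym/law].
by rewrite ge0_integral_pushforward.
Qed.

Lemma integral_law (f : T' -> \bar R) : measurable_fun setT f ->
  (\int[P']_x f x = \int[P]_x f (phi x))%E.
Proof.
move=> mf; rewrite integralE [RHS]integralE; congr (_ - _)%E.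
  rewrite (ge0_integral_law (measurable_funepos mf))//.
  by apply: eq_integral => x _; rewrite !funeposE.
rewrite (ge0_integral_law (measurable_funeneg mf))//.
by apply: eq_integral => x _; rewrite !funenegE.
Qed.

Lemma E_law (F : T' -> R) : measurable_fun setT F ->
  \int[P']_x F x = \int[P]_x F (phi x).
Proof.
move=> mF; congr fine; apply: (integral_law (f := EFin \o F)).
exact/measurable_EFinP.
Qed.

Lemma integ_law (F : T' -> R) : measurable_fun setT F ->
  P'.-integrable setT (EFin \o F) <-> P.-integrable setT (EFin \o (fun x => F (phi x))).
Proof.
move=> mF.
have e : (\int[P']_x `|(F x)%:E| = \int[P]_x `|(F (phi x))%:E|)%E.
  rewrite (ge0_integral_law (f := fun x => `|(F x)%:E|%E))//.
  by apply: measurableT_comp => //; exact/measurable_EFinP.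
split=> /integrableP[_ h]; apply/integrableP; split.
- by apply/measurable_EFinP; exact: measurableT_comp mphi.
- by rewrite /= -e.
- exact/measurable_EFinP.
- by rewrite /= e.
Qed.

Lemma sqint_law (F : T' -> R) : measurable_fun setT F ->
  sqint P' F <-> sqint P (fun x => F (phi x)).
Proof.
move=> mF; split=> -[mF' iF]; split=> //.
- exact: measurableT_comp mphi.
- by apply/(integ_law (F := fun x => F x ^+ 2)) => //; exact: measurable_funX.
- by apply/integ_law => //; exact: measurable_funX.
Qed.

End law.

Lemma bmeas_indic {d} {T : measurableType d} {R : realType} (A : set T) :
  measurable A -> bmeas (\1_A : T -> R).
Proof.
move=> mA; split; first exact: measurable_indic.
by exists 1 => x; rewrite indicE; case: (x \in A); rewrite ?normr1 ?normr0.
Qed.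

Lemma cvg_sum_indic {T : Type} {R : realType} (F : (set T)^nat) (x : T) :
  trivIset setT F ->
  \sum_(i < n) (\1_(F i) x : R) @[n --> \oo] --> (\1_(\bigcup_k F k) x : R).
Proof.
move=> tF; have [[k _ Fk]|nF] := pselect ((\bigcup_k F k) x).
  rewrite indicE mem_set; last by exists k.
  apply: cvg_near_cst; exists k.+1 => // n /= kn.
  rewrite (bigD1 (Ordinal kn))//= indicE mem_set// big1 ?addr0// => i ik.
  rewrite indicE memNset// => Fi; move/negP: ik; apply.
  apply/eqP/val_inj => /=; apply: tF => //; by exists x.
rewrite indicE memNset//; apply: cvg_near_cst; apply: nearW => n.
rewrite big1// => i _; rewrite indicE memNset// => Fi; apply: nF; by exists i.
Qed.

Section monotone_class.
Context {d} {T : measurableType d} {R : realType}.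
Variables (G : set (set T)) (H : (T -> R) -> Prop).
Hypotheses (mG : @measurable _ T = <<s G >>) (GI : setI_closed G).
Hypothesis HG : forall C, G C -> H \1_C.
Hypothesis H1 : H (fun=> 1).
Hypothesis HD : forall a F F', bmeas F -> bmeas F' -> H F -> H F' ->
  H (fun x => F x + a * F' x).
Hypothesis Hlim : forall (Fn : nat -> T -> R) (F : T -> R) (M : R),
  (forall n, bmeas (Fn n)) -> (forall n, H (Fn n)) -> bmeas F ->
  (forall n x, `|Fn n x| <= M) -> (forall x, Fn n x @[n --> \oo] --> F x) -> H F.
Import HBNNSimple.

Let HZ a F : bmeas F -> H F -> H (fun x => a * F x).
Proof.
(* [HD] is the only linear closure rule; a multiple [a * F] is reached as [F + (a - 1) * F]. *)
move=> bF hF; have := HD (a - 1) bF bF hF hF.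
by congr H; apply/funext => x; ring.
Qed.

Let H0 : H (fun=> 0).
Proof.
have := HZ 0 (bmeas_cst 1) H1.
by congr H; apply/funext => x; rewrite mul0r.
Qed.

Let Hsum (I : Type) (s : seq I) (F : I -> T -> R) :
  (forall i, bmeas (F i)) -> (forall i, H (F i)) -> H (fun x => \sum_(i <- s) F i x).
Proof.
move=> bF hF; elim: s => [|i s ih].
  by under eq_fun do rewrite big_nil; exact: H0.
under eq_fun do rewrite big_cons.
have := HD 1 (bF i) (bmeas_sum s bF) (hF i) ih.
by congr H; apply/funext => x; rewrite mul1r.
Qed.

Let Hindic C : measurable C -> H \1_C.
Proof.
rewrite mG; move: C; apply: (dynkin_induction mG GI).
- by rewrite indicT.
- exact: HG.
- move=> C mC hC.
  have := HD (-1) (bmeas_cst 1) (bmeas_indic mC) H1 hC.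
  congr H; apply/funext => x; rewrite indicC indicE.
  by case: (x \in C) => /=; ring.
- move=> F mF tF hF.
  have bF i : bmeas (\1_(F i) : T -> R) by exact: bmeas_indic.
  apply: (@Hlim (fun n x => \sum_(i < n) \1_(F i) x) _ 1).
  + by move=> n; apply: bmeas_sum => i; exact: bF.
  + by move=> n; apply: Hsum => i; [exact: bF|exact: hF].
  + by apply: bmeas_indic; exact: bigcupT_measurable.
  + move=> n x.
    have nd : nondecreasing_seq (fun n => \sum_(i < n) (\1_(F i) x : R)).
      apply/nondecreasing_seqP => k; rewrite big_ord_recr/= lerDl.
      by rewrite indicE; case: (_ \in _).
    have cv := @cvg_sum_indic _ R F x tF.
    rewrite ger0_norm; last by apply: sumr_ge0 => i _; rewrite indicE; case: (_ \in _).
    have /nondecreasing_cvgn_le/(_ (ltac:(by apply/cvg_ex; eexists; exact: cv)) n) := nd.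
    rewrite (cvg_lim _ cv)// => /le_trans; apply.
    by rewrite indicE; case: (_ \in _).
  + by move=> x; exact: cvg_sum_indic.
Qed.

Let Hnneg F : bmeas F -> (forall x, 0 <= F x) -> H F.
Proof.
move=> bF F0; have [mF [M hM]] := bF.
have mF' : measurable_fun setT (EFin \o F) by exact/measurable_EFinP.
pose f := nnsfun_approx measurableT mF'.
have cf y : f n y @[n --> \oo] --> F y.
  apply: (@fine_cvg _ _ _ _ (fun n => (f n y)%:E)).
  by apply: (cvg_nnsfun_approx measurableT mF') => // z _; rewrite lee_fin.
have fle n y : `|f n y| <= M.
  have nd : nondecreasing_seq (fun n => f n y).
    by move=> a b ab; have /lefP := nd_nnsfun_approx measurableT mF' ab; exact.
  have /nondecreasing_cvgn_le/(_ (ltac:(by apply/cvg_ex; eexists; exact: cf)) n) := nd.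
  rewrite (cvg_lim _ (cf y))// ger0_norm// => /le_trans; apply.
  exact: le_trans (ler_norm _) (hM y).
have fE n : exists s : seq R, (f n : T -> R) =
    fun x => \sum_(y <- s) y * \1_(f n @^-1` [set y]) x.
  by eexists; apply/funext => x; rewrite fimfunE fsbig_finite.
have bi n y : bmeas (\1_(f n @^-1` [set y]) : T -> R) by exact: bmeas_indic.
apply: (Hlim (Fn := fun n => f n) (M := M)) => //.
- by move=> n; have [s ->] := fE n; apply: bmeas_sum => y; exact: bmeasZ.
- move=> n; have [s ->] := fE n; apply: Hsum => y; first exact: bmeasZ.
  by apply: HZ => //; exact: Hindic.
Qed.

(** Dynkin's theorem yields all measurable indicators, linearity the simple functions, and bounded
    limits the nonnegative functions. Adding the bound [M] reduces a signed function to these. *)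
Lemma monotone_class F : bmeas F -> H F.
Proof.
move=> bF; have [mF [M hM]] := bF.
have b : bmeas (fun x => F x + M) by apply: bmeasD => //; exact: bmeas_cst.
have hp : H (fun x => F x + M).
  by apply: Hnneg => // x; have := hM x; rewrite ler_norml; lra.
have := HD (- M) b (bmeas_cst 1) hp H1.
by congr H; apply/funext => x; ring.
Qed.

End monotone_class.

Lemma cvg_E_bounded {d} {T : measurableType d} {R : realType} (P : probability T R)
    (Z : T -> R) (Fn : nat -> T -> R) (F : T -> R) (M : R) :
  P.-integrable setT (EFin \o Z) ->
  (forall n, measurable_fun setT (Fn n)) -> measurable_fun setT F ->
  (forall n x, `|Fn n x| <= M) -> (forall x, Fn n x @[n --> \oo] --> F x) ->
  \int[P]_x (Z x * Fn n x) @[n --> \oo] --> \int[P]_x (Z x * F x).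
Proof.
move=> iZ mFn mF hM cv; have mZ := integ_measurable iZ.
apply: (@E_DCT _ _ _ P _ _ (fun x => M * `|Z x|)).
- by move=> n; exact: measurable_funM.
- exact: measurable_funM.
- exact/integZ/integ_abs.
- by move=> n x; rewrite normrM mulrC ler_wpM2r.
- by apply: nearW => x; apply: cvgM; [exact: cvg_cst|exact: cv].
Qed.

(** * Identities between expectations, extended from a pi-system to test functions *)

Section conditional.
Context {d} {T : measurableType d} {R : realType}.
Variable P : probability T R.
Notation "''E' F" := (Rintegral P setT F) (at level 10, F at level 9) : ring_scope.
Notation integ F := (P.-integrable setT (EFin \o F)).
Context {d'} {T' : measurableType d'}.

Lemma E_indic (Z : T -> R) A :
  'E (fun x => Z x * \1_A x) = fine (\int[P]_(x in A) (Z x)%:E)%E.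
Proof.
rewrite -[in RHS](setTI A) integral_mkcondr; congr fine.
apply: eq_integral => x _; rewrite patchE/= indicE; case: (x \in A); rewrite ?mulr1//.
by rewrite mulr0.
Qed.

(** Two weights and two maps occur at once because the Markov identity compares the shifted path,
    weighted by an indicator of the newest state, with the unshifted path weighted by the kernel. *)
Lemma eq_pi_system (G : set (set T')) (Z1 Z2 : T -> R) (Y1 Y2 : T -> T') (phi : T' -> R) :
  @measurable _ T' = <<s G >> -> setI_closed G -> G setT ->
  integ Z1 -> integ Z2 -> measurable_fun setT Y1 -> measurable_fun setT Y2 -> bmeas phi ->
  (forall B, G B -> 'E (fun x => Z1 x * \1_B (Y1 x)) = 'E (fun x => Z2 x * \1_B (Y2 x))) ->
  'E (fun x => Z1 x * phi (Y1 x)) = 'E (fun x => Z2 x * phi (Y2 x)).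
Proof.
move=> mG GI GT iZ1 iZ2 mY1 mY2 bphi h.
apply: (monotone_class (H := fun phi => 'E (fun x => Z1 x * phi (Y1 x)) =
  'E (fun x => Z2 x * phi (Y2 x))) mG GI) => //.
- by have := h _ GT; rewrite indicT.
- move=> a F F' bF bF' hF hF'.
  have i Z Y G' : integ Z -> measurable_fun setT Y -> bmeas G' ->
      integ (fun x => Z x * G' (Y x)).
    by move=> iZ mY bG; apply: integMb => //; exact: bmeas_comp.
  have e Z Y : integ Z -> measurable_fun setT Y ->
      'E (fun x => Z x * (F (Y x) + a * F' (Y x))) =
      'E (fun x => Z x * F (Y x)) + a * 'E (fun x => Z x * F' (Y x)).
    move=> iZ mY; under eq_Rintegral do rewrite mulrDr mulrCA.
    by rewrite E_D ?E_Z//; [exact: i|exact: i|apply: integZ; exact: i].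
  by rewrite !e// hF hF'.
- move=> Fn F M bFn hFn bF hM cv.
  have c Z Y : integ Z -> measurable_fun setT Y ->
      'E (fun x => Z x * Fn n (Y x)) @[n --> \oo] --> 'E (fun x => Z x * F (Y x)).
    move=> iZ mY; apply: (cvg_E_bounded (M := M)) => //.
    + by move=> n; apply: measurableT_comp => //; case: (bFn n).
    + by apply: measurableT_comp => //; case: bF.
  have c1 := c _ _ iZ1 mY1; have c2 := c _ _ iZ2 mY2.
  rewrite -(cvg_lim _ c1)// -(cvg_lim _ c2)//.
  by congr lim; under eq_fun do rewrite hFn.
Qed.

Lemma orth_pi_system (G : set (set T')) (Z : T -> R) (Y : T -> T') (phi : T' -> R) :
  @measurable _ T' = <<s G >> -> setI_closed G -> G setT ->
  integ Z -> measurable_fun setT Y -> bmeas phi ->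
  (forall B, G B -> 'E (fun x => Z x * \1_B (Y x)) = 0) ->
  'E (fun x => Z x * phi (Y x)) = 0.
Proof.
move=> mG GI GT iZ mY bphi h.
have z (psi : T' -> R) : 'E (fun x => 0 * psi (Y x)) = 0.
  by under eq_Rintegral do rewrite mul0r; rewrite E_cst.
rewrite (@eq_pi_system G Z (fun=> 0) Y Y)//; first exact: integ_cst.
by move=> B GB; rewrite h.
Qed.

Lemma cond_bounded (Z : T -> R) (Y : T -> T') (phi : T' -> R) :
  integ Z -> measurable_fun setT Y -> bmeas phi ->
  (forall B, measurable B -> 'E (fun x => Z x * \1_B (Y x)) = 0) ->
  'E (fun x => Z x * phi (Y x)) = 0.
Proof.
move=> iZ mY bphi h; apply: (orth_pi_system (G := @measurable _ T')) => //.
- by rewrite [RHS]sigma_algebra_id//; exact: sigma_algebra_measurable.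
- by move=> A B mA mB; exact: measurableI.
Qed.

(** Truncate [phi]; the products are dominated by [|Z * phi (Y)|], integrable as a product of two
    square-integrable functions. *)
Lemma orth_sqint_of_bounded (Z : T -> R) (Y : T -> T') (phi : T' -> R) :
  sqint P Z -> measurable_fun setT Y -> measurable_fun setT phi ->
  sqint P (fun x => phi (Y x)) ->
  (forall psi, bmeas psi -> 'E (fun x => Z x * psi (Y x)) = 0) ->
  'E (fun x => Z x * phi (Y x)) = 0.
Proof.
move=> sZ mY mphi sphi h.
have : 'E (fun x => Z x * trunc n (phi (Y x))) @[n --> \oo] --> 'E (fun x => Z x * phi (Y x)).
  apply: (@E_DCT _ _ _ P _ _ (fun x => `|Z x * phi (Y x)|)).
  - move=> n; apply: measurable_funM; first by case: sZ.
    by have [] := bmeas_comp (bmeas_trunc n mphi) mY.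
  - by apply: measurable_funM; [case: sZ|case: sphi].
  - exact/integ_abs/sqintM.
  - by move=> n x; rewrite !normrM ler_wpM2l// trunc_le.
  - by apply: nearW => x; apply: cvgM; [exact: cvg_cst|exact: cvg_trunc].
under eq_fun => n do rewrite (h (fun y => trunc n (phi y)) (bmeas_trunc n mphi)).
by move/cvg_lim => <- //; rewrite lim_cst.
Qed.

End conditional.

(** * Trajectory space *)

Section traj_space.
Context {dS} (S : measurableType dS).

(** Constraints on coordinates [0] to [m] inclusive, the shape in which [markov_chain] and
    [stationary] test events. *)
Definition cyl (m : nat) (B : nat -> set S) : set (nat -> S) :=
  [set p | forall k, (k <= m)%N -> B k (p k)].

Definition cylinders : set (set (nat -> S)) :=
  [set C | exists m B, (forall k, measurable (B k)) /\ C = cyl m B].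

Definition traj := g_sigma_algebraType cylinders.

Lemma cylinders_setI : setI_closed cylinders.
Proof.
move=> _ _ [m [B [mB ->]]] [m' [B' [mB' ->]]].
exists (maxn m m'), (fun k => (if (k <= m)%N then B k else setT) `&`
                              (if (k <= m')%N then B' k else setT)).
split; first by move=> k; apply: measurableI; case: ifP.
apply/seteqP; split => p.
  by move=> [h h'] k _; split; case: ifP => // km; [exact: h|exact: h'].
by move=> h; split=> k km; have := h k; rewrite km leq_max km ?orbT => /(_ isT) [].
Qed.

Lemma cylinders_setT : cylinders setT.
Proof. by exists 0%N, (fun=> setT); split=> //; apply/seteqP; split. Qed.

Lemma measurable_cyl m B : (forall k, measurable (B k)) ->
  measurable (cyl m B : set traj).
Proof. by move=> mB; apply: sub_sigma_algebra; exists m, B. Qed.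

Lemma measurable_coord k : measurable_fun setT (fun p : traj => p k).
Proof.
move=> _ B mB; rewrite setTI.
have -> : (fun p : traj => p k) @^-1` B = cyl k (fun j => if j == k then B else setT).
  apply/seteqP; split => p /=.
    by move=> Bp j _; case: eqP => // ->.
  by move/(_ k (leqnn k)); rewrite eqxx.
by apply: measurable_cyl => j; case: ifP.
Qed.

Lemma measurable_to_traj {d} {X : measurableType d} (f : X -> traj) :
  (forall k, measurable_fun setT (fun x => f x k)) -> measurable_fun setT f.
Proof.
move=> mf; apply: (@measurability _ _ X traj setT f cylinders (erefl _)).
move=> _ [_ [m [B [mB ->]]] <-]; rewrite setTI.
have -> : f @^-1` cyl m B = \bigcap_(k in [set k | (k <= m)%N]) ((fun x => f x k) @^-1` B k).
  by apply/seteqP; split.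
apply: bigcap_measurable; first by exists 0%N.
move=> k _; rewrite -[X in measurable X]setTI; exact: mf.
Qed.

(** Coordinate 0 is the newest time, so [pshift] forgets the newest state and [pcons] lets the chain
    take one more step. *)
Definition pshift (p : traj) : traj := fun k => p k.+1.
Definition pcons (x : S) (p : traj) : traj := fun k => if k is k'.+1 then p k' else x.

Lemma measurable_pshift : measurable_fun setT pshift.
Proof. by apply: measurable_to_traj => k; exact: measurable_coord. Qed.

Lemma iter_pshift n (p : traj) k : iter n pshift p k = p (n + k)%N.
Proof. by elim: n k => // n ih k; rewrite iterS /pshift ih addnS. Qed.

Lemma measurable_iter_pshift n : measurable_fun setT (iter n pshift).
Proof.
apply: measurable_to_traj => k.
rewrite (_ : (fun p => iter n pshift p k) = (fun p : traj => p (n + k)%N)).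
  exact: measurable_coord.
by apply/funext => p; rewrite iter_pshift.
Qed.

Lemma measurable_pcons : measurable_fun setT (fun z : traj * S => pcons z.2 z.1).
Proof.
apply: measurable_to_traj => -[|k] /=; first exact: measurable_snd.
by apply: (measurableT_comp (measurable_coord k)); exact: measurable_fst.
Qed.

Lemma measurable_pcons1 p : measurable_fun setT (pcons ^~ p).
Proof. by apply: measurable_to_traj => -[|k] /=. Qed.

Lemma pshift_pcons x p : pshift (pcons x p) = p.
Proof. by []. Qed.

(** Stated pointwise instead of through a sub-sigma-algebra: integrating out the newest state then
    lowers [m] by one merely by substituting paths. *)
Definition depends (m : nat) {A} (F : traj -> A) :=
  forall p q : traj, (forall k, (k <= m)%N -> p k = q k) -> F p = F q.

Lemma measurable_const_traj : measurable_fun setT (fun s : S => (fun _ => s) : traj).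
Proof. by apply: measurable_to_traj. Qed.

End traj_space.

(** * The transition kernel acting on functions of a path *)

Section kernel.
Context {dS} {S : measurableType dS} {R : realType}.
Variable Q : R.-pker S ~> S.

(** The measure [Q s] under a new name that carries a probability structure, so that the expectation
    lemmas apply to it. *)
Definition kprob (s : S) : set S -> \bar R := Q s.

HB.instance Definition _ s := Measure.copy (kprob s) (Q s).
HB.instance Definition _ s := Measure_isProbability.Build _ _ _ (kprob s) (prob_kernel s).

(** [Q] read at coordinate 0, as a kernel on trajectories; measurability of [kop] comes from
    integrating a function of two variables against it. *)
Definition kcoord (p : traj S) : {measure set S -> \bar R} := Q (p 0%N).

Lemma measurable_kcoord U : measurable U -> measurable_fun setT (kcoord ^~ U).
Proof.
move=> mU; apply: (measurableT_comp (measurable_kernel Q U mU)).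
exact: measurable_coord.
Qed.

HB.instance Definition _ := isKernel.Build _ _ _ _ _ kcoord measurable_kcoord.

Lemma kcoord_prob p : kcoord p setT = 1%E.
Proof. exact: prob_kernel. Qed.

HB.instance Definition _ := Kernel_isProbability.Build _ _ _ _ _ kcoord kcoord_prob.

(** The conditional expectation of [F] of the path one step later, given that the path so far is
    [p]. *)
Definition kop (F : traj S -> R) (p : traj S) : R :=
  \int[kprob (p 0%N)]_x F (pcons x p).

Lemma bmeas_pcons (F : traj S -> R) p : bmeas F -> bmeas (fun x => F (pcons x p)).
Proof. by move=> bF; apply: (bmeas_comp bF); exact: measurable_pcons1. Qed.

Lemma kop_bound (F : traj S -> R) (M : R) :
  bmeas F -> (forall p, `|F p| <= M) -> forall p, `|kop F p| <= M.
Proof.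
move=> bF hM p; rewrite /kop.
have i := integ_bmeas (kprob (p 0%N)) (bmeas_pcons p bF).
apply: le_trans (E_abs i) _; rewrite -[leRHS](E_cst (kprob (p 0%N))).
by apply: E_le => //; [exact: integ_abs|exact: integ_cst].
Qed.

Lemma kopD a (F G : traj S -> R) : bmeas F -> bmeas G ->
  kop (fun p => F p + a * G p) = (fun p => kop F p + a * kop G p).
Proof.
move=> bF bG; apply/funext => p; rewrite /kop.
have i1 := integ_bmeas (kprob (p 0%N)) (bmeas_pcons p bF).
have i2 := integ_bmeas (kprob (p 0%N)) (bmeas_pcons p bG).
by rewrite E_D ?E_Z//; exact: integZ.
Qed.

Lemma kop_cst c : kop (fun=> c) = (fun=> c).
Proof. by apply/funext => p; rewrite /kop E_cst. Qed.

Lemma bmeas_kop (F : traj S -> R) : bmeas F -> bmeas (kop F).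
Proof.
move=> bF; have [mF [M hM]] := bF; split; last by exists M; exact: kop_bound.
have b : bmeas (fun p => F p + M) by apply: bmeasD => //; exact: bmeas_cst.
(* Adding [M] makes the integrand nonnegative, as measurability of kernel integrals requires. *)
have -> : kop F = (fun p => kop (fun p => F p + M) p - M).
  apply/funext => p.
  have -> : (fun p => F p + M) = (fun p => F p + M * 1) by apply/funext => q; rewrite mulr1.
  by rewrite kopD ?kop_cst//; [ring|exact: bmeas_cst].
apply: measurable_funB => //.
apply: (measurableT_comp (fine_measurable measurableT)).
apply: (measurable_kfcomp kcoord (f := fun z => (F (pcons z.2 z.1) + M)%:E)).
- apply/measurable_EFinP; apply: measurable_funD => //.
  by apply: measurableT_comp => //; exact: measurable_pcons.
- by move=> t; rewrite lee_fin; have := hM (pcons t.2 t.1); rewrite ler_norml; lra.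
Qed.

Lemma kop_cvg (Fn : nat -> traj S -> R) (F : traj S -> R) (M : R) :
  (forall n, bmeas (Fn n)) -> bmeas F -> (forall n p, `|Fn n p| <= M) ->
  (forall p, Fn n p @[n --> \oo] --> F p) ->
  forall p, kop (Fn n) p @[n --> \oo] --> kop F p.
Proof.
move=> bFn bF hM cv p.
apply: (@E_DCT _ _ _ (kprob (p 0%N)) _ _ (fun=> M)) => //.
- by move=> n; case: (bmeas_pcons p (bFn n)).
- by case: (bmeas_pcons p bF).
- exact: integ_cst.
- by apply: nearW => x; exact: cv.
Qed.

Lemma kop_shift F A p : bmeas F -> bmeas A ->
  kop (fun p => F p * A (pshift p)) p = kop F p * A p.
Proof.
move=> bF bA; rewrite /kop.
under eq_Rintegral do rewrite pshift_pcons mulrC.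
by rewrite (E_Z _ (integ_bmeas _ (bmeas_pcons p bF))) mulrC.
Qed.

Lemma depends_kop m F : depends m.+1 F -> depends m (kop F).
Proof.
move=> h p q pq; rewrite /kop pq//; apply: eq_Rintegral => x _; apply: h => -[|k] //= km.
exact: pq.
Qed.

Lemma kop_coord0 (g : S -> R) : kop (fun p => g (p 0%N)) = (fun p => Qop Q g (p 0%N)).
Proof. by []. Qed.

End kernel.

(** Stationarity is invariance under the shift. In the one-step Markov clause the right side
    integrates over [p] where one expects [pshift p]; by invariance both have the same law. *)
Definition markov_traj {dS} {S : measurableType dS} {R : realType}
    (Q : R.-pker S ~> S) (mu : probability (traj S) R) : Prop :=
  (forall A, measurable A -> mu A = mu (@pshift _ S @^-1` A)) /\
  forall (B : set S) m (Bs : nat -> set S),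
    measurable B -> (forall k, measurable (Bs k)) ->
    (mu [set p | B (p 0%N) /\ cyl m Bs (pshift p)] =
     \int[mu]_(p in cyl m Bs) Q (p 0%N) B)%E.

Lemma bmeas_shiftn {dS} {S : measurableType dS} {R : realType} n (F : traj S -> R) : bmeas F -> bmeas (fun p => F (iter n (@pshift _ S) p)).
Proof. by move=> bF; exact: (bmeas_comp bF (measurable_iter_pshift n)). Qed.

Lemma bmeas_coord {dS} {S : measurableType dS} {R : realType} k (g : S -> R) : bmeas g -> bmeas (fun p : traj S => g (p k)).
Proof. by move=> bg; exact: (bmeas_comp bg (measurable_coord k)). Qed.

(** * The Markov property of the path law in functional form *)

Section markov_path.
Context {dS} {S : measurableType dS} {R : realType}.
Variables (Q : R.-pker S ~> S) (mu : probability (traj S) R).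
Notation "''E' F" := (Rintegral mu setT F) (at level 10, F at level 9) : ring_scope.
Notation integ F := (mu.-integrable setT (EFin \o F)).
Hypothesis Hmu : markov_traj Q mu.
Let mu_shift := proj1 Hmu.
Let mu_markov := proj2 Hmu.

Lemma mu_shiftn n A : measurable A -> mu A = mu (iter n (@pshift _ S) @^-1` A).
Proof.
move=> mA; elim: n => // n ->.
rewrite [LHS]mu_shift; last first.
  by rewrite -[X in measurable X]setTI; exact: measurable_iter_pshift.
congr (mu _); apply/seteqP; split=> p; rewrite /preimage /= -iterSr//.
Qed.

Lemma E_shiftn n (F : traj S -> R) : measurable_fun setT F ->
  'E (fun p => F (iter n (@pshift _ S) p)) = 'E F.
Proof.
move=> mF; rewrite [RHS](E_law (measurable_iter_pshift n) (@mu_shiftn n))//.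
Qed.

Lemma integ_shiftn n (F : traj S -> R) : integ F -> integ (fun p => F (iter n (@pshift _ S) p)).
Proof.
move=> iF.
have [h _] := integ_law (measurable_iter_pshift n) (@mu_shiftn n) (integ_measurable iF).
exact: h.
Qed.

Lemma sqint_shiftn n (F : traj S -> R) : sqint mu F ->
  sqint mu (fun p => F (iter n (@pshift _ S) p)).
Proof.
move=> sF.
have [h _] := sqint_law (measurable_iter_pshift n) (@mu_shiftn n) (proj1 sF).
exact: h.
Qed.

Let kop_adj1 (B : set S) (A : traj S -> R) : measurable B -> bmeas A ->
  'E (fun p => \1_B (p 0%N) * A (pshift p)) = 'E (fun p => fine (Q (p 0%N) B) * A p).
Proof.
move=> mB bA.
have bq : bmeas (fun p : traj S => fine (Q (p 0%N) B)).
  have := @bmeas_kop _ _ _ Q _ (bmeas_coord 0 (bmeas_indic mB)).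
  by congr bmeas; apply/funext => p; rewrite /kop /Rintegral integral_indic// setIT.
have bi : bmeas (fun p : traj S => \1_B (p 0%N) : R).
  exact: (bmeas_coord 0 (bmeas_indic mB)).
apply: (@eq_pi_system _ (traj S) R mu _ (traj S) (@cylinders _ S) (fun p => \1_B (p 0%N))
  (fun p => fine (Q (p 0%N) B)) (@pshift _ S) id A (erefl _)
  (@cylinders_setI _ S) (@cylinders_setT _ S)) => //.
- exact: integ_bmeas.
- exact: integ_bmeas.
- exact: measurable_pshift.
- move=> C [m [Bs [mBs ->]]].
  have e : (fun p : traj S => \1_B (p 0%N) * \1_(cyl m Bs) (pshift p) : R) =
      \1_[set p | B (p 0%N) /\ cyl m Bs (pshift p)].
    apply/funext => p; rewrite !indicE -natrM mulnb; congr ((_ : bool)%:R).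
    apply/andP/idP; first by move=> [/set_mem ? /set_mem ?]; apply/mem_set.
    by move=> /set_mem [? ?]; split; apply/mem_set.
  rewrite e E_indic.
  have mC : measurable [set p : traj S | B (p 0%N) /\ cyl m Bs (pshift p)].
    rewrite (_ : mkset _ = ((fun p : traj S => p 0%N) @^-1` B) `&`
                           (@pshift _ S @^-1` cyl m Bs)); last by [].
    apply: measurableI.
      by rewrite -[X in measurable X]setTI; exact: measurable_coord.
    rewrite -[X in measurable X]setTI; apply: measurable_pshift => //.
    exact: measurable_cyl.
  transitivity (fine (mu [set p | B (p 0%N) /\ cyl m Bs (pshift p)])).
    by rewrite /Rintegral integral_indic// setIT.
  rewrite mu_markov//; congr fine.
  by apply: eq_integral => p _; rewrite fineK//; exact: (fin_num_measure (kprob Q (p 0%N))).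
Qed.

(** Monotone class in [F]: on a cylinder the constraints beyond coordinate 0 are a function of
    [pshift p], so they are absorbed into [A], and only an indicator of coordinate 0 remains. *)
Lemma kop_adj F A : bmeas F -> bmeas A ->
  'E (fun p => F p * A (pshift p)) = 'E (fun p => kop Q F p * A p).
Proof.
move=> bF; move: A.
have bs (A : traj S -> R) : bmeas A -> bmeas (fun p : traj S => A (pshift p)).
  by move=> bA; exact: (bmeas_comp bA (@measurable_pshift _ S)).
apply: (@monotone_class _ (traj S) R (@cylinders _ S) (fun F => forall A, bmeas A ->
  'E (fun p => F p * A (pshift p)) = 'E (fun p => kop Q F p * A p)) (erefl _)
  (@cylinders_setI _ S)) => //.
- move=> _ [m [Bs [mBs ->]]] A bA.
  (* The constraints of the cylinder after removal of coordinate 0. When [m = 0] the index [m.-1] is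
     still 0, and the default [setT] leaves that coordinate free. *)
  pose C : set (traj S) := cyl m.-1 (fun k => if (k.+1 <= m)%N then Bs k.+1 else setT).
  have mC : measurable C by apply: measurable_cyl => k; case: ifP.
  have bB : bmeas (fun p : traj S => \1_(Bs 0%N) (p 0%N) : R).
    exact: (bmeas_coord 0 (bmeas_indic (mBs 0%N))).
  have e : (\1_(cyl m Bs) : traj S -> R) =
      (fun p => \1_(Bs 0%N) (p 0%N) * \1_C (pshift p)).
    apply/funext => p; rewrite !indicE -natrM mulnb; congr ((_ : bool)%:R).
    apply/idP/andP.
      move=> /set_mem h; split; apply/mem_set; first exact: h.
      by move=> k _; case: ifP => // km; exact: h.
    move=> [/set_mem h0 /set_mem h]; apply/mem_set => -[|k] km //.
    by have := h k; rewrite km; apply; rewrite -ltnS (ltn_predK km).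
  rewrite e.
  transitivity ('E (fun p => \1_(Bs 0%N) (p 0%N) * (\1_C (pshift p) * A (pshift p)))).
    by apply: eq_Rintegral => p _; rewrite mulrA.
  rewrite (@kop_adj1 _ (fun p => \1_C p * A p))//; last first.
    by apply: bmeasM => //; exact: bmeas_indic.
  apply: eq_Rintegral => p _; rewrite kop_shift//; last exact: bmeas_indic.
  rewrite mulrA; congr (_ * _ * _).
  by rewrite /kop /Rintegral integral_indic// setIT.
- move=> A bA; rewrite kop_cst.
  under eq_Rintegral do rewrite mul1r.
  under [RHS]eq_Rintegral do rewrite mul1r.
  by have := @E_shiftn 1 A; apply; case: bA.
- move=> a F1 F2 b1 b2 h1 h2 A bA; rewrite kopD//.
  have e (G1 G2 B : traj S -> R) : bmeas G1 -> bmeas G2 -> bmeas B ->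
      'E (fun p => (G1 p + a * G2 p) * B p) =
      'E (fun p => G1 p * B p) + a * 'E (fun p => G2 p * B p).
    move=> bG1 bG2 bB; under eq_Rintegral do rewrite mulrDl -mulrA.
    have i G : bmeas G -> integ (fun p => G p * B p).
      by move=> bG; apply: integ_bmeas; exact: bmeasM.
    by rewrite E_D ?E_Z//; [exact: i|exact: i|apply: integZ; exact: i].
  rewrite !e ?h1 ?h2//; try exact: bmeas_kop.
  exact: bs.
- move=> Fn F' M bFn hFn bF' hM cv A bA.
  have c1 : 'E (fun p => Fn n p * A (pshift p)) @[n --> \oo] --> 'E (fun p => F' p * A (pshift p)).
    rewrite (_ : (fun p => F' p * _) = (fun p => A (pshift p) * F' p)); last first.
      by apply/funext => p; rewrite mulrC.
    under eq_fun do under eq_Rintegral do rewrite mulrC.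
    apply: (cvg_E_bounded (M := M)) => //.
    + by apply: integ_bmeas; exact: bs.
    + by move=> n; case: (bFn n).
    + by case: bF'.
  have c2 : 'E (fun p => kop Q (Fn n) p * A p) @[n --> \oo] --> 'E (fun p => kop Q F' p * A p).
    rewrite (_ : (fun p => kop Q F' p * _) = (fun p => A p * kop Q F' p)); last first.
      by apply/funext => p; rewrite mulrC.
    under eq_fun do under eq_Rintegral do rewrite mulrC.
    apply: (cvg_E_bounded (M := M)) => //.
    + exact: integ_bmeas.
    + by move=> n; case: (bmeas_kop Q (bFn n)).
    + by case: (bmeas_kop Q bF').
    + by move=> n; exact: kop_bound.
    + exact: (kop_cvg bFn bF' hM cv).
  rewrite -(cvg_lim _ c1)// -(cvg_lim _ c2)//.
  by congr lim; under eq_fun do rewrite hFn//.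
Qed.

Lemma bmeas_iter_kop n F : bmeas F -> bmeas (iter n (kop Q) F).
Proof. by move=> bF; elim: n => // n ih; exact: bmeas_kop. Qed.

Lemma kopn_adj n F A : bmeas F -> bmeas A ->
  'E (fun p => F p * A (iter n (@pshift _ S) p)) = 'E (fun p => iter n (kop Q) F p * A p).
Proof.
elim: n F => // n ih F bF bA; rewrite iterSr -ih//; last exact: bmeas_kop.
rewrite -kop_adj//; last exact: bmeas_shiftn.
by apply: eq_Rintegral => p _; rewrite iterSr.
Qed.

Lemma depends_iter_kop n F : depends n F -> depends 0 (iter n (kop Q) F).
Proof.
elim: n F => // n ih F h; rewrite iterSr; apply: ih; exact: depends_kop.
Qed.

(** [kappa (p n)] is the conditional expectation of [F] given the coordinates from [n] on. Each
    [kop] removes one coordinate; after [n] of them only coordinate 0 matters, and evaluating on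
    constant paths gives a function on [S]. *)
Lemma cond_kernel n F : bmeas F -> depends n F ->
  exists2 kappa : S -> R, bmeas kappa & forall A, bmeas A ->
    'E (fun p => F p * A (iter n (@pshift _ S) p)) = 'E (fun p => kappa (p 0%N) * A p).
Proof.
move=> bF dF; exists (fun s => iter n (kop Q) F (fun=> s)).
  by apply: (bmeas_comp (bmeas_iter_kop n bF)); exact: measurable_const_traj.
move=> A bA; rewrite kopn_adj//; apply: eq_Rintegral => p _; congr (_ * _).
by apply: (depends_iter_kop dF) => k; rewrite leqn0 => /eqP ->.
Qed.

Lemma iter_kop_coord0 n (g : S -> R) :
  iter n (kop Q) (fun p => g (p 0%N)) = (fun p => iter n (Qop Q) g (p 0%N)).
Proof. by elim: n => // n ih; rewrite iterS ih kop_coord0. Qed.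

Lemma bmeas_Qop n (g : S -> R) : bmeas g -> bmeas (iter n (Qop Q) g).
Proof.
move=> bg.
have := bmeas_comp (bmeas_iter_kop n (bmeas_coord 0 bg)) (@measurable_const_traj _ S).
by rewrite iter_kop_coord0.
Qed.

Lemma Qopn_adj n (g : S -> R) A : bmeas g -> bmeas A ->
  'E (fun p => g (p 0%N) * A (iter n (@pshift _ S) p)) =
  'E (fun p => iter n (Qop Q) g (p 0%N) * A p).
Proof. by move=> bg bA; rewrite kopn_adj ?iter_kop_coord0//; exact: bmeas_coord. Qed.

Lemma E_trunc_cvg (Z : traj S -> R) : integ Z ->
  'E (fun p => `|Z p - trunc k (Z p)|) @[k --> \oo] --> (0 : R).
Proof.
move=> iZ; have mZ := integ_measurable iZ.
have -> : (0 : R) = 'E (fun=> 0) by rewrite E_cst.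
apply: (@E_DCT _ _ _ mu _ _ (fun p => `|Z p|)).
- move=> k; apply: measurableT_comp => //; apply: measurable_funB => //.
  by case: (bmeas_trunc k mZ).
- by [].
- exact: integ_abs.
- by move=> k p; rewrite normr_id /trunc; case: ifP; rewrite ?subrr ?normr0 ?subr0.
- apply: nearW => p; rewrite -(normr0 R); apply: cvg_norm.
  by rewrite -[X in _ --> X](subrr (Z p)); apply: cvgB; [exact: cvg_cst|exact: cvg_trunc].
Qed.

(* The truncations of [Z] have conditional expectations tending to [0] in mean, which is
   checked by testing against the sign of that conditional expectation. *)
Lemma orth_depends n (Z : traj S -> R) : integ Z -> depends n Z ->
  (forall a : S -> R, bmeas a -> 'E (fun p => Z p * a (p n)) = 0) ->
  forall A, bmeas A -> 'E (fun p => Z p * A (iter n (@pshift _ S) p)) = 0.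
Proof.
move=> iZ dZ hZ A bA; have mZ := integ_measurable iZ.
have [mA [M hM]] := bA.
have bAn := bmeas_shiftn n bA.
pose e k := 'E (fun p => `|Z p - trunc k (Z p)|).
have bt k : bmeas (fun p => trunc k (Z p)) by exact: bmeas_trunc.
have it k := integ_bmeas mu (bt k).
have id k : integ (fun p => Z p - trunc k (Z p)) by exact: integB.
have M0 : 0 <= M by apply: le_trans (hM point).
have small (a : traj S -> R) (N : R) k : 0 <= N -> bmeas a -> (forall p, `|a p| <= N) ->
    `|'E (fun p => (Z p - trunc k (Z p)) * a p)| <= N * e k.
  move=> N0 ba hN; apply: le_trans (E_abs _) _; first exact: integMb.
  rewrite -E_Z; last exact: integ_abs.
  apply: E_le; [exact/integ_abs/integMb|exact/integZ/integ_abs|].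
  by move=> p; rewrite normrM mulrC ler_wpM2r.
have bound k : `|'E (fun p => Z p * A (iter n (@pshift _ S) p))| <= 2 * M * e k.
  have dk : depends n (fun p => trunc k (Z p)) by move=> p q pq; rewrite (dZ p q pq).
  have [kap bk hk] := cond_kernel (bt k) dk.
  pose a s : R := if 0 <= kap s then 1 else -1.
  have ba : bmeas a.
    split; last by exists 1 => s; rewrite /a; case: ifP; rewrite ?normrN normr1.
    by apply: measurable_fun_ifT => //; apply: measurable_fun_ler => //; case: bk.
  have k1 : 'E (fun p => `|kap (p 0%N)|) <= 1 * e k.
    have -> : 'E (fun p => `|kap (p 0%N)|) = 'E (fun p => kap (p 0%N) * a (p 0%N)).
      apply: eq_Rintegral => p _; rewrite /a; case: ifPn => h.
        by rewrite ger0_norm// mulr1.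
      by rewrite ltr0_norm ?ltNge// mulrN1.
    rewrite -(hk (fun p => a (p 0%N))); last exact: bmeas_coord.
    have ban : bmeas (fun p : traj S => a (p n)) by exact: bmeas_coord.
    have -> : 'E (fun p => trunc k (Z p) * a (iter n (@pshift _ S) p 0%N)) =
              - 'E (fun p => (Z p - trunc k (Z p)) * a (p n)).
      under [in RHS]eq_Rintegral do rewrite mulrBl.
      rewrite E_B ?hZ//; [|exact: integMb|exact: integMb].
      rewrite sub0r opprK; apply: eq_Rintegral => p _.
      by rewrite iter_pshift addn0.
    apply: le_trans (ler_norm _) _; rewrite normrN; apply: small => //.
    by move=> p; rewrite /a; case: ifP; rewrite ?normrN normr1.
  have -> : 'E (fun p => Z p * A (iter n (@pshift _ S) p)) =
     'E (fun p => (Z p - trunc k (Z p)) * A (iter n (@pshift _ S) p)) +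
     'E (fun p => trunc k (Z p) * A (iter n (@pshift _ S) p)).
    rewrite -E_D; [|exact: integMb|exact: integMb].
    by apply: eq_Rintegral => p _; rewrite -mulrDl subrK.
  apply: le_trans (ler_normD _ _) _.
  have -> : 2 * M * e k = M * e k + M * e k by ring.
  apply: lerD; first exact: small.
  rewrite hk//; apply: le_trans (E_abs _) _.
    by apply: integMb => //; apply: integ_bmeas; exact: bmeas_coord.
  apply: le_trans (_ : M * 'E (fun p => `|kap (p 0%N)|) <= _); last first.
    by rewrite ler_wpM2l// -[leRHS]mul1r.
  have ik : integ (fun p => kap (p 0%N)) by apply: integ_bmeas; exact: bmeas_coord.
  rewrite -E_Z; last exact: integ_abs.
  apply: E_le; [exact/integ_abs/integMb|exact/integZ/integ_abs|].
  by move=> p; rewrite normrM mulrC ler_wpM2r.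
apply/eqP; rewrite -normr_le0.
have cv : 2 * M * e k @[k --> \oo] --> (0 : R).
  by rewrite -[X in _ --> X](mulr0 (2 * M)); apply: cvgMr; exact: E_trunc_cvg.
rewrite -(cvg_lim _ cv)//; apply: limr_ge; first by apply/cvg_ex; eexists; exact: cv.
exact: nearW.
Qed.

End markov_path.

(** Cancels a factor that may vanish; it ends the arguments in which a function is paired with
    itself to bound its norm. *)
Lemma ler_of_sqr {R : realType} (x c : R) : 0 <= x -> x ^+ 2 <= c * x -> 0 <= c -> x <= c.
Proof.
move=> x0; rewrite le_eqVlt in x0; case/orP: x0 => [/eqP <- //|x0].
by rewrite expr2 ler_pM2r.
Qed.

(** * Partial sums *)

Section partial_sums.
Context {dS} {S : measurableType dS} {R : realType}.
Variables (Q : R.-pker S ~> S) (mu : probability (traj S) R).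
Hypothesis Hmu : markov_traj Q mu.
Notation "''E' F" := (Rintegral mu setT F) (at level 10, F at level 9) : ring_scope.
Notation integ F := (mu.-integrable setT (EFin \o F)).
Notation theta n := (iter n (@pshift _ S)).
Notation nrm := (nrm mu).

Lemma sqint_coord k (g : S -> R) : measurable_fun setT g ->
  sqint mu (fun p => g (p 0%N)) <-> sqint mu (fun p => g (p k)).
Proof.
move=> mg.
have e : (fun p : traj S => g (p k)) = (fun p => (fun q : traj S => g (q 0%N)) (theta k p)).
  by apply/funext => p; rewrite iter_pshift addn0.
rewrite e; apply: (sqint_law (measurable_iter_pshift k) (@mu_shiftn _ _ _ _ _ Hmu k)).
by apply: measurableT_comp => //; exact: measurable_coord.
Qed.

Lemma nrm_coord k (g : S -> R) : measurable_fun setT g ->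
  nrm (fun p => g (p k)) = nrm (fun p => g (p 0%N)).
Proof.
move=> mg; rewrite /nrm; congr Num.sqrt.
rewrite -[RHS](E_shiftn Hmu k); last first.
  by apply: measurable_funX; apply: measurableT_comp => //; exact: measurable_coord.
by apply: eq_Rintegral => p _; rewrite iter_pshift addn0.
Qed.

Lemma nrm_shiftn n (F : traj S -> R) : measurable_fun setT F ->
  nrm (fun p => F (theta n p)) = nrm F.
Proof.
move=> mF; rewrite /nrm; congr Num.sqrt.
by rewrite (E_shiftn Hmu n (F := fun p => F p ^+ 2))//; exact: measurable_funX.
Qed.

Lemma adj_ext_L2 n (F G A : traj S -> R) : bmeas F -> bmeas G ->
  (forall B, bmeas B -> 'E (fun p => F p * B (theta n p)) = 'E (fun p => G p * B p)) ->
  sqint mu A -> 'E (fun p => F p * A (theta n p)) = 'E (fun p => G p * A p).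
Proof.
move=> bF bG FG sA.
have mA : measurable_fun setT A by case: sA.
have c (h : traj S -> R) m : bmeas h ->
    'E (fun p => h p * trunc k (A (theta m p))) @[k --> \oo] -->
    'E (fun p => h p * A (theta m p)).
  move=> bh; have sm := sqint_shiftn Hmu m sA.
  apply: (@E_DCT _ _ _ mu _ _ (fun p => `|A (theta m p) * h p|)).
  - move=> k; apply: measurable_funM; first by case: bh.
    by case: (bmeas_trunc k (proj1 sm)).
  - by apply: measurable_funM; [case: bh|case: sm].
  - exact/integ_abs/integMb/bh/sqint_integ.
  - by move=> k p; rewrite [leRHS]normrM [leRHS]mulrC normrM ler_wpM2l// trunc_le.
  - by apply: nearW => p; apply: cvgM; [exact: cvg_cst|exact: cvg_trunc].
have c1 := c F n bF; have c2 := c G 0%N bG.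
have e : (fun k => 'E (fun p => F p * trunc k (A (theta n p)))) =
    (fun k => 'E (fun p => G p * trunc k (A (theta 0 p)))).
  by apply/funext => k; rewrite (FG _ (bmeas_trunc k mA)).
by rewrite -(cvg_lim _ c1)// e (cvg_lim _ c2).
Qed.

Lemma Qopn_adj_L2 n (g : S -> R) A : bmeas g -> sqint mu A ->
  'E (fun p => g (p 0%N) * A (theta n p)) = 'E (fun p => iter n (Qop Q) g (p 0%N) * A p).
Proof.
move=> bg; apply: (adj_ext_L2 (F := fun p => g (p 0%N))
  (G := fun p => iter n (Qop Q) g (p 0%N))).
- exact: bmeas_coord.
- exact/bmeas_coord/bmeas_Qop.
- by move=> B bB; exact: (Qopn_adj Hmu).
Qed.

(** By adjointness the squared norm of [Q^n g] is the pairing of [g] with a shift of [Q^n g].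
    Cauchy-Schwarz and shift invariance bound it by the product of the two norms, and one factor
    cancels. *)
Lemma Qopn_contract n (g : S -> R) : bmeas g ->
  nrm (fun p => iter n (Qop Q) g (p 0%N)) <= nrm (fun p => g (p 0%N)).
Proof.
move=> bg; have bq := bmeas_Qop Q n bg.
have b0 := bmeas_coord 0 bg; have q0 := bmeas_coord 0 bq.
apply: ler_of_sqr; rewrite ?nrm_ge0// nrm_sqr.
under eq_Rintegral do rewrite expr2.
rewrite -(Qopn_adj Hmu n bg (A := fun p => iter n (Qop Q) g (p 0%N)))//.
apply: le_trans (ler_norm _) _.
have := E_CS_nrm (sqint_bmeas mu b0) (sqint_bmeas mu (bmeas_shiftn n q0)).
by rewrite (nrm_shiftn n (proj1 q0)).
Qed.

Lemma orth_depends_L2 n (Z A : traj S -> R) : sqint mu Z -> depends n Z ->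
  (forall a : S -> R, bmeas a -> 'E (fun p => Z p * a (p n)) = 0) ->
  sqint mu A -> 'E (fun p => Z p * A (theta n p)) = 0.
Proof.
move=> sZ dZ hZ sA; apply: orth_sqint_of_bounded => //.
- exact: measurable_iter_pshift.
- by case: sA.
- exact: (sqint_shiftn Hmu).
- by move=> psi bpsi; apply: (orth_depends Hmu) => //; exact: sqint_integ.
Qed.

Variable f : S -> R.
Hypotheses (mf : measurable_fun setT f) (sf : sqint mu (fun p => f (p 0%N))).

(** On the path read backwards from time [n], coordinates [0] to [n - 1] are the times [n] down to
    [1]: this is [S_n], and coordinate [n] is the state at time 0. *)
Definition psum n (p : traj S) : R := \sum_(k < n) f (p k).

Lemma psumD m n p : psum (m + n) p = psum m p + psum n (theta m p).
Proof.
rewrite /psum big_split_ord/=; congr (_ + _).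
by apply: eq_bigr => i _; rewrite iter_pshift.
Qed.

Lemma sqint_psum n : sqint mu (psum n).
Proof. by apply: sqint_sum => k; exact/sqint_coord. Qed.

Lemma depends_psum m n : (n <= m.+1)%N -> depends m (psum n).
Proof.
move=> nm p q pq; apply: eq_bigr => k _; rewrite pq//.
by have := leq_trans (ltn_ord k) nm; rewrite ltnS.
Qed.

Lemma depends_coord m k (g : S -> R) : (k <= m)%N -> depends m (fun p => g (p k)).
Proof. by move=> km p q pq; rewrite pq. Qed.

Lemma dependsB m (F G : traj S -> R) : depends m F -> depends m G ->
  depends m (fun p => F p - G p).
Proof. by move=> dF dG p q pq; rewrite (dF p q pq) (dG p q pq). Qed.

End partial_sums.

(** * Norms of the one-sided conditional expectations of partial sums *)

Section cond_sums.
Context {dS} {S : measurableType dS} {R : realType}.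
Variables (Q : R.-pker S ~> S) (mu : probability (traj S) R).
Hypothesis Hmu : markov_traj Q mu.
Notation "''E' F" := (Rintegral mu setT F) (at level 10, F at level 9) : ring_scope.
Notation integ F := (mu.-integrable setT (EFin \o F)).
Notation theta n := (iter n (@pshift _ S)).
Notation nrm := (nrm mu).
Variable f : S -> R.
Hypotheses (mf : measurable_fun setT f) (sf : sqint mu (fun p => f (p 0%N))).
Notation psum := (psum f).

Variables (g0 gn : nat -> S -> R).
Hypothesis mg0 : forall n, (0 < n)%N -> measurable_fun setT (g0 n).
Hypothesis mgn : forall n, (0 < n)%N -> measurable_fun setT (gn n).
Hypothesis sg0 : forall n, (0 < n)%N -> sqint mu (fun p => g0 n (p 0%N)).
Hypothesis sgn : forall n, (0 < n)%N -> sqint mu (fun p => gn n (p 0%N)).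
Hypothesis og0 : forall n, (0 < n)%N -> forall a : S -> R, bmeas a ->
  'E (fun p => (psum n p - g0 n (p n)) * a (p n)) = 0.
Hypothesis ogn : forall n, (0 < n)%N -> forall a : S -> R, bmeas a ->
  'E (fun p => (psum n p - gn n (p 0%N)) * a (p 0%N)) = 0.

(** [al n] and [be n] are the norms of [E(S_n | xi_0)] and [E(S_n | xi_n)]. Stationarity allows
    [g0 n] to be read at coordinate 0 although it belongs to coordinate [n]. *)
Definition al n := nrm (fun p => g0 n (p 0%N)).
Definition be n := nrm (fun p => gn n (p 0%N)).

Let sZ0 n : (0 < n)%N -> sqint mu (fun p => psum n p - g0 n (p n)).
Proof.
move=> n0; apply: sqintB; first exact: (sqint_psum Hmu mf sf).
by apply/(sqint_coord Hmu); [exact: mg0|exact: sg0].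
Qed.

Let E_split (F G H : traj S -> R) : sqint mu F -> sqint mu G -> sqint mu H ->
  'E (fun p => (F p - G p) * H p) = 0 -> 'E (fun p => F p * H p) = 'E (fun p => G p * H p).
Proof.
move=> sF sG sH; under eq_Rintegral do rewrite mulrBl.
by rewrite E_B; [move/eqP; rewrite subr_eq0 => /eqP|exact: sqintM|exact: sqintM].
Qed.

(** Orthogonality to functions of coordinate [m] upgrades, by the Markov property, to orthogonality
    to everything from coordinate [m] on; a shift by [m] then brings that coordinate to 0. *)
Let E_past m (A : traj S -> R) : (0 < m)%N -> sqint mu A ->
  'E (fun p => psum m p * A (theta m p)) = 'E (fun p => g0 m (p 0%N) * A p).
Proof.
move=> m0 sA; have sAm := sqint_shiftn Hmu m sA.
rewrite (E_split (G := fun p => g0 m (p m)))//.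
- rewrite -[RHS](E_shiftn Hmu m); last by apply: measurable_funM; [case: (sg0 m0)|case: sA].
  by apply: eq_Rintegral => p _; rewrite iter_pshift addn0.
- exact: (sqint_psum Hmu mf sf).
- by apply/(sqint_coord Hmu); [exact: mg0|exact: sg0].
- apply: (orth_depends_L2 Hmu) => //; first exact: sZ0.
  + by apply: dependsB; [exact: depends_psum|exact: depends_coord].
  + exact: og0.
Qed.

Let E_fut n (g : S -> R) : (0 < n)%N -> measurable_fun setT g -> sqint mu (fun p => g (p 0%N)) ->
  'E (fun p => psum n p * g (p 0%N)) = 'E (fun p => gn n (p 0%N) * g (p 0%N)).
Proof.
move=> n0 mg sg; apply: E_split => //; [exact: (sqint_psum Hmu mf sf)|exact: sgn|].
apply: (orth_sqint_of_bounded (Y := fun p : traj S => p 0%N)) => //.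
- by apply: sqintB; [exact: (sqint_psum Hmu mf sf)|exact: sgn].
- exact: measurable_coord.
- exact: ogn.
Qed.

(** In the cross term the newer block is first projected on the past and becomes [g0 m] at the
    junction. What multiplies the older block is then a function of its newest state, so that block
    may be replaced by [gn n]. *)
Lemma E_psum2_add m n : (0 < m)%N -> (0 < n)%N ->
  `|'E (fun p => psum (m + n) p ^+ 2) - 'E (fun p => psum m p ^+ 2)
     - 'E (fun p => psum n p ^+ 2)| <= 2 * (al m * be n).
Proof.
move=> m0 n0.
have sm := sqint_psum Hmu mf sf m; have sn := sqint_psum Hmu mf sf n; have snm := sqint_shiftn Hmu m sn.
have -> : 'E (fun p => psum (m + n) p ^+ 2) = 'E (fun p => psum m p ^+ 2) +
   2 * 'E (fun p => psum m p * psum n (theta m p)) + 'E (fun p => psum n p ^+ 2).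
  rewrite -[X in _ + X](E_shiftn Hmu m); last by apply: measurable_funX; case: sn.
  have i1 := sqint_sqr sm; have i2 := sqintM sm snm; have i3 := sqint_sqr snm.
  rewrite -E_Z// -E_D//; last exact: integZ.
  rewrite -E_D//; last by apply: integD => //; exact: integZ.
  by apply: eq_Rintegral => p _; rewrite psumD; ring.
have -> (a b c : R) : a + b + c - a - c = b by ring.
rewrite normrM (ger0_norm (ler0n R 2)) ler_wpM2l ?ler0n// E_past//.
have -> : 'E (fun p => g0 m (p 0%N) * psum n p) = 'E (fun p => psum n p * g0 m (p 0%N)).
  by apply: eq_Rintegral => p _; rewrite mulrC.
rewrite (E_fut (g := g0 m))//; [|exact: mg0|exact: sg0].
rewrite mulrC; exact: E_CS_nrm (sgn n0) (sg0 m0).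
Qed.

(** Pair [S_(m+n)] with its own projection [phi] on the oldest state. Each of the two blocks is
    projected on its past, which costs [al m] or [al n] times the norm of [phi]. *)
Lemma al_subadd m n : (0 < m)%N -> (0 < n)%N -> al (m + n) <= al m + al n.
Proof.
move=> m0 n0; have N0 : (0 < m + n)%N by rewrite addn_gt0 m0.
apply: ler_of_sqr; rewrite ?addr_ge0 ?nrm_ge0//.
set phi := g0 (m + n).
have mphi : measurable_fun setT phi by exact: mg0.
have sphi k : sqint mu (fun p => phi (p k)) by apply/(sqint_coord Hmu) => //; exact: sg0.
have e N : (0 < N)%N -> 'E (fun p => psum N p * phi (p N)) = 'E (fun p => g0 N (p 0%N) * phi (p 0%N)).
  move=> N_gt0; rewrite -(E_past (A := fun p => phi (p 0%N)))//.
  by apply: eq_Rintegral => p _; rewrite iter_pshift addn0.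
have -> : al (m + n) ^+ 2 = 'E (fun p => psum (m + n) p * phi (p (m + n)%N)).
  by rewrite e// nrm_sqr; apply: eq_Rintegral => p _; rewrite expr2.
have -> : 'E (fun p => psum (m + n) p * phi (p (m + n)%N)) =
    'E (fun p => psum m p * phi (p (m + n)%N)) + 'E (fun p => psum n p * phi (p n)).
  rewrite -[X in _ + X](E_shiftn Hmu m); last first.
    by apply: measurable_funM; [case: (sqint_psum Hmu mf sf n)|case: (sphi n)].
  rewrite -E_D.
  - by apply: eq_Rintegral => p _; rewrite psumD mulrDl iter_pshift.
  - by apply: sqintM; [exact: (sqint_psum Hmu mf sf)|exact: sphi].
  - apply: (integ_shiftn Hmu m (F := fun p => psum n p * phi (p n))).
    by apply: sqintM; [exact: (sqint_psum Hmu mf sf)|exact: sphi].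
rewrite mulrDl; apply: lerD.
- have -> : 'E (fun p => psum m p * phi (p (m + n)%N)) = 'E (fun p => g0 m (p 0%N) * phi (p n)).
    rewrite -(E_past (A := fun p => phi (p n)))//.
    by apply: eq_Rintegral => p _; rewrite iter_pshift.
  apply: le_trans (ler_norm _) _; apply: le_trans (E_CS_nrm (sg0 m0) (sphi n)) _.
  by rewrite (nrm_coord Hmu n mphi).
- by rewrite e//; apply: le_trans (ler_norm _) _; exact: E_CS_nrm (sg0 n0) (sphi 0%N).
Qed.

(** Now the test function sits at the newest state, away from the older block. Adjointness carries
    it there as its image under [Q^m], a contraction. As [Q^m] is applied to bounded functions, the
    self-pairing is made with truncations, and the bound passes to the limit. *)
Lemma be_subadd m n : (0 < m)%N -> (0 < n)%N -> be (m + n) <= be m + be n.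
Proof.
move=> m0 n0; have N0 : (0 < m + n)%N by rewrite addn_gt0 m0.
set phi := gn (m + n).
have mphi : measurable_fun setT phi by exact: mgn.
have c0 : 0 <= be m + be n by rewrite addr_ge0 ?nrm_ge0.
suff H k : nrm (fun p => trunc k (phi (p 0%N))) <= be m + be n.
  have mphi0 : measurable_fun setT (fun p : traj S => phi (p 0%N)) by case: (sgn N0).
  have [k|_ h] := @sqint_of_trunc _ _ _ mu _ ((be m + be n) ^+ 2) mphi0.
    by rewrite -nrm_sqr ler_pXn2r// nnegrE nrm_ge0.
  by rewrite -(@ler_pXn2r _ 2)// ?nnegrE ?nrm_ge0// nrm_sqr.
pose phik s := trunc k (phi s).
have bk : bmeas phik by exact: bmeas_trunc.
have sk : sqint mu (fun p => phik (p 0%N)) by exact/sqint_bmeas/bmeas_coord.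
apply: ler_of_sqr; rewrite ?nrm_ge0//.
have -> : nrm (fun p => trunc k (phi (p 0%N))) ^+ 2 = 'E (fun p => psum (m + n) p * phik (p 0%N)).
  rewrite nrm_sqr E_fut//; last by case: bk.
  apply: eq_Rintegral => p _; rewrite /phik /trunc.
  by case: ifP; rewrite ?mulr0 ?expr0n// expr2.
have -> : 'E (fun p => psum (m + n) p * phik (p 0%N)) =
    'E (fun p => psum m p * phik (p 0%N)) + 'E (fun p => phik (p 0%N) * psum n (theta m p)).
  rewrite -E_D.
  - by apply: eq_Rintegral => p _; rewrite psumD; ring.
  - by apply: sqintM => //; exact: (sqint_psum Hmu mf sf).
  - by apply: sqintM => //; apply: (sqint_shiftn Hmu); exact: (sqint_psum Hmu mf sf).
rewrite mulrDl; apply: lerD.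
  rewrite E_fut//; last by case: bk.
  by apply: le_trans (ler_norm _) _; exact: E_CS_nrm (sgn m0) sk.
rewrite (Qopn_adj_L2 Hmu m bk (sqint_psum Hmu mf sf n)).
have bq := bmeas_Qop Q m bk.
have -> : 'E (fun p => iter m (Qop Q) phik (p 0%N) * psum n p) =
   'E (fun p => psum n p * iter m (Qop Q) phik (p 0%N)).
  by apply: eq_Rintegral => p _; rewrite mulrC.
have sq : sqint mu (fun p => iter m (Qop Q) phik (p 0%N)) by exact/sqint_bmeas/bmeas_coord.
rewrite E_fut//; last by case: bq.
apply: le_trans (ler_norm _) _; apply: le_trans (E_CS_nrm (sgn n0) sq) _.
by rewrite ler_wpM2l ?nrm_ge0//; exact: (Qopn_contract Hmu).
Qed.

End cond_sums.

Lemma cauchy_nat_cvg {R : realType} (x : nat -> R) :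
  (forall e, 0 < e -> exists N, forall m n, (N <= m)%N -> (N <= n)%N -> `|x m - x n| < e) ->
  cvgn x.
Proof.
move=> H; apply/cauchy_cvgP/cauchy_ballP => e e0.
have [N h] := H e e0.
exists ([set y | exists2 n, (N <= n)%N & y = x n], [set y | exists2 n, (N <= n)%N & y = x n]).
  by split; exists N => // n /= Nn; exists n.
by move=> [y z] /= [[m Nm ->] [n Nn ->]]; exact: h.
Qed.

(** * Almost additive and superadditive sequences *)

Section almost_additive.
Context {R : realType}.
Variables (V a b : nat -> R).
Hypotheses (a0 : forall n, 0 <= a n) (b0 : forall n, 0 <= b n).
Hypothesis V_add : forall m n, (0 < m)%N -> (0 < n)%N ->
  `|V (m + n)%N - V m - V n| <= 2 * (a m * b n).
Hypothesis a_sub : forall m n, (0 < m)%N -> (0 < n)%N -> a (m + n)%N <= a m + a n.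
Hypothesis b_sub : forall m n, (0 < m)%N -> (0 < n)%N -> b (m + n)%N <= b m + b n.

Let u n := a n ^+ 2 + b n ^+ 2.
Let T N := \sum_(1 <= l < N) u l / l%:R ^+ 2.
Variable C : R.
Hypothesis T_bound : forall N, T N <= C.

Let u_ge0 n : 0 <= u n. Proof. by rewrite addr_ge0 ?sqr_ge0. Qed.

Let u_sub m n : (0 < m)%N -> (0 < n)%N -> u (m + n)%N <= 2 * (u m + u n).
Proof.
move=> m0 n0; rewrite /u.
have := a_sub m0 n0; have := b_sub m0 n0.
have := a0 (m + n)%N; have := b0 (m + n)%N.
have := a0 m; have := a0 n; have := b0 m; have := b0 n.
move: (a (m + n)%N) (a m) (a n) (b (m + n)%N) (b m) (b n) => x y z x' y' z' *.
have h1 : x ^+ 2 <= (y + z) ^+ 2 by rewrite ler_pXn2r// nnegrE addr_ge0.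
have h2 : x' ^+ 2 <= (y' + z') ^+ 2 by rewrite ler_pXn2r// nnegrE addr_ge0.
have := sqr_ge0 (y - z); have := sqr_ge0 (y' - z'); nra.
Qed.

Let V_add_u m n : (0 < m)%N -> (0 < n)%N -> `|V (m + n)%N - V m - V n| <= u m + u n.
Proof.
move=> m0 n0; apply: le_trans (V_add m0 n0) _; rewrite /u.
have := sqr_ge0 (a m - b n); have := sqr_ge0 (a n); have := sqr_ge0 (b m).
by nra.
Qed.

Let T_nd : {homo T : m n / (m <= n)%N >-> m <= n}.
Proof.
apply/nondecreasing_seqP => -[|n]; first by rewrite /T !big_geq.
by rewrite /T [leRHS]big_nat_recr//= lerDl divr_ge0// sqr_ge0.
Qed.

Let Tsup : R := limn T.

Let T_cvg : T @ \oo --> Tsup.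
Proof.
by apply: nondecreasing_is_cvgn; [exact: T_nd|exists C => _ [n _ <-]; exact: T_bound].
Qed.

Let T_le n : T n <= Tsup.
Proof. exact: nondecreasing_cvgn_le T_nd (cvgP _ T_cvg) n. Qed.

(** The tail of the convergent series over indices beyond [n / 3]: a nonincreasing modulus tending
    to 0 that controls all errors below. *)
Let tau n : R := Tsup - T (n %/ 3).+1.

Let tau_ge0 n : 0 <= tau n. Proof. by rewrite subr_ge0; exact: T_le. Qed.

Let tau_ni m n : (m <= n)%N -> tau n <= tau m.
Proof. by move=> mn; rewrite lerD2l lerN2 T_nd// ltnS leq_div2r. Qed.

Let tau_small e : 0 < e -> exists N, forall n, (N <= n)%N -> tau n < e.
Proof.
move=> e0; have /cvgrPdist_lt/(_ e e0) [N _ h] := T_cvg.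
exists (3 * N)%N => n Nn.
have /h /= : (N <= (n %/ 3).+1)%N by apply: leqW; rewrite leq_divRL// mulnC.
by rewrite ger0_norm// subr_ge0; exact: T_le.
Qed.

Let w n := T (n - n %/ 3) - T (n %/ 3).+1.

(** Summability bounds [u] only on average; near-subadditivity makes this pointwise. Average
    [u n <= 2 (u l + u (n - l))] over the middle third, which [l -> n - l] preserves. It has at
    least [n / 6] indices once [n >= 6], and there [u l <= n^2 u l / l^2], whence [24 = 6 * 4]. *)
Let u_le_w n : (6 <= n)%N -> u n / n%:R <= 24 * w n.
Proof.
move=> n6.
set q := (n %/ 3)%N.
have q3 : (3 * q <= n)%N by rewrite mulnC leq_trunc_div.
have q4 : (n < 3 * q.+1)%N by rewrite mulnC ltn_ceil.
have n0 : (0 < n%:R :> R) by rewrite ltr0n; lia.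
have wE : w n = \sum_(q.+1 <= l < n - q) u l / l%:R ^+ 2.
  rewrite /w /T (big_cat_nat (n := q.+1))//=; first by ring.
  by lia.
have cnt : (n%:R / 6) * u n <= (n - q - q.+1)%:R * u n :> R.
  rewrite ler_wpM2r// ler_pdivrMr ?ltr0n// -natrM ler_nat; lia.
have step : (n - q - q.+1)%:R * u n <= 4 * n%:R ^+ 2 * w n.
  have -> : (n - q - q.+1)%:R * u n = \sum_(q.+1 <= l < n - q) u n.
    by rewrite sumr_const_nat mulr_natl.
  apply: le_trans (_ : \sum_(q.+1 <= l < n - q) (2 * u l + 2 * u (n - l)%N) <= _).
    rewrite big_nat_cond [leRHS]big_nat_cond; apply: ler_sum => l; rewrite andbT => /andP[h1 h2].
    have e : n = (l + (n - l))%N by lia.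
    rewrite {1}e; apply: le_trans (u_sub _ _) _; [lia|lia|].
    by rewrite mulrDr.
  rewrite big_split/=.
  have -> : \sum_(q.+1 <= l < n - q) 2 * u (n - l)%N = \sum_(q.+1 <= l < n - q) 2 * u l.
    rewrite [RHS]big_nat_rev/= big_nat_cond [RHS]big_nat_cond; apply: eq_bigr => l.
    by rewrite andbT => /andP[h1 h2]; congr (_ * u _); lia.
  rewrite -big_split/= wE mulr_sumr big_nat_cond [leRHS]big_nat_cond; apply: ler_sum => l.
  rewrite andbT => /andP[h1 h2].
  have l0 : (0 < l%:R :> R) by rewrite ltr0n; lia.
  rewrite mulrA ler_pdivlMr ?exprn_gt0//.
  have -> : 2 * u l + 2 * u l = 4 * u l by ring.
  rewrite [leLHS]mulrAC ler_wpM2r// ler_wpM2l//.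
  by rewrite ler_pXn2r// ?nnegrE// ler_nat; lia.
rewrite ler_pdivrMr//.
have := le_trans cnt step; nra.
Qed.

Let w_le_tau n : w n <= tau n.
Proof. by rewrite lerD2r; exact: T_le. Qed.

Let u_le_tau n : (6 <= n)%N -> u n <= 24 * n%:R * tau n.
Proof.
move=> n6; have n0 : (0 < n%:R :> R) by rewrite ltr0n; lia.
have := u_le_w n6; rewrite ler_pdivrMr// => /le_trans; apply.
by rewrite [leRHS]mulrAC ler_wpM2r// ler_wpM2l// w_le_tau.
Qed.

(** One doubling from [n] costs at most [u n / (2 n) <= 12 w n]. The window of [w n] ends no later
    than the window for [n + n] starts, so the costs telescope and the bound is uniform in [k]. *)
Let dyadic p k : (6 <= p)%N ->
  `|V (2 ^ k * p)%N / (2 ^ k * p)%:R - V p / p%:R| <=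
  12 * (T ((2 ^ k * p) %/ 3).+1 - T (p %/ 3).+1).
Proof.
move=> p6; elim: k => [|k ih].
  by rewrite expn0 mul1n !subrr normr0 mulr0.
set n := (2 ^ k * p)%N in ih *.
have n6 : (6 <= n)%N by apply: leq_trans p6 _; rewrite leq_pmull// expn_gt0.
have n0 : (0 < n%:R :> R) by rewrite ltr0n; lia.
have -> : (2 ^ k.+1 * p = n + n)%N by rewrite expnS /n; lia.
have h1 : `|V (n + n)%N / (n + n)%:R - V n / n%:R| <= 12 * w n.
  have -> : V (n + n)%N / (n + n)%:R - V n / n%:R = (V (n + n)%N - V n - V n) / (2 * n%:R).
    have -> : (n + n)%:R = 2 * n%:R :> R by rewrite natrD; ring.
    by field; rewrite lt0r_neq0.
  rewrite normrM normfV (ger0_norm (ltW (mulr_gt0 _ n0)))//.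
  rewrite ler_pdivrMr ?mulr_gt0//.
  have := V_add (ltac:(lia) : (0 < n)%N) (ltac:(lia) : (0 < n)%N).
  have := u_le_w n6; rewrite ler_pdivrMr// /u.
  have := sqr_ge0 (a n - b n); nra.
have h2 : w n <= T ((n + n) %/ 3).+1 - T (n %/ 3).+1.
  by rewrite lerD2r; apply: T_nd; lia.
apply: le_trans (_ : `|V (n + n)%N / (n + n)%:R - V n / n%:R| + `|V n / n%:R - V p / p%:R| <= _).
  by rewrite -[X in `|X| <= _](subrKA (V n / n%:R)) ler_normD.
lra.
Qed.

Let dyadic_tau p k : (6 <= p)%N ->
  `|V (2 ^ k * p)%N / (2 ^ k * p)%:R - V p / p%:R| <= 12 * tau p.
Proof.
move=> p6; apply: le_trans (dyadic k p6) _.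
by rewrite ler_wpM2l// lerD2r; exact: T_le.
Qed.

(** Adding one block of length [n] at a time gives an error quadratic in [j]. This crude bound is
    applied only with [j] fixed and [n] very large. *)
Let multiple j n : (6 <= n)%N -> (0 < j)%N ->
  `|V (j * n)%N - j%:R * V n| <= 24 * j%:R ^+ 2 * n%:R * tau n.
Proof.
move=> n6; case: j => // j _; elim: j => [|j ih].
  rewrite mul1n mul1r subrr normr0 !mulr_ge0//.
have n0 : (0 < n)%N by lia.
have jn0 : (0 < j.+1 * n)%N by lia.
have -> : (j.+2 * n = j.+1 * n + n)%N by lia.
have h := V_add_u jn0 n0.
have h1 := u_le_tau n6.
have h2 : u (j.+1 * n)%N <= 24 * (j.+1 * n)%:R * tau n.
  apply: le_trans (u_le_tau _) _; first by lia.
  by rewrite ler_wpM2l ?mulr_ge0// tau_ni//; lia.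
have -> : V (j.+1 * n + n)%N - j.+2%:R * V n =
   (V (j.+1 * n + n)%N - V (j.+1 * n)%N - V n) + (V (j.+1 * n)%N - j.+1%:R * V n).
  by rewrite -[j.+2]addn1 natrD; ring.
apply: le_trans (ler_normD _ _) _; apply: le_trans (lerD h ih) _.
apply: le_trans (lerD (lerD h2 h1) (lexx _)) _.
rewrite natrM -[j.+2]addn1 [(j.+1 + 1)%:R]natrD.
have t0 := tau_ge0 n; have j0 : (0 <= j.+1%:R :> R) by [].
have nn0 : (0 <= n%:R :> R) by [].
move: (tau n) (j.+1%:R : R) (n%:R : R) t0 j0 nn0 => t x y t0 x0 y0.
have : 0 <= x * y * t by rewrite !mulr_ge0.
have : 0 <= y * t by rewrite mulr_ge0.
nra.
Qed.

(** Uniformity in [j] comes from doubling both [p] and [j * p] up to a scale where [tau] beats the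
    quadratic error of [multiple]. The scale depends on [j], but each ascent costs at most
    [12 tau p]. *)
Let compare p j : (6 <= p)%N -> (0 < j)%N ->
  `|V (j * p)%N / (j * p)%:R - V p / p%:R| <= 24 * tau p.
Proof.
move=> p6 j0; apply/ler_addgt0Pr => e e0.
have J0 : (0 < j%:R :> R) by rewrite ltr0n.
have e'0 : 0 < e / (24 * j%:R) by rewrite divr_gt0// mulr_gt0.
have [N hN] := tau_small e'0.
set n := (2 ^ N * p)%N.
have n6 : (6 <= n)%N by apply: leq_trans p6 _; rewrite leq_pmull// expn_gt0.
have Nn : (N <= n)%N by apply: leq_trans (ltnW (ltn_expl N (ltnSn 1))) _; rewrite leq_pmulr//; lia.
have h1 := dyadic_tau N p6.
have jp6 : (6 <= j * p)%N by apply: leq_trans p6 _; rewrite leq_pmull.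
have h2 := dyadic_tau N jp6.
have h3 : tau (j * p)%N <= tau p by rewrite tau_ni// leq_pmull.
have n0 : (0 < n%:R :> R) by rewrite ltr0n; lia.
have h4 : `|V (2 ^ N * (j * p))%N / (2 ^ N * (j * p))%:R - V n / n%:R| <= e.
  have -> : (2 ^ N * (j * p) = j * n)%N by rewrite /n; lia.
  have -> : V (j * n)%N / (j * n)%:R - V n / n%:R = (V (j * n)%N - j%:R * V n) / (j%:R * n%:R).
    by rewrite natrM; field; rewrite !lt0r_neq0.
  rewrite normrM normfV (ger0_norm (ltW (mulr_gt0 J0 n0))) ler_pdivrMr ?mulr_gt0//.
  apply: le_trans (multiple n6 j0) _.
  have := hN n Nn; rewrite ltr_pdivlMr ?mulr_gt0// => /ltW.
  move: (tau n) => t ht.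
  have : 0 <= j%:R * n%:R :> R by rewrite mulr_ge0 ?ltW.
  have -> : 24 * j%:R ^+ 2 * n%:R * t = (t * (24 * j%:R)) * (j%:R * n%:R) by ring.
  by move=> ?; rewrite ler_wpM2r.
set x := V (j * p)%N / _ in h2 *; set y := V p / _ in h1 *.
set x' := V (2 ^ N * (j * p))%N / _ in h2 h4 *; set y' := V n / _ in h1 h4.
have -> : x - y = (x - x') + (x' - y') + (y' - y) by ring.
apply: le_trans (ler_normD _ _) _; apply: le_trans (lerD (ler_normD _ _) (lexx _)) _.
rewrite (distrC x x'); lra.
Qed.

(** The ratios at [m] and [n] are both compared with the ratio at the common multiple [m * n], which
    gives a Cauchy sequence; 48 is twice the constant of [compare]. *)
Lemma almost_additive_cvg : cvgn (fun n => V n / n%:R).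
Proof.
apply: cauchy_nat_cvg => e e0.
have e'0 : 0 < e / 48 by rewrite divr_gt0.
have [N hN] := tau_small e'0.
exists (maxn 6 N) => m n; rewrite !geq_max => /andP[m6 Nm] /andP[n6 Nn].
have h1 := @compare m n m6 (ltac:(lia)); have h2 := @compare n m n6 (ltac:(lia)).
rewrite mulnC in h1.
have := hN m Nm; have := hN n Nn; rewrite !ltr_pdivlMr// => t1 t2.
rewrite -(subrKA (V (m * n)%N / (m * n)%:R)).
apply: le_lt_trans (ler_normD _ _) _; rewrite distrC; lra.
Qed.

End almost_additive.

Section birkhoff.
Context {T : Type} {R : realType}.

Definition bsum (D : T -> R) (tau : T -> T) (k : nat) (p : T) : R :=
  \sum_(j < k) D (iter j tau p).

Lemma bsumS D tau k p : bsum D tau k.+1 p = D p + bsum D tau k (tau p).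
Proof.
rewrite /bsum big_ord_recl/=; congr (_ + _).
by apply: eq_bigr => j _; rewrite -iterS iterSr.
Qed.

Lemma bsumM D tau k l p : bsum (bsum D tau l) (iter l tau) k p = bsum D tau (k * l) p.
Proof.
elim: k p => [|k ih] p; first by rewrite mul0n /bsum !big_ord0.
rewrite bsumS ih mulSn /bsum [RHS]big_split_ord/=; congr (_ + _); apply: eq_bigr => j _.
by rewrite -iterD addnC.
Qed.

End birkhoff.

(** Fekete's argument. The limit is the supremum of the ratios, and the last two clauses record this
    because the limit theorem needs one block length whose ratio is nearly optimal. *)
Lemma superadditive_cvg {R : realType} (x : nat -> R) (C : R) :
  (forall n, 0 <= x n) -> (forall n, x n <= C * n%:R) ->
  (forall m k n, (0 < m)%N -> (k * m <= n)%N -> k%:R * x m <= x n) ->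
  exists c, [/\ x n / n%:R @[n --> \oo] --> c, forall m, (0 < m)%N -> x m / m%:R <= c &
    forall e, 0 < e -> exists2 m, (0 < m)%N & c - e < x m / m%:R].
Proof.
move=> x0 xC sup_x.
pose A := [set x m.+1 / m.+1%:R | m in setT].
have bA : has_sup A.
  split; first by exists (x 1%N / 1%:R); exists 0%N.
  by exists C => _ [m _ <-]; rewrite ler_pdivrMr// ltr0Sn.
have ub m : (0 < m)%N -> x m / m%:R <= sup A.
  case: m => // m _; apply: ub_le_sup; first by case: bA.
  by exists m.
have ap e : 0 < e -> exists2 m, (0 < m)%N & sup A - e < x m / m%:R.
  by move=> e0; have [_ [m _ <-] h] := sup_adherent e0 bA; exists m.+1.
exists (sup A); split=> //.
apply/cvgrPdist_lt => e e0.
have [m m0 hm] := ap (e / 2) (divr_gt0 e0 (ltr0Sn _ 1)).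
have m0' : (0 < m%:R :> R) by rewrite ltr0n.
(* [x m + 1] is used in place of [x m], which may be 0. *)
have ht : 0 < e / 2 / (x m + 1) by rewrite !divr_gt0// ltr_wpDl.
pose N := (Num.truncn (e / 2 / (x m + 1))^-1).+1.
exists (maxn 1 N) => // n /=; rewrite geq_max => /andP[n0 Nn].
have n0' : (0 < n%:R :> R) by rewrite ltr0n.
rewrite ger0_norm ?subr_ge0 ?ub//.
(* [floor (n/m) x_m >= (n/m - 1) x_m] *)
have h := sup_x m (n %/ m)%N n m0 (leq_trunc_div _ _).
have q1 : n%:R <= ((n %/ m)%:R + 1) * m%:R :> R.
  by rewrite -[1]/(1%:R) -natrD -natrM ler_nat addn1 ltnW// ltn_ceil.
have h2 : (n%:R / m%:R - 1) * x m <= x n.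
  apply: le_trans h; rewrite ler_wpM2r// lerBlDr ler_pdivrMr//.
have h3 : (x m + 1) < e / 2 * n%:R.
  have hN : (e / 2 / (x m + 1))^-1 < n%:R.
    by apply: lt_le_trans (truncnS_gt _) _; rewrite ler_nat.
  move: hN; rewrite invf_div ltr_pdivrMr ?divr_gt0//.
  by rewrite mulrC.
have h4 : x m / m%:R - x m / n%:R <= x n / n%:R.
  rewrite ler_pdivlMr//.
  have -> : (x m / m%:R - x m / n%:R) * n%:R = (n%:R / m%:R - 1) * x m.
    by field; rewrite !lt0r_neq0.
  exact: h2.
have h5 : x m / n%:R < e / 2 by rewrite ltr_pdivrMr//; lra.
lra.
Qed.

(** * Deviations from the conditional expectation *)

Section deviations.
Context {dS} {S : measurableType dS} {R : realType}.
Variables (Q : R.-pker S ~> S) (mu : probability (traj S) R).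
Hypothesis Hmu : markov_traj Q mu.
Notation "''E' F" := (Rintegral mu setT F) (at level 10, F at level 9) : ring_scope.
Notation integ F := (mu.-integrable setT (EFin \o F)).
Notation theta n := (iter n (@pshift _ S)).
Variable f : S -> R.
Hypotheses (mf : measurable_fun setT f) (sf : sqint mu (fun p => f (p 0%N))).
Notation psum := (psum f).
Let spsum := sqint_psum Hmu mf sf.

Variable h : nat -> S * S -> R.
Hypothesis mh : forall n, (0 < n)%N -> measurable_fun setT (h n).
Hypothesis sh : forall n, (0 < n)%N -> sqint mu (fun p => h n (p n, p 0%N)).
Hypothesis oh : forall n, (0 < n)%N -> forall psi : S * S -> R, bmeas psi ->
  'E (fun p => (psum n p - h n (p n, p 0%N)) * psi (p n, p 0%N)) = 0.

(** In the backward reading [(p n, p 0)] is [(xi_0, xi_n)], so this is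
    [S_n - E(S_n | xi_0, xi_n)]. *)
Definition dev n (p : traj S) : R := psum n p - h n (p n, p 0%N).

Lemma sqint_dev n : (0 < n)%N -> sqint mu (dev n).
Proof. by move=> n0; apply: sqintB; [exact: spsum|exact: sh]. Qed.

Lemma depends_dev n : depends n (dev n).
Proof.
by move=> p q pq; rewrite /dev (depends_psum f (leqnSn n) pq) !pq.
Qed.

Lemma depends_shift i m (F : traj S -> R) : depends m F -> depends (i + m) (fun p => F (theta i p)).
Proof.
move=> dF p q pq; apply: dF => k km; rewrite !iter_pshift; apply: pq.
by rewrite leq_add2l.
Qed.

Lemma measurable_pair n : measurable_fun setT (fun p : traj S => (p n, p 0%N)).
Proof.
by apply/measurable_fun_pairP; split; exact: measurable_coord.
Qed.

(** [Phi] lives on times after the block and [A] on times before it. One use of the Markov property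
    replaces [A] by a function of the oldest state of the block, another replaces [Phi] by a
    function of its newest state; the deviation is orthogonal to the product by its definition. *)
Lemma dev_orth i m (Phi A : traj S -> R) : (0 < m)%N -> bmeas Phi -> depends i Phi -> bmeas A ->
  'E (fun p => dev m (theta i p) * Phi p * A (theta (i + m) p)) = 0.
Proof.
move=> m0 bPhi dPhi bA.
have sd := sqint_dev m0; have sdi := sqint_shiftn Hmu i sd.
apply: (orth_depends Hmu (Z := fun p => dev m (theta i p) * Phi p)) => //.
- exact/integMb/bPhi/sqint_integ.
- move=> p q pq; rewrite (depends_shift (i := i) (@depends_dev m) pq); congr (_ * _).
  by apply: dPhi => k ki; apply: pq; exact: leq_trans ki (leq_addr _ _).
move=> a ba.
have [kap bk hk] := cond_kernel Hmu bPhi dPhi.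
have bk0 := bmeas_coord 0 bk.
have sB : sqint mu (fun p => dev m p * a (p m)).
  by apply: sqintMb => //; exact: bmeas_coord.
have := adj_ext_L2 Hmu bPhi bk0 hk sB.
have -> : 'E (fun p => Phi p * (dev m (theta i p) * a (theta i p m))) =
    'E (fun p => dev m (theta i p) * Phi p * a (p (i + m)%N)).
  by apply: eq_Rintegral => p _; rewrite iter_pshift; ring.
move=> ->.
rewrite -(oh m0 (psi := fun z => a z.1 * kap z.2)).
  by apply: eq_Rintegral => p _ /=; rewrite /dev; ring.
by apply: bmeasM; [exact: (bmeas_comp ba measurable_fst)|exact: (bmeas_comp bk measurable_snd)].
Qed.

(** On a rectangle the test function splits into a factor at coordinate 0 and a factor at coordinate
    [N], one on each side of the block, as [dev_orth] requires. *)
Lemma dev_orth_pair i m N (g : S * S -> R) : (0 < m)%N -> (i + m <= N)%N ->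
  measurable_fun setT g -> sqint mu (fun p => g (p N, p 0%N)) ->
  'E (fun p => dev m (theta i p) * g (p N, p 0%N)) = 0.
Proof.
move=> m0 iN mg sg.
have sdi := sqint_shiftn Hmu i (sqint_dev m0).
apply: (orth_sqint_of_bounded (Y := fun p : traj S => (p N, p 0%N))) => //.
  exact: measurable_pair.
move=> psi bpsi.
apply: (@orth_pi_system _ _ _ _ _ (S * S)%type [set A `*` B | A in measurable & B in measurable] _
   (fun p : traj S => (p N, p 0%N))) => //.
- exact: measurable_prod_measurableType.
- move=> _ _ [A1 mA1 [B1 mB1 <-]] [A2 mA2 [B2 mB2 <-]].
  exists (A1 `&` A2); first exact: measurableI.
  exists (B1 `&` B2); first exact: measurableI.
  by rewrite setXI.
- by exists setT => //; exists setT => //; rewrite setXTT.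
- exact: sqint_integ.
- exact: measurable_pair.
move=> _ [A mA [B mB <-]].
rewrite -(@dev_orth i m (fun p => \1_B (p 0%N)) (fun p => \1_A (p (N - (i + m))%N)) m0).
- apply: eq_Rintegral => p _; rewrite iter_pshift subnKC// -mulrA; congr (_ * _).
  rewrite !indicE -natrM mulnb; congr ((_ : bool)%:R).
  by rewrite andbC in_setX.
- exact: (bmeas_coord 0 (bmeas_indic mB)).
- by apply: (@depends_coord _ _ _ _ _ (\1_B)).
- exact: (bmeas_coord _ (bmeas_indic mA)).
Qed.

Lemma dev_orth_coord i m l (g : S -> R) : (0 < m)%N -> (l <= i)%N || (i + m <= l)%N ->
  measurable_fun setT g -> sqint mu (fun p => g (p 0%N)) ->
  'E (fun p => dev m (theta i p) * g (p l)) = 0.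
Proof.
move=> m0 hl mg sg.
have sdi := sqint_shiftn Hmu i (sqint_dev m0).
apply: (orth_sqint_of_bounded (Y := fun p : traj S => p l)) => //.
- exact: measurable_coord.
- exact/(sqint_coord Hmu).
move=> psi bpsi; case/orP: hl => hl.
- rewrite -(@dev_orth i m (fun p => psi (p l)) (fun=> 1) m0).
  + by apply: eq_Rintegral => p _; rewrite mulr1.
  + exact: bmeas_coord.
  + exact: depends_coord.
  + exact: bmeas_cst.
- rewrite -(@dev_orth i m (fun=> 1) (fun p => psi (p (l - (i + m))%N)) m0).
  + by apply: eq_Rintegral => p _; rewrite mulr1 iter_pshift subnKC.
  + exact: bmeas_cst.
  + by [].
  + exact: bmeas_coord.
Qed.

Lemma dev_orth_past m A : (0 < m)%N -> sqint mu A ->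
  'E (fun p => dev m p * A (theta m p)) = 0.
Proof.
move=> m0 sA; apply: (orth_depends_L2 Hmu) => //.
- exact: sqint_dev.
- exact: depends_dev.
move=> a ba; apply: (@dev_orth_coord 0 m m) => //; first by rewrite add0n leqnn orbT.
- by case: ba.
- exact/sqint_bmeas/bmeas_coord.
Qed.

Notation bs m := (bsum (dev m) (iter m (@pshift _ S))).

Lemma sqint_bs m k : (0 < m)%N -> sqint mu (bs m k).
Proof.
move=> m0; apply: sqint_sum => j.
have := sqint_shiftn Hmu (j * m) (sqint_dev m0).
congr sqint; apply/funext => p; congr dev.
by rewrite iterM.
Qed.

Lemma E_dev_psum i m n : (0 < m)%N -> (n <= i)%N ->
  'E (fun p => dev m (theta i p) * psum n p) = 0.
Proof.
move=> m0 ni; under eq_Rintegral do rewrite /psum mulr_sumr.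
rewrite E_sum; last first.
  move=> l; apply: sqintM; first exact: (sqint_shiftn Hmu i (sqint_dev m0)).
  exact/(sqint_coord Hmu).
rewrite big1// => l _; apply: dev_orth_coord => //.
by rewrite (leq_trans (ltnW (ltn_ord l)) ni).
Qed.

(** Cut [S_N] into the parts after, inside and before the sub-block. The deviation of the sub-block
    is orthogonal to the outer parts and to [h N], and against its own partial sum it gives its own
    square. *)
Lemma E_dev_dev i m N : (0 < m)%N -> (i + m <= N)%N ->
  'E (fun p => dev N p * dev m (theta i p)) = 'E (fun p => dev m p ^+ 2).
Proof.
move=> m0 iN; have N0 : (0 < N)%N by lia.
have sd := sqint_dev m0; have sdi := sqint_shiftn Hmu i sd.
have sr := sqint_shiftn Hmu (i + m) (spsum (N - (i + m))).
have sm := sqint_shiftn Hmu i (spsum m).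
have -> : (fun p => dev N p * dev m (theta i p)) =
  (fun p => dev m (theta i p) * psum i p + dev m (theta i p) * psum m (theta i p) +
     dev m (theta i p) * psum (N - (i + m)) (theta (i + m) p) -
     dev m (theta i p) * h N (p N, p 0%N)).
  apply/funext => p; rewrite {1}/dev.
  have {1}-> : N = (i + m + (N - (i + m)))%N by lia.
  by rewrite !psumD; ring.
have i1 := sqintM sdi (spsum i); have i2 := sqintM sdi sm.
have i3 := sqintM sdi sr; have i4 := sqintM sdi (sh N0).
rewrite E_B//; last by apply: integD => //; exact: integD.
rewrite E_D//; last exact: integD.
rewrite E_D// E_dev_psum// (dev_orth_pair m0 iN (mh N0) (sh N0)) subr0 add0r.
rewrite (_ : 'E (fun p => _ * psum (N - (i + m)) _) = 0) ?addr0; last first.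
  rewrite -(@dev_orth_past m (fun p => psum (N - (i + m)) p) m0) ?spsum//.
  rewrite -[RHS](E_shiftn Hmu i); last first.
    apply: measurable_funM; first by case: sd.
    by case: (sqint_shiftn Hmu m (spsum (N - (i + m)))).
  by apply: eq_Rintegral => p _; rewrite -iterD addnC.
rewrite (E_shiftn Hmu i (F := fun p => dev m p * psum m p)); last first.
  by apply: measurable_funM; [case: sd|case: (spsum m)].
have := @dev_orth_pair 0 m m (h m) m0 (leqnn _) (mh m0) (sh m0).
rewrite /= => e; rewrite -[LHS]subr0 -[X in _ - X]e -E_B.
- by apply: eq_Rintegral => p _; rewrite -mulrBr expr2.
- exact: sqintM.
- exact: sqintM (sh m0).
Qed.

Lemma E_dev_bs m k N : (0 < m)%N -> (k * m <= N)%N ->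
  'E (fun p => dev N p * bs m k p) = k%:R * 'E (fun p => dev m p ^+ 2).
Proof.
move=> m0 kN.
have [N0|N0] := posnP N.
  have k0 : k = 0%N by move: kN; rewrite N0; lia.
  by rewrite k0 mul0r; under eq_Rintegral do rewrite /bsum big_ord0 mulr0; rewrite E_cst.
under eq_Rintegral do rewrite /bsum mulr_sumr.
have sj (j : 'I_k) : sqint mu (fun p => dev m (iter j (theta m) p)).
  have := sqint_shiftn Hmu (j * m) (sqint_dev m0).
  by congr sqint; apply/funext => p; rewrite iterM.
rewrite E_sum; last by move=> j; apply: sqintM => //; exact: sqint_dev.
rewrite (eq_bigr (fun=> 'E (fun p => dev m p ^+ 2))).
  by rewrite sumr_const card_ord mulr_natl.
move=> j _; rewrite -(@E_dev_dev (j * m) m N m0).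
  by apply: eq_Rintegral => p _; rewrite iterM.
by have := ltn_ord j; nia.
Qed.

(** The weight [A], a function of what precedes all [k] blocks, is kept so that the identity
    concerns conditional second moments. By stationarity each block is moved to the start of the
    path, and only its distance [j.+1 * m] to [A] remains. *)
Lemma E_bs_sqr m k (A : traj S -> R) : (0 < m)%N -> bmeas A ->
  'E (fun p => bs m k p ^+ 2 * A (theta (k * m) p)) =
  \sum_(j < k) 'E (fun p => dev m p ^+ 2 * A (theta (j.+1 * m) p)).
Proof.
move=> m0 bA; elim: k => [|k ih].
  rewrite big_ord0; under eq_Rintegral do rewrite /bsum big_ord0 expr0n /= mul0r.
  by rewrite E_cst.
have sd := sqint_dev m0; have sb := sqint_bs k m0.
have sbm := sqint_shiftn Hmu m sb.
have bAk n := bmeas_shiftn n bA.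
rewrite big_ord_recr/= -ih addrC.
rewrite -(E_shiftn Hmu m (F := fun p => bs m k p ^+ 2 * A (theta (k * m) p))); last first.
  by apply: measurable_funM; [apply: measurable_funX; case: sb|case: (bAk (k * m)%N)].
have e1 : 'E (fun p => dev m p * (bs m k (theta m p) * A (theta (k.+1 * m) p))) = 0.
  rewrite -(@dev_orth_past m (fun p => bs m k p * A (theta (k * m) p)) m0).
    by apply: eq_Rintegral => p _; rewrite -iterD mulSn addnC.
  exact: sqintMb.
have i1 : integ (fun p => dev m p ^+ 2 * A (theta (k.+1 * m) p)).
  by apply: integMb => //; exact: sqint_sqr.
have i2 : integ (fun p => dev m p * (bs m k (theta m p) * A (theta (k.+1 * m) p))).
  by apply: sqintM => //; exact: sqintMb.
have i3 : integ (fun p => bs m k (theta m p) ^+ 2 * A (theta (k * m) (theta m p))).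
  apply: integMb; first exact: sqint_sqr.
  exact: (bmeas_shiftn m (bAk (k * m)%N)).
rewrite -[RHS]addr0 -[X in _ + X](mulr0 2) -e1 -E_Z// -E_D// -E_D; first last.
- exact: integZ.
- exact: integD.
apply: eq_Rintegral => p _; rewrite bsumS -iterD mulSn addnC; ring.
Qed.

Lemma E_bs_sqr1 m k : (0 < m)%N -> 'E (fun p => bs m k p ^+ 2) = k%:R * 'E (fun p => dev m p ^+ 2).
Proof.
move=> m0; have := @E_bs_sqr m k (fun=> 1) m0 (bmeas_cst 1).
under eq_Rintegral do rewrite mulr1.
move=> ->; under eq_bigr do under eq_Rintegral do rewrite mulr1.
by rewrite sumr_const card_ord mulr_natl.
Qed.

Lemma E_bs_orth m k (A : traj S -> R) : (0 < m)%N -> bmeas A ->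
  'E (fun p => bs m k p * A (theta (k * m) p)) = 0.
Proof.
move=> m0 bA; elim: k => [|k ih].
  by under eq_Rintegral do rewrite /bsum big_ord0 mul0r; rewrite E_cst.
have sd := sqint_dev m0; have sb := sqint_bs k m0.
have sbm := sqint_shiftn Hmu m sb; have bAk n := bmeas_shiftn n bA.
have -> : (fun p => bs m k.+1 p * A (theta (k.+1 * m) p)) = (fun p =>
    dev m p * A (theta (k * m) (theta m p)) + bs m k (theta m p) * A (theta (k * m) (theta m p))).
  by apply/funext => p; rewrite bsumS -iterD mulSn addnC mulrDl.
rewrite E_D; first last.
- apply: integMb; first exact: sqint_integ.
  exact: (bmeas_shiftn m (bAk (k * m)%N)).
- apply: integMb; first exact: sqint_integ.
  exact: (bmeas_shiftn m (bAk (k * m)%N)).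
rewrite (@dev_orth_past m (fun p => A (theta (k * m) p)) m0) ?add0r; last exact: sqint_bmeas.
rewrite (E_shiftn Hmu m (F := fun p => bs m k p * A (theta (k * m) p))) ?ih//.
by apply: measurable_funM; [case: sb|case: (bAk (k * m)%N)].
Qed.

Lemma E_dev_sub_bs m k N : (0 < m)%N -> (k * m <= N)%N -> (0 < N)%N ->
  'E (fun p => (dev N p - bs m k p) ^+ 2) =
  'E (fun p => dev N p ^+ 2) - k%:R * 'E (fun p => dev m p ^+ 2).
Proof.
move=> m0 kN N0.
have sN := sqint_dev N0; have sb := sqint_bs k m0.
have i1 := sqint_sqr sN; have i2 := sqint_sqr sb; have i3 := sqintM sN sb.
have -> : (fun p => (dev N p - bs m k p) ^+ 2) =
    (fun p => dev N p ^+ 2 - 2 * (dev N p * bs m k p) + bs m k p ^+ 2).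
  by apply/funext => p; ring.
rewrite E_D//; last by apply: integB => //; exact: integZ.
rewrite E_B//; last exact: integZ.
rewrite E_Z// E_dev_bs// E_bs_sqr1//; ring.
Qed.

Lemma dev_superadd m k N : (0 < m)%N -> (k * m <= N)%N ->
  k%:R * 'E (fun p => dev m p ^+ 2) <= 'E (fun p => dev N p ^+ 2).
Proof.
move=> m0 kN; have [N0|N0] := posnP N.
  have -> : k = 0%N by move: kN; rewrite N0; lia.
  by rewrite mul0r E_ge0// => p; exact: sqr_ge0.
rewrite -subr_ge0 -E_dev_sub_bs//; apply: E_ge0 => p; exact: sqr_ge0.
Qed.

Lemma E_psum_dev n : (0 < n)%N ->
  'E (fun p => psum n p ^+ 2) = 'E (fun p => dev n p ^+ 2) + 'E (fun p => h n (p n, p 0%N) ^+ 2).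
Proof.
move=> n0; have sd := sqint_dev n0; have s1 := sh n0.
have e := @dev_orth_pair 0 n n (h n) n0 (leqnn _) (mh n0) s1.
have i1 := sqint_sqr sd; have i2 := sqint_sqr s1; have i3 := sqintM sd s1.
rewrite -[RHS]addr0 -[X in _ + X](mulr0 2) -[X in 2 * X]e /= -E_Z// -E_D// -E_D; first last.
- exact: integZ.
- exact: integD.
by apply: eq_Rintegral => p _; rewrite /dev; ring.
Qed.

End deviations.

(** * The parallelogram identity and almost sure convergence *)

Section nrm_more.
Context {d} {T : measurableType d} {R : realType}.
Variable P : probability T R.
Notation "''E' F" := (Rintegral P setT F) (at level 10, F at level 9) : ring_scope.
Notation nrm := (nrm P).

Lemma nrmZ c F : sqint P F -> nrm (fun x => c * F x) = `|c| * nrm F.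
Proof.
move=> sF; rewrite /nrm.
under eq_Rintegral do rewrite exprMn.
rewrite E_Z; last exact: sqint_sqr.
by rewrite sqrtrM ?sqr_ge0// sqrtr_sqr.
Qed.

Lemma nrm_le_bound F (M : R) : sqint P F -> 0 <= M -> (forall x, `|F x| <= M) -> nrm F <= M.
Proof.
move=> sF M0 hM; rewrite -(@ler_pXn2r _ 2)// ?nnegrE ?nrm_ge0// nrm_sqr.
rewrite -[leRHS](E_cst P); apply: E_le; [exact: sqint_sqr|exact: integ_cst|].
by move=> x; rewrite -[leLHS]real_normK ?num_real// ler_pXn2r ?nnegrE.
Qed.

Lemma nrm_sum (F : nat -> T -> R) n (c : R) : (forall i, sqint P (F i)) ->
  (forall i, nrm (F i) <= c) -> nrm (fun x => \sum_(i < n) F i x) <= n%:R * c.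
Proof.
move=> sF hc; elim: n => [|n ih].
  rewrite mul0r; under [X in nrm X]eq_fun do rewrite big_ord0.
  by rewrite /nrm expr0n /= E_cst sqrtr0.
under [X in nrm X]eq_fun do rewrite big_ord_recr/=.
apply: le_trans (nrmD _ _) _ => //.
  by under eq_fun do rewrite -(big_mkord xpredT (F^~ _)); exact: sqint_sum.
by rewrite -addn1 natrD mulrDl mul1r lerD.
Qed.

Lemma parallelogram F G : sqint P F -> sqint P G ->
  nrm (fun x => F x - G x) ^+ 2 =
  2 * nrm F ^+ 2 + 2 * nrm G ^+ 2 - 4 * nrm (fun x => F x + 2^-1 * (G x - F x)) ^+ 2.
Proof.
move=> sF sG.
have sB := sqintB sF sG.
have sM : sqint P (fun x => F x + 2^-1 * (G x - F x)).
  by apply: sqintD => //; apply: sqintZ; exact: sqintB.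
have i1 := sqint_sqr sF; have i2 := sqint_sqr sG; have i3 := sqint_sqr sM.
rewrite !nrm_sqr -!E_Z// -E_D; [|exact: integZ|exact: integZ].
rewrite -E_B; [|by apply: integD; exact: integZ|exact: integZ].
by apply: eq_Rintegral => x _; field.
Qed.

Lemma nrm0_ae F : sqint P F -> nrm F = 0 -> {ae P, forall x, F x = 0}.
Proof.
move=> sF h; apply: E_abs_eq0; first exact: sqint_integ.
apply/eqP; rewrite eq_le E_ge0// andbT -h; exact: E_abs_nrm.
Qed.

(** The increments have summable L1 norms, so the sum of their absolute values is integrable and
    hence finite almost everywhere. *)
Lemma ae_cvg_of_nrm_summable (y : nat -> T -> R) : (forall k, sqint P (y k)) ->
  (forall k, nrm (fun x => y k.+1 x - y k x) <= 2^-1 ^+ k) ->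
  {ae P, forall x, cvgn (y^~ x)}.
Proof.
move=> sy hy.
have sd k : sqint P (fun x => y k.+1 x - y k x) by exact: sqintB.
pose u k x : R := `|y k.+1 x - y k x|.
have iu k : P.-integrable setT (EFin \o u k) by apply: integ_abs; exact: sqint_integ.
have mu_ k : measurable_fun setT (fun x => (u k x)%:E).
  by apply/measurable_EFinP; exact: integ_measurable (iu k).
have u0 k x : (0 <= (u k x)%:E)%E by rewrite lee_fin normr_ge0.
have e := @integral_nneseries _ _ _ P setT measurableT (fun k x => (u k x)%:E) mu_ (fun k x _ => u0 k x).
have fin : (\int[P]_x (\sum_(0 <= k <oo) (u k x)%:E) < +oo)%E.
  rewrite e.
  have g : cvgn (series (geometric 1 (2^-1 : R))).
    by apply: is_cvg_geometric_series; rewrite ger0_norm// invf_lt1// ltr1n.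
  apply: le_lt_trans (_ : \sum_(0 <= k <oo) (geometric 1 (2^-1 : R) k)%:E < +oo)%E.
    apply: lee_nneseries => [k *|k *]; first by apply: integral_ge0 => x _; exact: u0.
    rewrite E_EFin// lee_fin /geometric /= mul1r; apply: le_trans (hy k).
    exact: E_abs_nrm.
  have g0 k : 0 <= geometric 1 (2^-1 : R) k by rewrite /geometric /= mul1r exprn_ge0// invr_ge0.
  apply: le_lt_trans (_ : (limn (series (geometric 1 (2^-1 : R))))%:E < +oo)%E; last exact: ltry.
  apply: lime_le; first by apply: is_cvg_nneseries => k _ _; rewrite lee_fin.
  apply: nearW => n; rewrite sumEFin lee_fin.
  apply: (nondecreasing_cvgn_le (u_ := series (geometric 1 (2^-1 : R)))) => //.
  by apply/nondecreasing_seqP => k; rewrite /series /= big_nat_recr//= lerDl.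
have ae1 : {ae P, forall x, (\sum_(0 <= k <oo) (u k x)%:E < +oo)%E}.
  have ii : P.-integrable setT (fun x => \sum_(0 <= k <oo) (u k x)%:E)%E.
    apply/integrableP; split.
      by apply: ge0_emeasurable_sum => // k x _ _.
    under eq_integral do rewrite gee0_abs ?nneseries_ge0//.
    by [].
  have := integrable_ae measurableT ii.
  by apply: filterS => x /(_ I); rewrite fin_numElt => /andP[].
apply: filterS ae1 => x hx.
have c1 : cvgn (series (fun k => u k x)) by apply: nnseries_is_cvg => // k; rewrite normr_ge0.
have c2 : cvgn (series (fun k => y k.+1 x - y k x)).
  by apply: normed_cvg.
have -> : y^~ x = (fun n => y 0%N x + series (fun k => y k.+1 x - y k x) n).
  apply/funext => n; rewrite /series /=.
  by rewrite telescope_sumr// addrC subrK.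
by apply: is_cvgD => //; exact: is_cvg_cst.
Qed.

End nrm_more.

(** * Mean ergodic theorem *)

Section mean_ergodic.
Context {d} {T : measurableType d} {R : realType}.
Variable P : probability T R.
Notation "''E' F" := (Rintegral P setT F) (at level 10, F at level 9) : ring_scope.
Notation nrm := (nrm P).
Variable K : (T -> R) -> (T -> R).
Hypothesis K_bmeas : forall g, bmeas g -> bmeas (K g).
Hypothesis K_bound : forall g (M : R), bmeas g -> (forall x, `|g x| <= M) -> forall x, `|K g x| <= M.
Hypothesis K_lin : forall a g g', bmeas g -> bmeas g' ->
  K (fun x => g x + a * g' x) = (fun x => K g x + a * K g' x).
Hypothesis K_contr : forall g, bmeas g -> nrm (K g) <= nrm g.
Hypothesis K_E : forall g, bmeas g -> 'E (K g) = 'E g.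
Hypothesis K_erg : forall g, bmeas g -> {ae P, forall x, K g x = g x} ->
  exists c, {ae P, forall x, g x = c}.

Let it j g := iter j K g.

Let it_bmeas j g : bmeas g -> bmeas (it j g).
Proof. by move=> bg; elim: j => // j ih; exact: K_bmeas. Qed.

Let it_bound j g (M : R) : bmeas g -> (forall x, `|g x| <= M) -> forall x, `|it j g x| <= M.
Proof. by move=> bg hM; elim: j => // j ih; apply: K_bound => //; exact: it_bmeas. Qed.

Let it_lin j a g g' : bmeas g -> bmeas g' ->
  it j (fun x => g x + a * g' x) = (fun x => it j g x + a * it j g' x).
Proof.
by move=> bg bg'; elim: j => // j ih; rewrite /it iterS [iter j _ _]ih K_lin//; exact: it_bmeas.
Qed.

Let it_contr j g : bmeas g -> nrm (it j g) <= nrm g.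
Proof.
move=> bg; elim: j => // j ih; apply: le_trans ih; apply: K_contr; exact: it_bmeas.
Qed.

Let it_E j g : bmeas g -> 'E (it j g) = 'E g.
Proof. by move=> bg; elim: j => // j ih; rewrite /it iterS K_E//; exact: it_bmeas. Qed.

Definition cesaro_mean n g x : R := n.+1%:R^-1 * \sum_(j < n.+1) iter j K g x.

Lemma bmeas_cesaro n g : bmeas g -> bmeas (cesaro_mean n g).
Proof. by move=> bg; apply: bmeasZ; apply: bmeas_sum => j; exact: it_bmeas. Qed.

Let sq g : bmeas g -> sqint P g. Proof. exact: sqint_bmeas. Qed.

Lemma cesaro_lin n a g g' : bmeas g -> bmeas g' ->
  cesaro_mean n (fun x => g x + a * g' x) = (fun x => cesaro_mean n g x + a * cesaro_mean n g' x).
Proof.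
move=> bg bg'; apply/funext => x; rewrite /cesaro_mean.
under eq_bigr do rewrite [iter _ _ _ _](congr1 (fun f => f x) (it_lin _ _ bg bg')).
by rewrite big_split/= -mulr_sumr mulrDr mulrCA.
Qed.

Lemma cesaro_bound n g (M : R) : bmeas g -> (forall x, `|g x| <= M) -> forall x, `|cesaro_mean n g x| <= M.
Proof.
move=> bg hM x; rewrite /cesaro_mean normrM ger0_norm ?invr_ge0//.
rewrite mulrC ler_pdivrMr ?ltr0Sn//.
apply: le_trans (ler_norm_sum _ _ _) _.
apply: le_trans (_ : \sum_(j < n.+1) M <= _).
  by apply: ler_sum => j _; exact: it_bound.
by rewrite sumr_const card_ord mulr_natr.
Qed.

Let cesaro_contr n g : bmeas g -> nrm (cesaro_mean n g) <= nrm g.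
Proof.
move=> bg; rewrite /cesaro_mean nrmZ; last by apply/sq/bmeas_sum => j; exact: it_bmeas.
rewrite ger0_norm ?invr_ge0// mulrC ler_pdivrMr ?ltr0Sn// mulrC.
by apply: (nrm_sum (F := fun j => it j g)) => j; [exact/sq/it_bmeas|exact: it_contr].
Qed.

Let cesaro_E n g : bmeas g -> 'E (cesaro_mean n g) = 'E g.
Proof.
move=> bg; rewrite E_Z; last by apply/integ_bmeas/bmeas_sum => j; exact: it_bmeas.
rewrite E_sum; last by move=> j; exact/integ_bmeas/it_bmeas.
under eq_bigr => j _ do rewrite (it_E j bg).
by rewrite sumr_const card_ord -[X in _ * X]mulr_natl mulKf.
Qed.

(** Plays the part of the closure of the range of [1 - K] in von Neumann's argument, without any
    closure being formed. *)
Let vanish z := nrm (cesaro_mean n z) @[n --> \oo] --> (0 : R).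

Let vanish_lin a z z' : bmeas z -> bmeas z' -> vanish z -> vanish z' ->
  vanish (fun x => z x + a * z' x).
Proof.
move=> bz bz' vz vz'; rewrite /vanish.
apply: (@squeeze_cvgr _ _ _ _ (fun=> 0) (fun n => nrm (cesaro_mean n z) + `|a| * nrm (cesaro_mean n z'))).
- apply: nearW => n; rewrite nrm_ge0/= cesaro_lin//.
  have s1 := sq (bmeas_cesaro n bz); have s2 := sq (bmeas_cesaro n bz').
  by rewrite -nrmZ// nrmD//; exact: sqintZ.
- exact: cvg_cst.
- rewrite -[X in _ --> X]addr0 -[X in _ + X](mulr0 `|a|).
  by apply: cvgD => //; apply: cvgM => //; exact: cvg_cst.
Qed.

(** The average of [w - K w] telescopes to its two end terms. Differences are written [+ -1 *] to
    match [K_lin]. *)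
Let cesaro_cob n w : bmeas w -> nrm (cesaro_mean n (fun x => w x + -1 * K w x)) <= 2 * nrm w / n.+1%:R.
Proof.
move=> bw; rewrite cesaro_lin//; last exact: K_bmeas.
have -> : (fun x => cesaro_mean n w x + -1 * cesaro_mean n (K w) x) =
   (fun x => n.+1%:R^-1 * (w x + -1 * it n.+1 w x)).
  apply/funext => x; rewrite /cesaro_mean mulrCA -mulrDr; congr (_ * _).
  rewrite big_ord_recl big_ord_recr/=.
  under [X in _ + -1 * (X + _)]eq_bigr do rewrite -iterSr.
  rewrite -iterSr /it /bump/=; ring.
have s1 := sq bw; have s2 := sq (it_bmeas n.+1 bw).
rewrite nrmZ; last by apply: sqintD => //; exact: sqintZ.
rewrite ger0_norm ?invr_ge0// mulrC ler_wpM2r ?invr_ge0//.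
apply: le_trans (nrmD s1 (sqintZ (-1) s2)) _.
rewrite nrmZ// normrN normr1 mul1r mulr_natl mulr2n lerD2l; exact: it_contr.
Qed.

Lemma cvg_divS (c : R) : c / n.+1%:R @[n --> \oo] --> (0 : R).
Proof.
rewrite -[X in _ --> X](mulr0 c); apply: cvgM; first exact: cvg_cst.
exact: cvg_harmonic.
Qed.

Let vanish_cob w : bmeas w -> vanish (fun x => w x + -1 * K w x).
Proof.
move=> bw; apply: (@squeeze_cvgr _ _ _ _ (fun=> 0) (fun n => 2 * nrm w / n.+1%:R)).
- by apply: nearW => n; rewrite nrm_ge0/=; exact: cesaro_cob.
- exact: cvg_cst.
- exact: cvg_divS.
Qed.

Let vanish_it j g : bmeas g -> vanish (fun x => it j g x + -1 * g x).
Proof.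
move=> bg; have bj i := it_bmeas i bg.
have bc w : bmeas w -> bmeas (fun x => w x + -1 * K w x).
  by move=> bw; apply: bmeasD => //; apply: bmeasZ; exact: K_bmeas.
elim: j => [|j ih].
  have -> : (fun x => it 0 g x + -1 * g x) = (fun=> 0) by apply/funext => x; rewrite /it /=; ring.
  rewrite /vanish.
  have -> : (fun n => nrm (cesaro_mean n (fun=> 0))) = (fun=> 0).
    apply/funext => n; apply/eqP; rewrite eq_le nrm_ge0 andbT.
    apply: le_trans (cesaro_contr n (bmeas_cst 0)) _.
    by rewrite /nrm expr0n /= E_cst sqrtr0.
  exact: cvg_cst.
have := @vanish_lin (-1) _ _ _ _ ih (vanish_cob (bj j)).
have -> : (fun x => it j g x + -1 * g x + -1 * (it j g x + -1 * K (it j g) x)) =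
    (fun x => it j.+1 g x + -1 * g x).
  by apply/funext => x; rewrite /it iterS; ring.
apply; last exact: bc.
by apply: bmeasD => //; exact: bmeasZ.
Qed.

Let vanish_cesaro n g : bmeas g -> vanish (fun x => cesaro_mean n g x + -1 * g x).
Proof.
move=> bg; have bj i := it_bmeas i bg.
have bd j : bmeas (fun x => it j g x + -1 * g x) by apply: bmeasD => //; exact: bmeasZ.
have vs m : vanish (fun x => \sum_(j < m) (it j g x + -1 * g x)).
  elim: m => [|m ih].
    have := @vanish_lin (-1) _ _ (bd 0%N) (bd 0%N) (vanish_it 0 bg) (vanish_it 0 bg).
    congr vanish; apply/funext => x; rewrite big_ord0; ring.
  have := @vanish_lin 1 _ _ _ _ ih (vanish_it m bg).
  have -> : (fun x => \sum_(j < m) (it j g x + -1 * g x) + 1 * (it m g x + -1 * g x)) =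
      (fun x => \sum_(j < m.+1) (it j g x + -1 * g x)).
    by apply/funext => x; rewrite big_ord_recr /= mul1r.
  by apply => //; apply: bmeas_sum.
have b0 : bmeas (fun x => \sum_(j < n.+1) (it j g x + -1 * g x)) by exact: bmeas_sum.
have := @vanish_lin (n.+1%:R^-1 - 1) _ _ b0 b0 (vs _) (vs _).
congr vanish; apply/funext => x.
rewrite big_split/= sumr_const card_ord /cesaro_mean /it -[(-1 * g x) *+ _]mulr_natl.
have : n.+1%:R != 0 :> R by rewrite pnatr_eq0.
by move: (n.+1%:R : R) => y y0; field.
Qed.

Variable g : T -> R.
Hypothesis bg : bmeas g.

(* The norms of the averages of [g] tend to the infimum of the norm over this convex set, so the
   averages are Cauchy by the parallelogram identity. *)
Let hull h := bmeas h /\ vanish (fun x => h x + -1 * g x).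
Let av n := cesaro_mean n g.

Let hull_av n : hull (av n).
Proof. by split; [exact: bmeas_cesaro|exact: vanish_cesaro]. Qed.

Let hull_mid h h' : hull h -> hull h' -> hull (fun x => h x + 2^-1 * (h' x - h x)).
Proof.
move=> [bh vh] [bh' vh'].
have bd k : bmeas k -> bmeas (fun x => k x + -1 * g x).
  by move=> bk; apply: bmeasD => //; exact: bmeasZ.
have bhh : bmeas (fun x => h x + -1 * g x + -1 * (h' x + -1 * g x)).
  by apply: bmeasD; [exact: bd|apply: bmeasZ; exact: bd].
split; first by apply: bmeasD => //; apply: bmeasZ; exact: bmeasB.
have v1 := @vanish_lin (-1) _ _ (bd _ bh) (bd _ bh') vh vh'.
have := @vanish_lin (- 2^-1) _ _ (bd _ bh) bhh vh v1.
congr vanish; apply/funext => x; ring.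
Qed.

Let c := inf [set nrm h | h in hull].

Let has_inf_hull : has_inf [set nrm h | h in hull].
Proof.
split; first by exists (nrm (av 0)); exists (av 0).
by exists 0 => _ [h _ <-]; exact: nrm_ge0.
Qed.

Let c_le h : hull h -> c <= nrm h.
Proof. by move=> hh; apply: ge_inf; [case: has_inf_hull|exists h]. Qed.

Let c_ge0 : 0 <= c.
Proof. by apply: lb_le_inf; [case: has_inf_hull|move=> _ [h _ <-]; exact: nrm_ge0]. Qed.

(** For [h] in the hull, [av n] is the average of [h] minus the average of [h - g]: the first has
    norm at most that of [h], the second tends to 0. *)
Let av_near e : 0 < e -> exists N, forall n, (N <= n)%N -> nrm (av n) <= c + e.
Proof.
move=> e0.
have e20 : 0 < e / 2 by rewrite divr_gt0.
have [_ [h hh <-] hlt] := inf_adherent e20 has_inf_hull.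
have [bh vh] := hh.
have /cvgrPdist_le/(_ _ e20) [N _ hN] := vh.
exists N => n Nn; have := hN n Nn; rewrite /= sub0r normrN ger0_norm ?nrm_ge0// => h2.
have bd : bmeas (fun x => h x + -1 * g x) by apply: bmeasD => //; exact: bmeasZ.
have -> : av n = (fun x => cesaro_mean n h x + -1 * cesaro_mean n (fun x => h x + -1 * g x) x).
  by apply/funext => x; rewrite cesaro_lin// /av; ring.
have s1 := sq (bmeas_cesaro n bh); have s2 := sq (bmeas_cesaro n bd).
apply: le_trans (nrmD s1 (sqintZ (-1) s2)) _; rewrite nrmZ// normrN normr1 mul1r.
have := cesaro_contr n bh; rewrite -/c in hlt; lra.
Qed.

Let av_cauchy e : 0 < e -> exists N, forall m n, (N <= m)%N -> (N <= n)%N ->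
  nrm (fun x => av m x - av n x) <= e.
Proof.
move=> e0.
(* The parallelogram identity bounds the squared distance by [4 (c + e')^2 - 4 c^2], which is at
   most [4 e' (2 c + 1)] when [e' <= 1]. *)
pose e' := Num.min 1 (e ^+ 2 / (4 * (2 * c + 1))).
have e'0 : 0 < e'.
  rewrite lt_min ltr01/= divr_gt0 ?exprn_gt0// mulr_gt0// ltr_wpDl// mulr_ge0//.
have [N hN] := av_near e'0.
exists N => m n Nm Nn.
rewrite -(@ler_pXn2r _ 2)// ?nnegrE ?nrm_ge0 ?(ltW e0)//.
have [hm hn] := (hull_av m, hull_av n).
rewrite parallelogram; [|exact: sq hm.1|exact: sq hn.1].
have h1 := c_le (hull_mid hm hn).
have hm2 : nrm (av m) ^+ 2 <= (c + e') ^+ 2.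
  by rewrite ler_pXn2r ?nnegrE ?nrm_ge0 ?addr_ge0 ?(ltW e'0)//; exact: hN.
have hn2 : nrm (av n) ^+ 2 <= (c + e') ^+ 2.
  by rewrite ler_pXn2r ?nnegrE ?nrm_ge0 ?addr_ge0 ?(ltW e'0)//; exact: hN.
have h3 : c ^+ 2 <= nrm (fun x => av m x + 2^-1 * (av n x - av m x)) ^+ 2.
  by rewrite ler_pXn2r// ?nnegrE ?nrm_ge0.
have e'1 : e' <= 1 by rewrite ge_min lexx.
have e'2 : e' * (4 * (2 * c + 1)) <= e ^+ 2.
  rewrite -ler_pdivlMr; first by rewrite ge_min lexx orbT.
  by rewrite mulr_gt0// ltr_wpDl// mulr_ge0.
have : e' ^+ 2 <= e' by rewrite expr2 ler_piMr// ltW.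
have := ltW e'0; move: c_ge0 => *; nra.
Qed.

(** A single good index suffices for the choice of group length later. The limit is built by hand: a
    fast subsequence converges almost everywhere, its limit is invariant under [K], hence constant
    by [K_erg]. *)
Lemma mean_ergodic_theorem e : 0 < e -> exists n, nrm (fun x => av n x - 'E g) < e.
Proof.
move=> e0.
have [M hM] := bg.2.
have M0 : 0 <= M by apply: le_trans (hM point).
have half0 k : 0 < 2^-1 ^+ k :> R by rewrite exprn_gt0// invr_gt0.
have /choice [N hN] : forall k, exists N, forall m n, (N <= m)%N -> (N <= n)%N ->
  nrm (fun x => av m x - av n x) <= 2^-1 ^+ k by move=> k; exact: av_cauchy.
(* Summing makes [s l] dominate [N k] for all [k <= l], so both [s k] and [s k.+1] are in the range
   of the Cauchy bound for [k]; the added 1 gives [k <= s k]. *)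
pose s k := (\sum_(i < k.+1) (N i + 1))%N.
have sN k l : (k <= l)%N -> (N k <= s l)%N.
  move=> kl; rewrite /s (bigD1 (Ordinal (kl : (k < l.+1)%N)))//= addn1; lia.
have sk k : (k <= s k)%N.
  elim: k => // k ih; rewrite /s big_ord_recr/= addn1 addnS ltnS.
  exact: leq_trans ih (leq_addr _ _).
pose y k := av (s k).
have by_ k : bmeas (y k) by exact: bmeas_cesaro.
have yM k x : `|y k x| <= M by exact: cesaro_bound.
have cv : {ae P, forall x, cvgn (y^~ x)}.
  apply: (@ae_cvg_of_nrm_summable _ _ _ P) => [k|k]; first exact: sq.
  by apply: hN; apply: sN.
(* Clamping the upper limit makes [G] bounded everywhere, also off the set of convergence, so that
   the hypotheses on [K] apply to it. *)
pose cl (z : R) : R := Num.max (- M) (Num.min M z).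
have cl_bound z : `|cl z| <= M.
  rewrite /cl ler_norml le_max lexx/= ge_max ge_min lexx/= andbT.
  by rewrite lerNl (le_trans _ M0)// oppr_le0.
have cl_id z : `|z| <= M -> cl z = z.
  by rewrite ler_norml => /andP[h1 h2]; rewrite /cl min_r// max_r.
pose G x : R := cl (limn_sup (y^~ x)).
have bG : bmeas G.
  split; last by exists M => x; exact: cl_bound.
  apply: measurable_maxr => //; apply: measurable_minr => //.
  apply: measurable_fun_limn_sup.
  - by move=> x _; exists M => _ [k _ <-]; exact: le_trans (ler_norm _) (yM k x).
  - by move=> x _; exists (- M) => _ [k _ <-]; have := yM k x; rewrite ler_norml => /andP[].
  - by move=> k; case: (by_ k).
have yG : {ae P, forall x, y k x @[k --> \oo] --> G x}.
  apply: filterS cv => x cx.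
  have l : `|limn (y^~ x)| <= M.
    rewrite ler_norml; apply/andP; split.
      by apply: limr_ge => //; apply: nearW => k; have := yM k x; rewrite ler_norml => /andP[].
    by apply: limr_le => //; apply: nearW => k; have := yM k x; rewrite ler_norml => /andP[].
  by rewrite /G (cvg_limn_supE cx) cl_id.
have nyG : nrm (fun x => y k x - G x) @[k --> \oo] --> (0 : R).
  have : 'E (fun x => (y k x - G x) ^+ 2) @[k --> \oo] --> 'E (fun=> 0).
    apply: (@E_DCT _ _ _ P _ _ (fun=> (2 * M) ^+ 2)).
    - by move=> k; apply: measurable_funX; case: (bmeasB (by_ k) bG).
    - by [].
    - exact: integ_cst.
    - move=> k x; rewrite ger0_norm ?sqr_ge0// -real_normK ?num_real// ler_pXn2r ?nnegrE ?mulr_ge0//.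
      apply: le_trans (ler_normB _ _) _; rewrite mulr_natl mulr2n lerD//; exact: cl_bound.
    - apply: filterS yG => x cx.
      have -> : (0 : R) = (G x - G x) ^+ 2 by rewrite subrr expr0n.
      rewrite expr2; under eq_fun do rewrite expr2.
      by apply: cvgM; apply: cvgB => //; exact: cvg_cst.
  rewrite E_cst => h.
  have := cvg_comp _ _ h (@sqrt_continuous R 0).
  by rewrite sqrtr0.
have KG : nrm (fun x => K G x - G x) = 0.
  apply/eqP; rewrite eq_le nrm_ge0 andbT.
  (* Write [K G - G] as [K (G - y k) + (y k - G) - (y k - K (y k))]. The first two terms have norm
     at most that of [y k - G], and the last is an average of [g - K g], which telescopes. *)
  have b k : nrm (fun x => K G x - G x) <= 2 * nrm (fun x => y k x - G x) + 2 * nrm g / k.+1%:R.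
    have bk := by_ k; have bKG := K_bmeas bG; have bKy := K_bmeas bk.
    have bd : bmeas (fun x => G x + -1 * y k x) by apply: bmeasD => //; exact: bmeasZ.
    have -> : (fun x => K G x - G x) = (fun x => K (fun x => G x + -1 * y k x) x +
         ((y k x - G x) + (-1) * cesaro_mean (s k) (fun x => g x + -1 * K g x) x)).
      apply/funext => x; rewrite K_lin//.
      have -> : cesaro_mean (s k) (fun x => g x + -1 * K g x) = (fun x => y k x + -1 * K (y k) x).
        rewrite cesaro_lin//; last exact: K_bmeas.
        apply/funext => z; congr (_ + _ * _).
        (* [K_lin] treats two terms at a time, so commuting [K] with an average takes an induction
           on the number of terms and then a scaling. *)
        have KZ m : K (fun x => m.+1%:R^-1 * \sum_(j < m.+1) iter j K g x) =
            cesaro_mean m (K g).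
          have Ks l : K (fun x => \sum_(j < l) iter j K g x) = (fun x => \sum_(j < l) iter j K (K g) x).
            elim: l => [|l ih].
              have := K_lin (-1) bg bg.
              have -> : (fun x => g x + -1 * g x) = (fun x => \sum_(j < 0) iter j K g x).
                by apply/funext => x'; rewrite big_ord0; ring.
              by move=> ->; apply/funext => x'; rewrite big_ord0; ring.
            have := K_lin 1 (bmeas_sum (index_enum 'I_l) (fun j : 'I_l => it_bmeas j bg)) (it_bmeas l bg).
            have -> : (fun x => \sum_(j < l) it j g x + 1 * it l g x) =
                (fun x => \sum_(j < l.+1) iter j K g x).
              by apply/funext => x'; rewrite big_ord_recr/= mul1r.
            rewrite ih.
            move=> ->; apply/funext => x'; rewrite big_ord_recr/= mul1r; congr (_ + _).
            by rewrite /it -iterS iterSr.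
          have bs l : bmeas (fun x => \sum_(j < l) iter j K g x).
            by apply: bmeas_sum => j; exact: it_bmeas.
          have := K_lin (m.+1%:R^-1 - 1) (bs m.+1) (bs m.+1).
          have -> : (fun x => \sum_(j < m.+1) iter j K g x +
              (m.+1%:R^-1 - 1) * \sum_(j < m.+1) iter j K g x) =
              (fun x => m.+1%:R^-1 * \sum_(j < m.+1) iter j K g x).
            by apply/funext => x'; ring.
          move=> ->; rewrite Ks; apply/funext => x'; rewrite /cesaro_mean; ring.
        by rewrite -KZ.
      ring.
    have bc : bmeas (cesaro_mean (s k) (fun x => g x + -1 * K g x)).
      by apply: bmeas_cesaro; apply: bmeasD => //; apply: bmeasZ; exact: K_bmeas.
    have s1 := sq (K_bmeas bd); have s2 := sq (bmeasB bk bG); have s3 := sq bc.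
    apply: le_trans (nrmD s1 (sqintD s2 (sqintZ (-1) s3))) _.
    have n1 : nrm (K (fun x => G x + -1 * y k x)) <= nrm (fun x => y k x - G x).
      apply: le_trans (K_contr bd) _.
      have -> : (fun x => G x + -1 * y k x) = (fun x => -1 * (y k x - G x)) by apply/funext => x; ring.
      by rewrite nrmZ// normrN normr1 mul1r.
    have n2 := nrmD s2 (sqintZ (-1) s3).
    rewrite nrmZ// normrN normr1 mul1r in n2.
    have n3 := cesaro_cob (s k) bg.
    have n4 : 2 * nrm g / (s k).+1%:R <= 2 * nrm g / k.+1%:R.
      by rewrite ler_wpM2l ?mulr_ge0 ?nrm_ge0// lef_pV2 ?posrE ?ltr0Sn// ler_nat ltnS.
    apply: le_trans (lerD n1 n2) _.
    apply: le_trans (lerD (lexx _) (lerD (lexx _) (le_trans n3 n4))) _.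
    by rewrite addrA lerD2r [leRHS]mulr_natl mulr2n.
  have cv0 : 2 * nrm (fun x => y k x - G x) + 2 * nrm g / k.+1%:R @[k --> \oo] --> (0 : R).
    rewrite -[X in _ --> X]addr0; apply: cvgD; last exact: cvg_divS.
    by rewrite -[X in _ --> X](mulr0 2); apply: cvgM => //; exact: cvg_cst.
  rewrite -(cvg_lim _ cv0)//; apply: limr_ge; first by apply/cvg_ex; eexists; exact: cv0.
  exact: nearW.
have [c0 hc0] : exists c0, {ae P, forall x, G x = c0}.
  apply: K_erg => //.
  have := nrm0_ae (sq (bmeasB (K_bmeas bG) bG)) KG.
  by apply: filterS => x /eqP; rewrite subr_eq0 => /eqP.
have nyc k : nrm (fun x => y k x - c0) = nrm (fun x => y k x - G x).
  rewrite /nrm; congr Num.sqrt; apply: E_ae_eq.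
  - by apply: measurable_funX; case: (bmeasB (by_ k) (bmeas_cst c0)).
  - by apply: measurable_funX; case: (bmeasB (by_ k) bG).
  - by apply: filterS hc0 => x ->.
(* Averages preserve the expectation and converge to [c0] in norm. *)
have cE : c0 = 'E g.
  apply/eqP; rewrite -subr_eq0 -normr_le0.
  rewrite -(cvg_lim _ nyG)//; apply: limr_ge; first by apply/cvg_ex; eexists; exact: nyG.
  apply: nearW => k; rewrite -nyc.
  have sk' := sq (bmeasB (by_ k) (bmeas_cst c0)).
  apply: le_trans (E_abs_nrm sk'); apply: le_trans (E_abs (sqint_integ sk')).
  rewrite E_B; [|exact: integ_bmeas|exact: integ_cst].
  by rewrite E_cst cesaro_E// distrC.
have /cvgrPdist_lt/(_ e e0) [k _ hk] := nyG.
exists (s k); have := hk k (leqnn k).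
by rewrite /= sub0r normrN ger0_norm ?nrm_ge0// -nyc cE.
Qed.

End mean_ergodic.

(** * Taylor remainders of sine, cosine and exponential *)

Section trig_bounds.
Context {R : realType}.
Implicit Types x y : R.

Lemma MVT_bound (g dg : R -> R) (C x : R) : 0 <= x ->
  (forall y, is_derive y 1 g (dg y)) -> (forall y, 0 <= y <= x -> `|dg y| <= C) ->
  `|g x - g 0| <= C * x.
Proof.
move=> x0 dgE hC; have [->|xn] := eqVneq x 0; first by rewrite subrr normr0 mulr0.
have xp : 0 < x by rewrite lt_neqAle eq_sym xn.
have [y yx ->] : exists2 c, c \in `]0, x[ & g x - g 0 = dg c * (x - 0).
  apply: MVT => //; apply: continuous_subspaceT => z.
  by apply: differentiable_continuous; apply/derivable1_diffP; case: (dgE z).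
rewrite subr0 normrM (ger0_norm x0) ler_wpM2r// hC//.
by move: yx; rewrite in_itv/= => /andP[/ltW -> /ltW ->].
Qed.

Lemma abs_sin_le x : `|sin x| <= `|x|.
Proof.
wlog x0 : x / 0 <= x.
  move=> W; have [x0|x0] := leP 0 x; first exact: W.
  by rewrite -normrN -sinN -[leRHS]normrN; apply: W; rewrite oppr_ge0 ltW.
have := @MVT_bound sin cos 1 x x0 (fun y => is_derive_sin y) (fun y _ => cos_max y).
by rewrite sin0 subr0 mul1r (ger0_norm x0).
Qed.

Lemma one_sub_cos_le x : `|1 - cos x| <= x ^+ 2 / 2.
Proof.
have -> : x = (x / 2) *+ 2 by rewrite mulr2n; field.
rewrite cos_mulr2n cos2sin2.
have -> : 1 - ((1 - sin (x / 2) ^+ 2) *+ 2 - 1) = 2 * sin (x / 2) ^+ 2 by ring.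
rewrite normrM (ger0_norm (ler0n R 2)) normrX.
have h := abs_sin_le (x / 2).
have : `|sin (x / 2)| ^+ 2 <= `|x / 2| ^+ 2 by rewrite ler_pXn2r ?nnegrE.
rewrite [X in _ <= X]real_normK ?num_real//.
have -> : ((x / 2) *+ 2) ^+ 2 / 2 = 2 * (x / 2) ^+ 2 by field.
by lra.
Qed.

Lemma sin_sub_id_cube x : `|sin x - x| <= `|x| ^+ 3.
Proof.
wlog x0 : x / 0 <= x.
  move=> W; have [x0|x0] := leP 0 x; first exact: W.
  have := W (- x); rewrite oppr_ge0 (ltW x0) sinN normrN => /(_ isT).
  have -> : - sin x - - x = - (sin x - x) by ring.
  by rewrite normrN.
have d y : is_derive y 1 (fun z : R => sin z - z) (cos y - 1).
  by apply: is_deriveB.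
have := @MVT_bound (fun z => sin z - z) (fun z => cos z - 1) (x ^+ 2) x x0 d.
rewrite sin0 !subr0 (ger0_norm x0) -exprSr; apply => y /andP[y0 yx].
rewrite distrC; apply: le_trans (one_sub_cos_le y) _.
have : y ^+ 2 <= x ^+ 2 by rewrite ler_pXn2r ?nnegrE.
have := sqr_ge0 y; lra.
Qed.

Lemma sin_sub_id_sqr x : `|sin x - x| <= x ^+ 2.
Proof.
have [h|h] := leP `|x| 1.
  apply: le_trans (sin_sub_id_cube x) _.
  rewrite -[leRHS]real_normK ?num_real// exprS ler_piMl// sqr_ge0//.
have [h2|h2] := leP `|x| 2.
  (* between 1 and 2 the cubic bound is too weak *)
  wlog x0 : x h h2 / 0 <= x.
    move=> W; have [x0|x0] := leP 0 x; first exact: W.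
    have := W (- x); rewrite normrN oppr_ge0 (ltW x0) sinN sqrrN => /(_ h h2 isT).
    have -> : - sin x - - x = - (sin x - x) by ring.
  by rewrite normrN.
  have d y : is_derive y 1 (fun z : R => sin z - z) (cos y - 1) by apply: is_deriveB.
  have := @MVT_bound (fun z => sin z - z) (fun z => cos z - 1) (x ^+ 2 / 2) x x0 d.
  rewrite sin0 !subr0 (ger0_norm x0) in h h2 *.
  move=> W; apply: le_trans (W _) _.
    move=> y /andP[y0 yx]; rewrite distrC; apply: le_trans (one_sub_cos_le y) _.
    by rewrite ler_wpM2r// ler_pXn2r ?nnegrE.
  have := sqr_ge0 x; nra.
apply: le_trans (ler_normB _ _) _; have := abs_sin_le x.
rewrite -(real_normK (num_real x)); nra.
Qed.

(** The second-order Taylor remainder of the cosine. Its quadratic bound supplies an integrable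
    majorant, its cubic bound the pointwise limit, so no third moment is required. *)
Definition cosrem x := cos x - 1 + x ^+ 2 / 2.

Lemma cosrem_sqr x : `|cosrem x| <= x ^+ 2.
Proof.
rewrite /cosrem; have := one_sub_cos_le x; rewrite distrC => h.
apply: le_trans (ler_normD _ _) _.
rewrite (@ger0_norm _ (x ^+ 2 / 2)) ?divr_ge0 ?sqr_ge0//.
lra.
Qed.

Lemma cosrem_cube x : `|cosrem x| <= `|x| ^+ 3.
Proof.
have [h|h] := leP 1 `|x|.
  apply: le_trans (cosrem_sqr x) _.
  by rewrite -[leLHS]real_normK ?num_real// [leRHS]exprS ler_peMl// sqr_ge0.
wlog x0 : x h / 0 <= x.
  move=> W; have [x0|x0] := leP 0 x; first exact: W.
  have := W (- x); rewrite normrN oppr_ge0 (ltW x0) => /(_ h isT).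
  by rewrite /cosrem cosN sqrrN.
have d y : is_derive y 1 cosrem (- (sin y - y)).
  rewrite /cosrem.
  have d2 : is_derive y 1 (fun x : R => x ^+ 2 / 2) y.
    by apply: trigger_derive; rewrite /GRing.scale/=; field.
  have := is_deriveD (is_deriveB (is_derive_cos y) (is_derive_cst (1 : R) y 1)) d2.
  by have -> : - sin y - 0 + y = - (sin y - y) by ring.
have := @MVT_bound cosrem (fun y => - (sin y - y)) (x ^+ 2) x x0 d.
rewrite {2}/cosrem cos0 subrr expr0n /= mul0r addr0 subr0 (ger0_norm x0) -exprSr; apply.
move=> y /andP[y0 yx]; rewrite normrN; apply: le_trans (sin_sub_id_sqr y) _.
by rewrite ler_pXn2r ?nnegrE.
Qed.

Lemma cos_lip x y : `|cos x - cos y| <= `|x - y|.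
Proof.
have -> : x = y + (x - y) by rewrite addrC subrK.
move: (x - y) => z; have -> : y + z - y = z by ring.
wlog z0 : y z / 0 <= z.
  move=> W; have [z0|z0] := leP 0 z; first exact: W.
  have := W (y + z) (- z); rewrite oppr_ge0 (ltW z0) addrK normrN => /(_ isT).
  by rewrite distrC.
have d (w : R) : is_derive w 1 (fun w : R => cos (y + w)) (- sin (y + w)).
  by apply: trigger_derive; rewrite /GRing.scale/=; ring.
have := @MVT_bound (fun w => cos (y + w)) (fun w => - sin (y + w)) 1 z z0 d.
rewrite addr0 mul1r (ger0_norm z0); apply => w _.
by rewrite normrN; exact: sin_max.
Qed.

Lemma expR_sub_lin x : 0 <= x -> `|expR (- x) - (1 - x)| <= x ^+ 2.
Proof.
move=> x0.
have h1 := expR_ge1Dx (- x).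
rewrite ger0_norm; last by lra.
have [x1|x1] := leP 1 x.
  have : expR (- x) <= 1 by rewrite -[leRHS]expR0 ler_expR oppr_le0.
  nra.
have h2 := expR_ge1Dx x.
have e : expR (- x) * expR x = 1 by rewrite -expRD addNr expR0.
have h0 := expR_gt0 (- x).
have : expR (- x) * (1 + x) <= 1 by rewrite -[leRHS]e ler_wpM2l// ltW.
nra.
Qed.

End trig_bounds.

(** * Central limit theorem for conditionally centred increments *)

Section step_clt.
Context {d} {T : measurableType d} {R : realType}.
Variables (P : probability T R) (tau : T -> T).
Notation "''E' F" := (Rintegral P setT F) (at level 10, F at level 9) : ring_scope.
Notation integ F := (P.-integrable setT (EFin \o F)).
Hypothesis mtau : measurable_fun setT tau.
Hypothesis E_tau : forall F : T -> R, measurable_fun setT F -> 'E (fun p => F (tau p)) = 'E F.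
Variables (D : T -> R) (V eps : R).
Hypotheses (sD : sqint P D) (V0 : 0 <= V).
Hypothesis orth : forall A, bmeas A -> 'E (fun p => D p * A (tau p)) = 0.
Hypothesis var : forall A, bmeas A -> (forall p, `|A p| <= 1) ->
  `|'E (fun p => (D p ^+ 2 - V) * A (tau p))| <= eps.

Let mD : measurable_fun setT D. Proof. by case: sD. Qed.

Let mbs k : measurable_fun setT (bsum D tau k).
Proof.
elim: k => [|k ih].
  rewrite (_ : bsum D tau 0 = cst 0); first exact: measurable_cst.
  by apply/funext => p; rewrite /bsum big_ord0.
rewrite (_ : bsum D tau k.+1 = (fun p => D p + bsum D tau k (tau p))); last first.
  by apply/funext => p; rewrite bsumS.
by apply: measurable_funD => //; exact: measurableT_comp.
Qed.

Let bcos (F : T -> R) : measurable_fun setT F -> bmeas (fun p => cos (F p)).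
Proof.
move=> mF; split; last by exists 1 => p; exact: cos_max.
apply: measurableT_comp mF; apply: continuous_measurable_fun; exact: continuous_cos.
Qed.

Let bsin (F : T -> R) : measurable_fun setT F -> bmeas (fun p => sin (F p)).
Proof.
move=> mF; split; last by exists 1 => p; exact: sin_max.
apply: measurableT_comp mF; apply: continuous_measurable_fun; exact: continuous_sin.
Qed.

Let rho (y : R) : R := `|cosrem y| + `|sin y - y|.

Let mrho s : measurable_fun setT (fun p => rho (s * D p)).
Proof.
have ms : measurable_fun setT (fun p => s * D p) by exact: measurable_funM.
apply: measurable_funD; apply: measurableT_comp => //.
  apply: measurable_funD; last by apply: measurable_funM => //; exact: measurable_funX.
  by apply: measurable_funB => //; case: (bcos ms).
by apply: measurable_funB => //; case: (bsin ms).
Qed.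

Let rho_ge0 y : 0 <= rho y. Proof. by rewrite addr_ge0. Qed.

Let rho_sqr y : rho y <= 2 * y ^+ 2.
Proof. by have := cosrem_sqr y; have := sin_sub_id_sqr y; rewrite /rho; lra. Qed.

Let rho_cube y : rho y <= 2 * `|y| ^+ 3.
Proof. by have := cosrem_cube y; have := sin_sub_id_cube y; rewrite /rho; lra. Qed.

Let irho s : integ (fun p => rho (s * D p)).
Proof.
apply: (@integ_le _ _ _ P _ (fun p => 2 * (s * D p) ^+ 2)).
- exact: mrho.
- by apply: integZ; apply: sqint_sqr; exact: sqintZ.
- by move=> p; rewrite ger0_norm.
Qed.

Let x s th k := 'E (fun p => cos (s * bsum D tau k p + th)).

(** Expand the cosine to second order in the newest increment [s * D]. The linear term vanishes by
    [orth], the quadratic one gives the factor [1 - s^2 V / 2] up to [eps], and replacing this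
    factor by an exponential costs the last square. *)
Let step s th k :
  `|x s th k.+1 - expR (- (s ^+ 2 * V / 2)) * x s th k| <=
  s ^+ 2 / 2 * eps + 'E (fun p => rho (s * D p)) + (s ^+ 2 * V / 2) ^+ 2.
Proof.
pose B p := s * bsum D tau k p + th.
have mB : measurable_fun setT B by apply: measurable_funD => //; exact: measurable_funM.
have bC := bcos mB; have bS := bsin mB.
have bCt : bmeas (fun p => cos (B (tau p))) by exact: (bmeas_comp bC mtau).
have bSt : bmeas (fun p => sin (B (tau p))) by exact: (bmeas_comp bS mtau).
have iD2 := sqint_sqr sD.
pose r p := cosrem (s * D p) * cos (B (tau p)) - (sin (s * D p) - s * D p) * sin (B (tau p)).
have mr : measurable_fun setT r.
  have ms : measurable_fun setT (fun p => s * D p) by exact: measurable_funM.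
  apply: measurable_funB; apply: measurable_funM.
  - apply: measurable_funD; last by apply: measurable_funM => //; exact: measurable_funX.
    by apply: measurable_funB => //; case: (bcos ms).
  - by case: bCt.
  - by apply: measurable_funB => //; case: (bsin ms).
  - by case: bSt.
have r_le p : `|r p| <= rho (s * D p).
  apply: le_trans (ler_normB _ _) _; rewrite !normrM lerD// ler_piMr//.
    exact: cos_max.
  exact: sin_max.
have ir : integ r by apply: integ_le (irho s) _.
have i1 : integ (fun p => cos (B (tau p))) by exact: integ_bmeas.
have i2 : integ (fun p => (D p ^+ 2 - V) * cos (B (tau p))).
  by apply: integMb => //; apply: integB => //; exact: integ_cst.
have i3 : integ (fun p => D p * sin (B (tau p))) by apply: integMb => //; exact: sqint_integ.
have -> : x s th k.+1 = (1 - s ^+ 2 * V / 2) * x s th k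
    - s ^+ 2 / 2 * 'E (fun p => (D p ^+ 2 - V) * cos (B (tau p)))
    - s * 'E (fun p => D p * sin (B (tau p))) + 'E r.
  rewrite {2}/x -(E_tau (F := fun p => cos (B p))); last by case: bC.
  rewrite -!E_Z// -E_B; [|exact: integZ|exact: integZ].
  rewrite -E_B; [|by apply: integB; exact: integZ|exact: integZ].
  rewrite -E_D//; last by apply: integB; [apply: integB|]; exact: integZ.
  apply: eq_Rintegral => p _; rewrite bsumS.
  have -> : s * (D p + bsum D tau k (tau p)) + th = s * D p + B (tau p) by rewrite /B; ring.
  by rewrite cosD /r /cosrem; field.
have o : 'E (fun p => D p * sin (B (tau p))) = 0 := orth bS.
rewrite o mulr0 subr0.
set e := 'E (fun p => (D p ^+ 2 - V) * _).
have he : `|e| <= eps by apply: (var bC) => p; exact: cos_max.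
have hr : `|'E r| <= 'E (fun p => rho (s * D p)).
  by apply: le_trans (E_abs ir) _; apply: E_le => //; exact: integ_abs.
have hx : `|x s th k| <= 1.
  rewrite -[leRHS](E_cst P); apply: le_trans (E_abs (integ_bmeas P bC)) _.
  by apply: E_le; [exact/integ_abs/integ_bmeas|exact: integ_cst|move=> p; exact: cos_max].
set z := s ^+ 2 * V / 2.
have z0 : 0 <= z by rewrite divr_ge0// mulr_ge0// sqr_ge0.
have -> : (1 - z) * x s th k - s ^+ 2 / 2 * e + 'E r - expR (- z) * x s th k =
   - (s ^+ 2 / 2 * e) + 'E r + - ((expR (- z) - (1 - z)) * x s th k) by ring.
apply: le_trans (ler_normD _ _) _; apply: lerD.
  apply: le_trans (ler_normD _ _) _; apply: lerD => //.
  rewrite normrN normrM ger0_norm ?divr_ge0 ?sqr_ge0//.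
  by rewrite ler_wpM2l// divr_ge0// sqr_ge0.
rewrite normrN normrM; apply: le_trans (_ : `|expR (- z) - (1 - z)| <= _).
  by rewrite ler_piMr.
exact: expR_sub_lin.
Qed.

(** The exponential factor is at most 1, so the one-step errors just add up over the recursion. *)
Let steps s th N :
  `|x s th N - expR (- (N%:R * (s ^+ 2 * V / 2))) * cos th| <=
  N%:R * (s ^+ 2 / 2 * eps + 'E (fun p => rho (s * D p)) + (s ^+ 2 * V / 2) ^+ 2).
Proof.
set b := _ + _ ^+ 2; set z := s ^+ 2 * V / 2.
have z0 : 0 <= z by rewrite divr_ge0// mulr_ge0// sqr_ge0.
elim: N => [|N ih].
  rewrite !mul0r oppr0 expR0 mul1r /x.
  under eq_Rintegral do rewrite /bsum big_ord0 mulr0 add0r.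
  by rewrite E_cst subrr normr0.
have -> : x s th N.+1 - expR (- (N.+1%:R * z)) * cos th =
  (x s th N.+1 - expR (- z) * x s th N) + expR (- z) * (x s th N - expR (- (N%:R * z)) * cos th).
  have -> : - (N.+1%:R * z) = - z + - (N%:R * z) by rewrite -addn1 natrD; ring.
  by rewrite expRD; ring.
apply: le_trans (ler_normD _ _) _.
have -> : N.+1%:R * b = b + N%:R * b by rewrite -natr1; ring.
apply: lerD; first exact: step.
rewrite normrM ger0_norm ?expR_ge0//; apply: le_trans ih.
by rewrite ler_piMl// -[leRHS]expR0 ler_expR oppr_le0.
Qed.

(** Lindeberg's condition by dominated convergence: at scale [t / sqrt N] the summed remainder is
    dominated by [2 (t D)^2] and is pointwise of order [1 / sqrt N]. *)
Lemma cvg_rho t : N.+1%:R * 'E (fun p => rho (t / Num.sqrt N.+1%:R * D p)) @[N --> \oo] --> (0 : R).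
Proof.
have s0 N : 0 < Num.sqrt N.+1%:R :> R by rewrite sqrtr_gt0 ltr0Sn.
have sq N : Num.sqrt N.+1%:R ^+ 2 = N.+1%:R :> R by rewrite sqr_sqrtr.
have -> : (0 : R) = 'E (fun=> 0) by rewrite E_cst.
under eq_fun do rewrite -E_Z//.
apply: (@E_DCT _ _ _ P _ _ (fun p => 2 * (t * D p) ^+ 2)).
- by move=> N; apply: measurable_funM => //; exact: mrho.
- by [].
- by apply: integZ; apply: sqint_sqr; exact: sqintZ.
- move=> N p; rewrite ger0_norm ?mulr_ge0//.
  have := rho_sqr (t / Num.sqrt N.+1%:R * D p).
  have -> : t / Num.sqrt N.+1%:R * D p = (t * D p) / Num.sqrt N.+1%:R by rewrite mulrAC.
  rewrite [in leRHS]exprMn exprVn sq mulrA ler_pdivlMr ?ltr0Sn//.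
  by rewrite mulrC.
- apply: nearW => p.
  apply: (@squeeze_cvgr _ _ _ _ (fun=> 0) (fun N => 2 * `|t * D p| ^+ 3 * (Num.sqrt N.+1%:R)^-1)).
  + apply: nearW => N; rewrite mulr_ge0//=.
    have := rho_cube (t / Num.sqrt N.+1%:R * D p).
    have -> : t / Num.sqrt N.+1%:R * D p = (t * D p) / Num.sqrt N.+1%:R by rewrite mulrAC.
    rewrite normrM normfV (ger0_norm (ltW (s0 N))) exprMn => h.
    rewrite -[X in X * _](sq N).
    have := s0 N; move: (Num.sqrt N.+1%:R) h => y h y0.
    have -> : 2 * `|t * D p| ^+ 3 / y = y ^+ 2 * (2 * (`|t * D p| ^+ 3 * (y^-1) ^+ 3)).
      by field; rewrite lt0r_neq0.
    by rewrite ler_wpM2l// sqr_ge0.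
  + exact: cvg_cst.
  + rewrite -[X in _ --> X](mulr0 (2 * `|t * D p| ^+ 3)); apply: cvgM; first exact: cvg_cst.
    have -> : (fun N => (Num.sqrt N.+1%:R)^-1) = (fun N => Num.sqrt (harmonic N) : R).
      by apply/funext => N; rewrite /harmonic /= sqrtrV.
    have := cvg_comp _ _ (@cvg_harmonic R) (@sqrt_continuous R 0).
    by rewrite sqrtr0.
Qed.

(** The variance defect [eps] is fixed, so a residual [t^2 eps / 2] survives the limit in [N]; it is
    made small afterwards through the size of the group. *)
Lemma step_clt t th del : 0 < del -> exists N0, forall N, (N0 <= N)%N ->
  `|'E (fun p => cos (t / Num.sqrt N%:R * bsum D tau N p + th)) - expR (- (t ^+ 2 * V / 2)) * cos th|
  <= t ^+ 2 / 2 * eps + del.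
Proof.
move=> del0.
have h1 : N.+1%:R * 'E (fun p => rho (t / Num.sqrt N.+1%:R * D p)) +
    (t ^+ 2 * V / 2) ^+ 2 / N.+1%:R @[N --> \oo] --> (0 : R).
  rewrite -[X in _ --> X]addr0; apply: cvgD; first exact: cvg_rho.
  rewrite -[X in _ --> X](mulr0 ((t ^+ 2 * V / 2) ^+ 2)); apply: cvgM; first exact: cvg_cst.
  exact: cvg_harmonic.
have /cvgrPdist_le/(_ _ del0) [N0 _ hN] := h1.
exists N0.+1 => -[//|N]; rewrite ltnS => NN; have := hN N NN.
rewrite /= sub0r normrN => /(le_trans (ler_norm _)) h.
have n0 : (0 < N.+1%:R :> R) by rewrite ltr0Sn.
have sE : (t / Num.sqrt N.+1%:R) ^+ 2 = t ^+ 2 / N.+1%:R.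
  by rewrite exprMn exprVn sqr_sqrtr// ltW.
have := steps (t / Num.sqrt N.+1%:R) th N.+1; rewrite sE /x.
have -> : N.+1%:R * (t ^+ 2 / N.+1%:R * V / 2) = t ^+ 2 * V / 2.
  by move: (N.+1%:R : R) n0 => y y0; field; rewrite lt0r_neq0.
move=> /le_trans; apply.
have -> : N.+1%:R * (t ^+ 2 / N.+1%:R / 2 * eps + 'E (fun p => rho (t / Num.sqrt N.+1%:R * D p)) +
   (t ^+ 2 / N.+1%:R * V / 2) ^+ 2) =
   t ^+ 2 / 2 * eps + (N.+1%:R * 'E (fun p => rho (t / Num.sqrt N.+1%:R * D p)) +
     (t ^+ 2 * V / 2) ^+ 2 / N.+1%:R).
  move: ('E _) => w; move: (N.+1%:R : R) n0 => y y0; field; rewrite lt0r_neq0//.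
by rewrite lerD2l.
Qed.

End step_clt.

(** * The Gaussian characteristic function *)

Section gaussian.
Context {R : realType}.
Local Notation mu := (@lebesgue_measure R).
Local Notation pdf := (normal_pdf (0 : R) 1).

Lemma normal_pdf01E (x : R) : pdf x = normal_peak 1 * expR (- x ^+ 2 / 2).
Proof. by rewrite normal_pdfE ?oner_neq0// /normal_fun subr0 expr1n. Qed.

Lemma is_derive_normal_pdf01 (x : R) : is_derive x 1 pdf (- x * pdf x).
Proof.
rewrite (_ : pdf = fun x => normal_peak 1 * expR (- x ^+ 2 / 2)); last first.
  by apply/funext => y; exact: normal_pdf01E.
by apply: trigger_derive; rewrite /GRing.scale/=; field.
Qed.

(* [|x| <= 1 + 3 x^2 / 8 <= exp (3 x^2 / 8)], so one factor [|x|] only widens the density. *)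
Lemma normr_normal_pdf_le (x : R) :
  `|x| * pdf x <= normal_peak 1 / normal_peak 2 * normal_pdf 0 2 x.
Proof.
have p2 : normal_peak 2 != 0 :> R by rewrite gt_eqF// normal_peak_gt0 ?pnatr_eq0.
rewrite normal_pdf01E normal_pdfE ?pnatr_eq0// /normal_fun subr0 mulrCA.
rewrite (mulrA (normal_peak 1 / _)) divfK//.
rewrite ler_wpM2l ?normal_peak_ge0//.
have -> : - x ^+ 2 / (2 ^+ 2 *+ 2) = 3 * x ^+ 2 / 8 + - x ^+ 2 / 2 by field.
rewrite expRD ler_wpM2r ?expR_ge0//.
apply: le_trans (expR_ge1Dx _).
rewrite -[x ^+ 2]real_normK ?num_real//; have := normr_ge0 x; move: `|x| => y y0.
have := sqr_ge0 (3 * y - 4); lra.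
Qed.

Lemma integrable_bounded_pdf (g : R -> R) (B : R) : measurable_fun setT g ->
  (forall x, `|g x| <= B) -> mu.-integrable setT (EFin \o (fun x => g x * pdf x)).
Proof.
move=> mg gB; apply: (@le_integrable _ _ _ mu setT _ _ (fun x => (B * pdf x)%:E)) => //.
- by apply/measurable_EFinP; apply: measurable_funM => //; exact: measurable_normal_pdf.
- move=> x _ /=; rewrite lee_fin !normrM ler_wpM2r//.
  by apply: le_trans (gB x) _; exact: ler_norm.
- by have := integrableZl measurableT B (integrable_normal_pdf 0 1).
Qed.

Lemma integrable_dom_pdf (C : R) :
  mu.-integrable setT (EFin \o (fun x => C * normal_pdf 0 2 x)).
Proof. by have := integrableZl measurableT C (integrable_normal_pdf 0 2). Qed.

Lemma integrable_bounded_id_pdf (g : R -> R) (B : R) : measurable_fun setT g ->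
  (forall x, `|g x| <= B) -> mu.-integrable setT (EFin \o (fun x => x * g x * pdf x)).
Proof.
move=> mg gB; have B0 : 0 <= B by apply: le_trans (gB 0).
have id := integrable_dom_pdf (B * (normal_peak 1 / normal_peak 2)).
apply: (le_integrable _ _ _ id) => //.
- apply/measurable_EFinP; apply: measurable_funM; last exact: measurable_normal_pdf.
  exact: measurable_funM.
- move=> x _ /=; rewrite lee_fin.
  apply: le_trans (ler_norm _); rewrite !normrM (ger0_norm (normal_pdf_ge0 _ _ _)).
  rewrite -[leRHS]mulrA (mulrC `|x|) -mulrA.
  by apply: ler_pM => //; [rewrite mulr_ge0 ?normal_pdf_ge0|exact: normr_normal_pdf_le].
Qed.

Lemma measurable_cos_lin (t th : R) : measurable_fun setT (fun x : R => cos (t * x + th)).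
Proof.
apply: (measurableT_comp (f := @cos R)).
  by apply: continuous_measurable_fun; exact: continuous_cos.
by apply: measurable_funD => //; exact: measurable_funM.
Qed.

Lemma measurable_sin_lin (t th : R) : measurable_fun setT (fun x : R => sin (t * x + th)).
Proof.
apply: (measurableT_comp (f := @sin R)).
  by apply: continuous_measurable_fun; exact: continuous_sin.
by apply: measurable_funD => //; exact: measurable_funM.
Qed.

Lemma normal_pdf01_le_inv (n : nat) (x : R) : n.+1%:R <= `|x| ->
  pdf x <= normal_peak 1 / normal_peak 2 * normal_peak 2 / n.+1%:R.
Proof.
move=> nx; rewrite ler_pdivlMr ?ltr0n//.
apply: le_trans (_ : `|x| * pdf x <= _).
  by rewrite mulrC ler_wpM2r// normal_pdf_ge0.
apply: le_trans (normr_normal_pdf_le x) _.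
rewrite ler_wpM2l ?divr_ge0 ?normal_peak_ge0//.
by apply: normal_pdf_ub; rewrite pnatr_eq0.
Qed.

Let H (t th x : R) := sin (t * x + th) * pdf x.
Let dH (t th x : R) := t * (cos (t * x + th) * pdf x) - x * sin (t * x + th) * pdf x.

Let is_derive_H (t th x : R) : is_derive x 1 (H t th) (dH t th x).
Proof.
have ds : is_derive x 1 (fun x => sin (t * x + th)) (t * cos (t * x + th)).
  by apply: trigger_derive; rewrite /GRing.scale/=; ring.
have h := is_deriveM ds (is_derive_normal_pdf01 x).
by refine (is_derive_eq h _); rewrite /dH /GRing.scale/=; ring.
Qed.

Let integrable_dH (t th : R) : mu.-integrable setT (EFin \o dH t th).
Proof.
have i1 := integrable_bounded_pdf (measurable_cos_lin t th) (fun x => cos_max _).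
have i2 := integrable_bounded_id_pdf (measurable_sin_lin t th) (fun x => sin_max _).
have := integrableB measurableT (integrableZl measurableT t i1) i2.
by apply: eq_integrable.
Qed.

(** Stein's identity for [sin (t x + th)]: the integrand is the derivative of [H], and the boundary
    values of [H] vanish at infinity. *)
Lemma normal_pdf_by_parts (t th : R) : \int[mu]_x dH t th x = 0.
Proof.
pose A n : set R := `[- n.+1%:R, n.+1%:R]%classic.
have mdH : measurable_fun setT (dH t th) by have /integrableP[/measurable_EFinP] := integrable_dH t th.
have cv : \int[mu]_x (dH t th x * \1_(A n) x) @[n --> \oo] --> \int[mu]_x dH t th x.
  have [||||| _ _ h] := @dominated_convergence _ _ _ mu setT measurableT
    (fun n x => (dH t th x * \1_(A n) x)%:E) (EFin \o dH t th) (fun x => `|(dH t th x)%:E|%E).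
  - move=> n; apply/measurable_EFinP; apply: measurable_funM => //.
    by apply: measurable_indic; exact: measurable_itv.
  - exact/measurable_EFinP.
  - apply: nearW => x _; apply: cvg_near_cst.
    exists (Num.truncn `|x|) => // n /= hn; congr EFin; rewrite indicE mem_set ?mulr1//.
    rewrite /A /= in_itv/= -ler_norml; apply: ltW; apply: lt_le_trans (truncnS_gt _) _.
    by rewrite ler_nat.
  - exact: integrable_abse (integrable_dH t th).
  - apply: nearW => x n _ /=; rewrite lee_fin normrM ler_piMr//.
    by rewrite indicE; case: (_ \in _); rewrite ?normr1 ?normr0.
  apply: fine_cvg; rewrite fineK//; exact: integrable_fin_num (integrable_dH t th).
have E n : \int[mu]_x (dH t th x * \1_(A n) x) = H t th n.+1%:R - H t th (- n.+1%:R).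
  have lt : - n.+1%:R < n.+1%:R :> R by have h0 : (0 : R) < n.+1%:R := ltr0Sn _ _; lra.
  have cH x : {for x, continuous (H t th)}.
    by apply: differentiable_continuous; apply/derivable1_diffP; case: (is_derive_H t th x).
  transitivity (fine (\int[mu]_(x in A n) (dH t th x)%:E)%E).
    rewrite -[in RHS](setTI (A n)) integral_mkcondr; congr fine.
    apply: eq_integral => x _; rewrite patchE/= indicE; case: (x \in A n); rewrite ?mulr1//.
    by rewrite mulr0.
  rewrite (@continuous_FTC2 _ _ (H t th))//.
  - apply: continuous_subspaceT => x; apply: cvgB; apply: cvgM.
    + exact: cvg_cst.
    + apply: cvgM; last by apply: continuous_normal_pdf; rewrite oner_eq0.
      apply: (@continuous_comp R R R (fun y => t * y + th) cos); last exact: continuous_cos.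
      by apply: cvgD; [apply: cvgM; [exact: cvg_cst|exact: cvg_id]|exact: cvg_cst].
    + apply: cvgM; first exact: cvg_id.
      apply: (@continuous_comp R R R (fun y => t * y + th) sin); last exact: continuous_sin.
      by apply: cvgD; [apply: cvgM; [exact: cvg_cst|exact: cvg_id]|exact: cvg_cst].
    + by apply: continuous_normal_pdf; rewrite oner_eq0.
  - split.
    + by move=> x _; case: (is_derive_H t th x).
    + by apply: cvg_at_right_filter; exact: cH.
    + by apply: cvg_at_left_filter; exact: cH.
  - by move=> x _; rewrite derive1E; case: (is_derive_H t th x).
apply: (cvg_unique _ cv) => //.
apply: norm_cvg0.
pose K : R := 2 * (normal_peak 1 / normal_peak 2 * normal_peak 2).
apply: (@squeeze_cvgr _ _ _ _ (fun=> 0 : R) (fun n => K * n.+1%:R^-1)).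
- apply: nearW => n; rewrite normr_ge0/= E.
  apply: le_trans (ler_normB _ _) _; rewrite /H !normrM.
  have h x : n.+1%:R <= `|x| -> `|sin (t * x + th)| * `|pdf x| <= K / 2 * n.+1%:R^-1.
    move=> /normal_pdf01_le_inv hx; rewrite (ger0_norm (normal_pdf_ge0 _ _ _)).
    apply: le_trans (_ : pdf x <= _).
      by rewrite ler_piMl ?normal_pdf_ge0// sin_max.
    apply: le_trans hx _; rewrite /K; set c := normal_peak 1 / _ * _.
    by have -> : 2 * c / 2 = c by field.
  have h1 := h n.+1%:R; have h2 := h (- n.+1%:R).
  rewrite normrN ger0_norm ?ler0n// in h2.
  rewrite ger0_norm ?ler0n// in h1.
  have := h1 (lexx _); have := h2 (lexx _).
  have -> : K * n.+1%:R^-1 = K / 2 * n.+1%:R^-1 + K / 2 * n.+1%:R^-1 by have := ltr0Sn R n => hn; field; rewrite gt_eqF.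
  by move=> ? ?; exact: lerD.
- exact: cvg_cst.
- rewrite -[X in _ --> X](mulr0 K); apply: cvgM; first exact: cvg_cst.
  exact: cvg_harmonic.
Qed.

Let F (th t : R) := \int[mu]_x (cos (t * x + th) * pdf x).

(** Differentiation under the integral, dominated by a wider Gaussian density, produces
    [- x sin (t x + th)], and Stein's identity turns it back into a cosine. *)
Let is_derive_F (th t : R) : is_derive t 1 (F th) (- t * F th t).
Proof.
pose f (t x : R) := cos (t * x + th) * pdf x.
have df (s x : R) : is_derive s 1 (f^~ x) (- (x * sin (s * x + th) * pdf x)).
  by rewrite /f; apply: trigger_derive; rewrite /GRing.scale/=; ring.
have E1 s x : partial1of2 f s x = - (x * sin (s * x + th) * pdf x).
  by rewrite partial1of2E; case: (df s x).
pose G (x : R) : R := normal_peak 1 / normal_peak 2 * normal_pdf 0 2 x.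
have Ia : `]t - 1, t + 1[%classic t by rewrite /= in_itv/=; apply/andP; split; lra.
have if_ s : `]t - 1, t + 1[%classic s -> mu.-integrable setT (EFin \o f s).
  move=> _; exact: integrable_bounded_pdf (measurable_cos_lin s th) (fun x => cos_max _).
have df_ s x : `]t - 1, t + 1[%classic s -> [set: R] x -> derivable (f^~ x) s 1.
  by move=> _ _; case: (df s x).
have G0 x : 0 <= G x by rewrite mulr_ge0 ?divr_ge0 ?normal_peak_ge0 ?normal_pdf_ge0.
have iG : mu.-integrable setT (EFin \o G) by exact: integrable_dom_pdf.
have fG s x : `]t - 1, t + 1[%classic s -> [set: R] x -> `|partial1of2 f s x| <= G x.
  move=> _ _; rewrite E1 normrN !normrM (ger0_norm (normal_pdf_ge0 _ _ _)).
  apply: le_trans (normr_normal_pdf_le x); rewrite -mulrA ler_wpM2l//.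
  by rewrite ler_piMl ?normal_pdf_ge0// sin_max.
have dF : derivable (F th) t 1.
  exact: (@derivable_under_integral _ _ _ mu f setT measurableT t _ _ Ia if_ df_ G G0 iG fG).
have vF : derive1 (F th) t = \int[mu]_x - (x * sin (t * x + th) * pdf x).
  rewrite (@differentiation_under_integral _ _ _ mu f setT measurableT t _ _ Ia if_ df_ G G0 iG fG).
  by apply: eq_Rintegral => x _; exact: E1.
apply: DeriveDef => //; rewrite -derive1E vF.
have i1 := integrable_bounded_pdf (measurable_cos_lin t th) (fun x => cos_max _).
have i2 := integrable_bounded_id_pdf (measurable_sin_lin t th) (fun x => sin_max _).
have := normal_pdf_by_parts t th; rewrite /dH RintegralB//; last first.
  by have := integrableZl measurableT t i1.
rewrite RintegralZl// => /eqP; rewrite subr_eq0 => /eqP h.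
have -> : \int[mu]_x - (x * sin (t * x + th) * pdf x) = - \int[mu]_x (x * sin (t * x + th) * pdf x).
  by rewrite -[RHS]mulN1r -RintegralZl//; apply: eq_Rintegral => x _; rewrite mulN1r.
by rewrite -h mulNr.
Qed.

(** [F' = - t F] makes [F * exp (t^2 / 2)] constant. The sign of [t] is normalised because
    [MVT_bound] works on [[0, x]]. *)
Lemma integral_cos_normal_pdf (t th : R) :
  \int[mu]_x (cos (t * x + th) * pdf x) = expR (- (t ^+ 2 / 2)) * cos th.
Proof.
wlog t0 : t th / 0 <= t.
  move=> h; have [|t0] := leP 0 t; first exact: h.
  have := h (- t) (- th); rewrite oppr_ge0 (ltW t0) => /(_ isT).
  rewrite sqrrN cosN => <-; apply: eq_Rintegral => x _.
  by rewrite mulNr -opprD cosN.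
pose u s := F th s * expR (s ^+ 2 / 2).
have du (s : R) : is_derive s 1 u 0.
  have de : is_derive s 1 (fun s => expR (s ^+ 2 / 2)) (s * expR (s ^+ 2 / 2)).
    by apply: trigger_derive; rewrite /GRing.scale/=; field.
  have h := is_deriveM (is_derive_F th s) de.
  by refine (is_derive_eq h _); rewrite /GRing.scale/=; ring.
have := @MVT_bound _ u (fun=> 0) 0 t t0 du.
rewrite normr0 mul0r => /(_ (fun _ _ => lexx _)).
rewrite normr_le0 subr_eq0 => /eqP.
have F0 : F th 0 = cos th.
  rewrite /F; under eq_Rintegral do rewrite mul0r add0r.
  rewrite RintegralZl//; last exact: integrable_normal_pdf.
  by rewrite /Rintegral integral_normal_pdf ?oner_neq0//= mulr1.
rewrite /u F0 expr0n mul0r expR0 mulr1 => h.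
by rewrite -h -/(F th t) mulrC -mulrA -expRD subrr expR0 mulr1.
Qed.

(** [normal_expect] is written as a Lebesgue integral with a density, while the convergence lemmas
    speak of a probability measure; this links the two. *)
Lemma normal_prob_E (g : R -> R) : bmeas g ->
  \int[normal_prob 0 1]_x g x = \int[mu]_x (g x * pdf x).
Proof.
have p0 x : 0 <= pdf x by exact: normal_pdf_ge0.
have mp := measurable_normal_pdf (0 : R) 1.
have ip g' : bmeas g' -> mu.-integrable setT (EFin \o (fun x => g' x * pdf x)).
  by move=> [mg [B hB]]; exact: integrable_bounded_pdf hB.
apply: (@monotone_class _ R R (@measurable _ R)
   (fun g => \int[normal_prob 0 1]_x g x = \int[mu]_x (g x * pdf x))).
- by rewrite [RHS]sigma_algebra_id//; exact: sigma_algebra_measurable.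
- by move=> A B; exact: measurableI.
- move=> C mC; rewrite [LHS]/Rintegral integral_indic// setIT /= /normal_prob.
  rewrite -[in LHS](setTI C) integral_mkcondr; congr fine.
  apply: eq_integral => x _; rewrite patchE/= indicE; case: (x \in C); rewrite ?mul1r//.
  by rewrite mul0r.
- rewrite E_cst; under eq_Rintegral do rewrite mul1r.
  by rewrite /Rintegral integral_normal_pdf ?oner_neq0.
- move=> a F1 F2 b1 b2 h1 h2.
  rewrite E_D ?E_Z ?h1 ?h2; [|exact: integ_bmeas..|by apply: integZ; exact: integ_bmeas].
  have -> : \int[mu]_x ((F1 x + a * F2 x) * pdf x) = \int[mu]_x (F1 x * pdf x + a * (F2 x * pdf x)).
    by apply: eq_Rintegral => x _; ring.
  rewrite RintegralD//; [|exact: ip|by have := integrableZl measurableT a (ip _ b2)].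
  by rewrite RintegralZl//; exact: ip.
- move=> Fn F1 M bFn hFn bF FM cF.
  have cN : \int[normal_prob 0 1]_x Fn n x @[n --> \oo] --> \int[normal_prob 0 1]_x F1 x.
    apply: (@E_DCT _ _ _ (normal_prob 0 1 : probability _ R) Fn F1 (fun=> M)) => //.
    - by move=> n; case: (bFn n).
    - by case: bF.
    - exact: integ_cst.
    - by apply: nearW => x; exact: cF.
  apply: (cvg_unique _ cN) => //; rewrite (funext hFn).
  have [||||| _ _ h] := @dominated_convergence _ _ _ mu setT measurableT
    (fun n x => (Fn n x * pdf x)%:E) (fun x => (F1 x * pdf x)%:E) (fun x => (M * pdf x)%:E).
  - by move=> n; apply/measurable_EFinP; apply: measurable_funM => //; case: (bFn n).
  - by apply/measurable_EFinP; apply: measurable_funM => //; case: bF.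
  - apply: nearW => x _; apply: cvg_EFin; first exact: nearW.
    by apply: cvgM; [exact: cF|exact: cvg_cst].
  - by have := integrableZl measurableT M (integrable_normal_pdf 0 1).
  - by apply: nearW => x n _ /=; rewrite lee_fin normrM (ger0_norm (p0 x)) ler_wpM2r.
  apply: fine_cvg; rewrite fineK//; exact: integrable_fin_num (ip _ bF).
Qed.

Lemma normal_expectE (v : R) (phi : R -> R) : bmeas phi ->
  normal_expect v phi = (\int[normal_prob 0 1]_x phi (Num.sqrt v * x))%:E.
Proof.
move=> bphi; have bp : bmeas (fun x => phi (Num.sqrt v * x)).
  by apply: bmeas_comp => //; exact: measurable_funM.
rewrite normal_prob_E// /normal_expect /Rintegral fineK//.
case: bp => mp [B hB]; exact: integrable_fin_num (integrable_bounded_pdf mp hB).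
Qed.

Lemma normal_prob_cos (v t th : R) : 0 <= v ->
  \int[normal_prob 0 1]_x cos (t * (Num.sqrt v * x) + th) = expR (- (t ^+ 2 * v / 2)) * cos th.
Proof.
move=> v0; rewrite normal_prob_E; last first.
  split; last by exists 1 => x; exact: cos_max.
  by under eq_fun do rewrite mulrA; exact: measurable_cos_lin.
under eq_Rintegral do rewrite mulrA.
by rewrite integral_cos_normal_pdf exprMn sqr_sqrtr.
Qed.

End gaussian.

(** * Trigonometric approximation *)

Section bernstein.
Context {R : realType}.
Implicit Types (x : R) (h : nat -> R).

(* The expectation of [h] at a binomial variable with parameters [n] and [x]. *)
Fixpoint bern n h x : R :=
  if n is n'.+1 then x * bern n' (fun k => h k.+1) x + (1 - x) * bern n' h x else h 0%N.

Lemma bern_le n h (g : nat -> R) x : 0 <= x <= 1 -> (forall k, h k <= g k) -> bern n h x <= bern n g x.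
Proof.
move=> /andP[x0 x1]; elim: n h g => [|n ih] h g hg //=.
by rewrite lerD// ler_wpM2l ?subr_ge0// ih.
Qed.

Lemma bern_lin n (a b : R) h (g : nat -> R) x : bern n (fun k => a * h k + b * g k) x = a * bern n h x + b * bern n g x.
Proof. by elim: n h g => [|n ih] h g //=; rewrite !ih; ring. Qed.

Lemma bern_cst n c x : bern n (fun=> c) x = c.
Proof. by elim: n => [|n ih] //=; rewrite !ih; ring. Qed.

Lemma bern_id n x : bern n (fun k => k%:R) x = n%:R * x.
Proof.
elim: n => [|n ih] /=; first by rewrite mul0r.
have -> : bern n (fun k => k.+1%:R) x = n%:R * x + 1.
  have := bern_lin n 1 1 (fun k => k%:R) (fun=> 1) x.
  rewrite bern_cst ih !mul1r => <-; congr bern; apply/funext => k.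
  by rewrite !mul1r natr1.
by rewrite ih -natr1; ring.
Qed.

Lemma bern_sqr n x : bern n (fun k => k%:R ^+ 2) x = n%:R * x * (1 - x) + (n%:R * x) ^+ 2.
Proof.
elim: n => [|n ih] /=; first by rewrite !mul0r expr0n add0r.
have -> : bern n (fun k => k.+1%:R ^+ 2) x =
    bern n (fun k => k%:R ^+ 2) x + 2 * bern n (fun k => k%:R) x + 1.
  have := bern_lin n 1 1 (fun k => k%:R ^+ 2) (fun k => 2 * k%:R + 1 * 1) x.
  rewrite (bern_lin n 2 1 (fun k => k%:R) (fun=> 1)) bern_cst !mul1r addrA => <-.
  congr bern; apply/funext => k; rewrite -natr1; ring.
by rewrite ih bern_id -natr1; ring.
Qed.

Lemma bern_var n x : (0 < n)%N -> bern n (fun k => (k%:R / n%:R - x) ^+ 2) x = x * (1 - x) / n%:R.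
Proof.
move=> n0; have n0' : n%:R != 0 :> R by rewrite pnatr_eq0 -lt0n.
have -> : (fun k => (k%:R / n%:R - x) ^+ 2) = (fun k => (n%:R ^+ 2)^-1 * k%:R ^+ 2 +
    1 * ((- 2 * x / n%:R) * k%:R + x ^+ 2 * 1)).
  by apply/funext => k; field.
rewrite bern_lin (bern_lin n _ _ (fun k => k%:R) (fun=> 1)) bern_cst bern_id bern_sqr.
by field.
Qed.

Lemma bern_bound n h x (B : R) : 0 <= x <= 1 -> (forall k, `|h k| <= B) -> `|bern n h x| <= B.
Proof.
move=> x01 hB; rewrite ler_norml; apply/andP; split.
  rewrite -(bern_cst n (- B) x); apply: bern_le => // k.
  by have := hB k; rewrite ler_norml => /andP[].
rewrite -[leRHS](bern_cst n B x); apply: bern_le => // k.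
by have := hB k; rewrite ler_norml => /andP[].
Qed.

(** Only [x] is confined to the segment. The comparison in [bern_le] ranges over all [k], so [k / n]
    may lie outside [[0, 1]]. *)
Lemma uniform_continuity (g : R -> R) (a b e : R) : continuous g -> 0 < e ->
  exists2 del : R, 0 < del & forall x y, a <= x <= b -> `|x - y| < del -> `|g x - g y| < e.
Proof.
move=> cg e0.
have e20 : 0 < e / 2 by rewrite divr_gt0.
have := @compact_near_coveringP R `[a, b]%classic.
move=> [+ _]; move=> /(_ (@segment_compact R a b)) nc.
have := nc R (0^'+) (fun del x => forall y, `|x - y| < del -> `|g x - g y| < e) _.
case.
  move=> x _.
  have /cvgrPdist_lt/(_ _ e20) [r /= r0 hr] := cg x.
  have r20 : 0 < r / 2 by rewrite divr_gt0.
  exists ([set x' | `|x - x'| < r / 2], [set del | del < r / 2]) => /=.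
    split; first by exists (r / 2).
    by exists (r / 2) => //= z /= hz _; move: hz; rewrite distrC subr0 => /(le_lt_trans (ler_norm _)).
  move=> [x' del] /= [h1 h2] y h3.
  have k1 : `|g x - g x'| < e / 2 by apply: hr => /=; lra.
  have k2 : `|g x - g y| < e / 2.
    apply: hr => /=; rewrite -(subrKA x'); apply: le_lt_trans (ler_normD _ _) _; lra.
  rewrite -(subrKA (g x)); apply: le_lt_trans (ler_normD _ _) _.
  by rewrite distrC; lra.
move=> r /= r0 hr; exists (r / 2); first by rewrite divr_gt0.
move=> x y xab; apply: (hr (r / 2)) => /=.
- by rewrite sub0r normrN gtr0_norm ?divr_gt0//; lra.
- by rewrite divr_gt0.
- by rewrite in_itv.
Qed.

Lemma bernstein (g : R -> R) (B e : R) : continuous g -> (forall x, `|g x| <= B) -> 0 < e ->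
  exists2 n, (0 < n)%N & forall x, 0 <= x <= 1 -> `|bern n (fun k => g (k%:R / n%:R)) x - g x| <= e.
Proof.
move=> cg gB e0.
have e20 : 0 < e / 2 by rewrite divr_gt0.
have [del del0 hdel] := @uniform_continuity g 0 1 _ cg e20.
have B0 : 0 <= B by apply: le_trans (gB 0).
(* Chebyshev: when [k / n] is at distance at least [del] from [x], the oscillation [2 B] is at most
   [C] times the squared distance, whose mean is at most [1 / n]. *)
pose C : R := 2 * B / del ^+ 2.
have C0 : 0 <= C by apply: divr_ge0; [exact: mulr_ge0|exact: sqr_ge0].
pose n := (Num.truncn (C / (e / 2))).+1.
have n0 : (0 < n%:R :> R) by rewrite ltr0n.
have Cn : C / n%:R <= e / 2.
  rewrite ler_pdivrMr// mulrC -ler_pdivrMr//; apply/ltW; exact: truncnS_gt.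
exists n => // x x01.
have key k : `|g (k%:R / n%:R) - g x| <= e / 2 + C * (k%:R / n%:R - x) ^+ 2.
  have [h|h] := ltP `|x - k%:R / n%:R| del.
    rewrite distrC; apply: le_trans (ltW (hdel _ _ x01 h)) _.
    by rewrite lerDl mulr_ge0// sqr_ge0.
  apply: le_trans (_ : C * (k%:R / n%:R - x) ^+ 2 <= _); last by rewrite lerDr ltW.
  apply: le_trans (_ : 2 * B <= _).
    by have := gB x; have := gB (k%:R / n%:R) => b1 b2; apply: le_trans (ler_normB _ _) _; lra.
  rewrite /C -mulrA ler_peMr ?mulr_ge0//.
  rewrite mulrC ler_pdivlMr ?exprn_gt0// mul1r.
  rewrite -[leRHS]real_normK ?num_real// ler_pXn2r ?nnegrE ?(ltW del0)//.
  by rewrite distrC.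
have e1 : bern n (fun k => g (k%:R / n%:R)) x - g x = bern n (fun k => g (k%:R / n%:R) - g x) x.
  have := bern_lin n 1 (- g x) (fun k => g (k%:R / n%:R)) (fun=> 1) x.
  rewrite bern_cst mul1r mulr1 => <-; congr bern; apply/funext => k; ring.
have up : bern n (fun k => e / 2 + C * (k%:R / n%:R - x) ^+ 2) x <= e.
  have -> : (fun k => e / 2 + C * (k%:R / n%:R - x) ^+ 2) =
    (fun k => (e / 2) * 1 + C * (k%:R / n%:R - x) ^+ 2) by apply/funext => k; rewrite mulr1.
  rewrite bern_lin bern_cst mulr1 bern_var//.
  have : C * (x * (1 - x) / n%:R) <= C / n%:R.
    rewrite mulrA ler_wpM2r ?invr_ge0 ?(ltW n0)// ler_piMr//.
    by case/andP: x01 => *; nra.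
  lra.
rewrite e1 ler_norml; apply/andP; split.
  rewrite lerNl; apply: le_trans up.
  have -> : - bern n (fun k => g (k%:R / n%:R) - g x) x =
      bern n (fun k => -1 * (g (k%:R / n%:R) - g x) + 0 * 0) x.
    by rewrite (bern_lin n _ _ _ (fun=> 0)) mul0r addr0 mulN1r.
  apply: bern_le => // k; rewrite mul0r addr0 mulN1r; apply: le_trans (key k).
  by rewrite -normrN; exact: ler_norm.
apply: le_trans up; apply: bern_le => // k.
by apply: le_trans (key k); exact: ler_norm.
Qed.

(** The free phase [th] includes sines, which keeps everything real: the cosine limits for all [t]
    and [th] carry the content of a characteristic function. *)
Inductive trigpoly : (R -> R) -> Prop :=
| trig_cos (t th : R) : trigpoly (fun y => cos (t * y + th))
| trig_lin (a b : R) (f g : R -> R) : trigpoly f -> trigpoly g -> trigpoly (fun y => a * f y + b * g y).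

(** Product-to-sum formula; a sine is a cosine with phase lowered by [pi / 2]. *)
Lemma trigpoly_sin f c : trigpoly f -> trigpoly (fun y => sin (c * y) * f y).
Proof.
elim=> [t th|a b f1 f2 _ h1 _ h2].
  have := trig_lin 2^-1 (- 2^-1) (trig_cos (t + c) (th - pi / 2)) (trig_cos (t - c) (th - pi / 2)).
  congr trigpoly; apply/funext => y.
  have s u : cos (u + (th - pi / 2)) = sin (u + th) by rewrite addrA cosBpihalf.
  rewrite !s.
  have -> : (t + c) * y + th = (t * y + th) + c * y by ring.
  have -> : (t - c) * y + th = (t * y + th) - c * y by ring.
  by rewrite sinD sinB; field.
have := trig_lin a b h1 h2; congr trigpoly; apply/funext => y; ring.
Qed.

(** The recursion of [bern] only multiplies by [x] and [1 - x], which for [x = (1 + sin (c y)) / 2]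
    stays among trigonometric polynomials. *)
Lemma trigpoly_bern c n h : trigpoly (fun y => bern n h ((1 + sin (c * y)) / 2)).
Proof.
elim: n h => [|n ih] h /=.
  have := trig_lin (h 0%N) 0 (trig_cos 0 0) (trig_cos 0 0).
  by congr trigpoly; apply/funext => y; rewrite mul0r addr0 cos0; ring.
pose f (y : R) := bern n (fun k => h k.+1) ((1 + sin (c * y)) / 2).
pose g (y : R) := bern n h ((1 + sin (c * y)) / 2).
have t1 : trigpoly (fun y => 1 * f y + 1 * g y) by apply: trig_lin; exact: ih.
have t2 : trigpoly (fun y => 1 * (sin (c * y) * f y) + -1 * (sin (c * y) * g y)).
  by apply: trig_lin; apply: trigpoly_sin; exact: ih.
have := trig_lin 2^-1 2^-1 t1 t2.
by congr trigpoly; apply/funext => y; rewrite /f /g; field.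
Qed.

Lemma trigpoly_cont f : trigpoly f -> continuous f.
Proof.
elim=> [t th|a b f1 f2 _ h1 _ h2] y.
  apply: (@continuous_comp R R R (fun y => t * y + th) cos); last exact: continuous_cos.
  by apply: cvgD; [apply: cvgM; [exact: cvg_cst|exact: cvg_id]|exact: cvg_cst].
by apply: cvgD; apply: cvgM; [exact: cvg_cst|exact: h1|exact: cvg_cst|exact: h2].
Qed.

Lemma trigpoly_bounded f : trigpoly f -> exists B, forall y, `|f y| <= B.
Proof.
elim=> [t th|a b f1 f2 _ [B1 h1] _ [B2 h2]]; first by exists 1 => y; exact: cos_max.
exists (`|a| * B1 + `|b| * B2) => y.
by apply: le_trans (ler_normD _ _) _; rewrite !normrM lerD// ler_wpM2l.
Qed.

(* [sin (y / (2 M))] is injective on [-M, M], so a continuous function there is a continuous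
   function of it; off [-M, M] the clamped extension keeps the approximant bounded. *)
Lemma trigpoly_approx (phi : R -> R) (B M e : R) : continuous phi -> (forall x, `|phi x| <= B) ->
  0 < M -> 0 < e ->
  exists2 q, trigpoly q & (forall y, `|q y| <= B) /\ (forall y, `|y| <= M -> `|q y - phi y| <= e).
Proof.
move=> cphi phiB M0 e0.
pose c : R := (2 * M)^-1.
have c0 : 0 < c by rewrite invr_gt0 mulr_gt0.
(* On [[-M, M]] the angle [c * y] stays within [1/2], so the sine stays within [s0 < 1]. Clamping at
   [s0] keeps [asin] away from the end points of its domain, where it is continuous. *)
pose s0 : R := sin 2^-1.
have pih : 1 <= pi / 2 :> R by exact: pihalf_ge1.
have half : (0 : R) < 2^-1 by rewrite invr_gt0.
have half1 : (2^-1 : R) < 1 by rewrite invf_lt1// ltr1n.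
have s01 : s0 < 1.
  by rewrite /s0 -[ltRHS](@sin_pihalf R) ltr_sin ?in_itv//=; try (apply/andP; split); lra.
have s00 : 0 < s0 by rewrite /s0; apply: sin_gt0_pihalf; apply/andP; split; lra.
pose cl (z : R) : R := Num.max (- s0) (Num.min s0 z).
have cl_bd z : - s0 <= cl z <= s0.
  rewrite /cl le_max lexx/= ge_max ge_min lexx/= andbT; lra.
have cl_id (z : R) : - s0 <= z <= s0 -> cl z = z.
  by move=> /andP[h1 h2]; rewrite /cl min_r// max_r.
have cl_cont : continuous cl.
  move=> z; apply: (@continuous_max R R (fun=> - s0) (fun z => Num.min s0 z)); first exact: cvg_cst.
  by apply: (@continuous_min R R (fun=> s0) id); [exact: cvg_cst|exact: cvg_id].
pose g (s : R) : R := phi (2 * M * asin (cl (2 * s - 1))).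
have cg : continuous g.
  move=> s; apply: (@continuous_comp R R R (fun s => 2 * M * asin (cl (2 * s - 1))) phi); last exact: cphi.
  apply: cvgM; first exact: cvg_cst.
  apply: (@continuous_comp R R R (fun s => cl (2 * s - 1)) asin).
    apply: (@continuous_comp R R R (fun s => 2 * s - 1) cl); last exact: cl_cont.
    by apply: cvgB; [apply: cvgM; [exact: cvg_cst|exact: cvg_id]|exact: cvg_cst].
  apply: continuous_asin; have /andP[h1 h2] := cl_bd (2 * s - 1).
  by apply/andP; split; lra.
have gB s : `|g s| <= B by exact: phiB.
have [n n0 hn] := bernstein cg gB e0.
pose u (y : R) : R := (1 + sin (c * y)) / 2.
have u01 y : 0 <= u y <= 1.
  have := sin_geN1 (c * y); have := sin_le1 (c * y); rewrite /u => h1 h2.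
  by apply/andP; split; lra.
exists (fun y => bern n (fun k => g (k%:R / n%:R)) (u y)); first exact: trigpoly_bern.
split=> y; first by apply: bern_bound.
move=> yM; have <- : g (u y) = phi y; last exact: hn.
have cy : - 2^-1 <= c * y <= 2^-1.
  rewrite -ler_norml normrM (gtr0_norm c0) /c ler_pdivrMl ?mulr_gt0//.
  have -> : 2 * M / 2 = M by field.
  exact: yM.
have itv (z : R) : - 2^-1 <= z <= 2^-1 -> z \in `[- (pi / 2), pi / 2].
  by rewrite in_itv/= => /andP[h1 h2]; apply/andP; split; lra.
rewrite /g /u.
have -> : 2 * ((1 + sin (c * y)) / 2) - 1 = sin (c * y) by field.
have lesin (a b : R) : - 2^-1 <= a <= 2^-1 -> - 2^-1 <= b <= 2^-1 -> a <= b -> sin a <= sin b.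
  move=> ha hb; rewrite le_eqVlt => /orP[/eqP -> //|ab]; apply: ltW.
  by rewrite ltr_sin//; exact: itv.
have hh : - (2^-1 : R) <= (2^-1 : R) <= (2^-1 : R) by rewrite lexx andbT; lra.
have hh' : - (2^-1 : R) <= - (2^-1 : R) <= (2^-1 : R) by rewrite lexx /=; lra.
rewrite cl_id; last first.
  case/andP: (cy) => h1 h2; apply/andP; split; last exact: lesin.
  by rewrite /s0 -sinN; exact: lesin.
rewrite sinK; last exact: itv.
congr phi; rewrite /c; field; exact: lt0r_neq0.
Qed.

End bernstein.

Lemma bmeas_gt_abs {R : realType} (c : R) : bmeas (fun y : R => (c < `|y|)%R%:R : R).
Proof.
split; last by exists 1 => y; case: (_ < _); rewrite ?normr1 ?normr0.
have -> : (fun y : R => (c < `|y|)%R%:R : R) = (fun y => if c < `|y| then 1 else 0).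
  by apply/funext => y; case: ifP.
apply: measurable_fun_ifT => //; apply: measurable_fun_ltr => //; exact: measurableT_comp.
Qed.

(** * From convergence of cosines to convergence in distribution *)

Section trig_convergence.
Context {R : realType} {d d'} {T : measurableType d} {T' : measurableType d'}.
Variables (P : probability T R) (P' : probability T' R).
Notation "''E' F" := (Rintegral P setT F) (at level 10, F at level 9) : ring_scope.
Notation "''E'' F" := (Rintegral P' setT F) (at level 10, F at level 9) : ring_scope.

Lemma bmeas_cont (phi : R -> R) (B : R) : continuous phi -> (forall x, `|phi x| <= B) -> bmeas phi.
Proof. by move=> cphi hB; split; [exact: continuous_measurable_fun|exists B]. Qed.

Lemma trigpoly_bmeas (q : R -> R) : trigpoly q -> bmeas q.
Proof. by move=> tq; have [B hB] := trigpoly_bounded tq; exact: bmeas_cont (trigpoly_cont tq) hB. Qed.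

Lemma cvg_E_trigpoly (Y : nat -> T -> R) (Z : T' -> R) q :
  (forall n, measurable_fun setT (Y n)) -> measurable_fun setT Z ->
  (forall t th, 'E (fun x => cos (t * Y n x + th)) @[n --> \oo] --> 'E' (fun x => cos (t * Z x + th))) ->
  trigpoly q ->
  'E (fun x => q (Y n x)) @[n --> \oo] --> 'E' (fun x => q (Z x)).
Proof.
move=> mY mZ hcos; elim=> [t th|a b f g tf hf tg hg]; first exact: hcos.
have bY (k : R -> R) n : trigpoly k -> P.-integrable setT (EFin \o (fun x => k (Y n x))).
  by move=> /trigpoly_bmeas bk; apply: integ_bmeas; exact: bmeas_comp.
have bZ (k : R -> R) : trigpoly k -> P'.-integrable setT (EFin \o (fun x => k (Z x))).
  by move=> /trigpoly_bmeas bk; apply: integ_bmeas; exact: bmeas_comp.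
rewrite E_D ?E_Z; [|exact: bZ..|by apply: integZ; exact: bZ|by apply: integZ; exact: bZ].
rewrite [X in X @ _ --> _](_ : _ = fun n => a * 'E (fun x => f (Y n x)) + b * 'E (fun x => g (Y n x))).
2: by apply/funext => n; rewrite E_D ?E_Z; [|exact: bY..|by apply: integZ; exact: bY|by apply: integZ; exact: bY].
by apply: cvgD; apply: cvgM => //; exact: cvg_cst.
Qed.

Lemma cvg_tail (Z : T' -> R) : measurable_fun setT Z ->
  'E' (fun x => (n%:R < `|Z x|)%R%:R : R) @[n --> \oo] --> (0 : R).
Proof.
move=> mZ.
have mi n : measurable_fun setT (fun x => (n%:R < `|Z x|)%R%:R : R).
  by case: (bmeas_comp (bmeas_gt_abs n%:R) mZ).
rewrite -[X in _ --> X](E_cst P' 0).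
apply: (@E_DCT _ _ _ P' _ (fun=> 0) (fun=> 1)) => //.
- exact: integ_cst.
- by move=> n x; case: (_ < _); rewrite ?normr1 ?normr0.
apply: nearW => x; apply: cvg_near_cst.
exists (Num.truncn `|Z x|).+1 => // n /= hn.
case: ltP => // h; have := truncnS_gt `|Z x|.
by move=> /(lt_trans h); rewrite ltr_nat ltnS leqNgt hn.
Qed.

(** Tightness comes from Chebyshev and the uniform second moment for [Y], and from [cvg_tail] for
    [Z]. The approximating polynomial keeps the bound [B] outside [[-M, M]], so the tails cost at
    most [2 B] times a small probability. *)
Lemma cvg_E_of_trig (Y : nat -> T -> R) (Z : T' -> R) (C : R) (phi : R -> R) :
  (forall n, sqint P (Y n)) -> (forall n, 'E (fun x => Y n x ^+ 2) <= C) ->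
  measurable_fun setT Z ->
  (forall t th, 'E (fun x => cos (t * Y n x + th)) @[n --> \oo] --> 'E' (fun x => cos (t * Z x + th))) ->
  continuous phi -> (exists M : R, forall x, `|phi x| <= M) ->
  'E (fun x => phi (Y n x)) @[n --> \oo] --> 'E' (fun x => phi (Z x)).
Proof.
move=> sY YC mZ hcos cphi [B phiB].
have B0 : 0 <= B by apply: le_trans (phiB 0).
have C0 : 0 <= C by apply: le_trans (YC 0%N); apply: E_ge0 => x; exact: sqr_ge0.
have mY n : measurable_fun setT (Y n) by case: (sY n).
apply/cvgrPdist_le => e e0.
have e5 : 0 < e / 5 by rewrite divr_gt0.
pose K : R := 2 * B + 1; have K0 : 0 < K by rewrite /K; lra.
have e5K : 0 < e / 5 / K by rewrite divr_gt0.
have /cvgrPdist_lt/(_ _ e5K) [N _ hN] := cvg_tail mZ.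
(* Beyond [N] for the tail of the limit, and beyond [5 K C / e] for Chebyshev, where [M <= M^2] is
   enough. *)
pose M := (N + Num.truncn (K * C / (e / 5))).+1.
have M0 : 0 < M%:R :> R by rewrite ltr0n.
have M1 : 1 <= M%:R :> R by rewrite ler1n.
have MC : K * C / M%:R ^+ 2 <= e / 5.
  rewrite ler_pdivrMr ?exprn_gt0// -ler_pdivrMl// mulrC.
  apply: le_trans (_ : M%:R <= _); last by rewrite expr2 ler_peMl// ltW.
  apply: ltW; apply: lt_le_trans (truncnS_gt _) _.
  by rewrite ler_nat ltnS leq_addl.
have [q tq [qB qphi]] := trigpoly_approx cphi phiB M0 e5.
have bphi := bmeas_cont cphi phiB; have bq := trigpoly_bmeas tq.
have diff y : `|phi y - q y| <= e / 5 + K * (M%:R < `|y|)%R%:R.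
  case: ltP => h /=; last by rewrite mulr0 addr0 distrC; exact: qphi.
  rewrite mulr1; apply: le_trans (ler_normB _ _) _.
  by have := phiB y; have := qB y; rewrite /K; lra.
have dE n : `|'E (fun x => phi (Y n x)) - 'E (fun x => q (Y n x))| <= 2 * (e / 5).
  have i1 : P.-integrable setT (EFin \o (fun x => phi (Y n x))).
    by apply: integ_bmeas; exact: bmeas_comp.
  have i2 : P.-integrable setT (EFin \o (fun x => q (Y n x))).
    by apply: integ_bmeas; exact: bmeas_comp.
  rewrite -E_B//; apply: le_trans (E_abs _) _; first exact: integB.
  apply: le_trans (_ : 'E (fun x => e / 5 + (K / M%:R ^+ 2) * Y n x ^+ 2) <= _).
    apply: E_le => [||x].
    - by apply: integ_abs; exact: integB.
    - by apply: integD; [exact: integ_cst|apply: integZ; exact: sqint_sqr].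
    apply: le_trans (diff _) _; rewrite lerD2l -mulrA ler_wpM2l ?(ltW K0)//.
    case: ltP => h; last by rewrite mulr_ge0 ?sqr_ge0 ?invr_ge0.
    rewrite mulrC ler_pdivlMr ?exprn_gt0// mul1r -[leRHS]real_normK ?num_real//.
    by rewrite ler_pXn2r ?nnegrE// ltW.
  have iY := sqint_sqr (sY n).
  rewrite (E_D (integ_cst P _) (integZ _ iY)) (E_Z _ iY) E_cst.
  have : K / M%:R ^+ 2 * 'E (fun x => Y n x ^+ 2) <= e / 5; last lra.
  apply: le_trans MC; rewrite mulrAC ler_wpM2r ?invr_ge0 ?sqr_ge0//.
  by rewrite ler_wpM2l// ltW.
have dE' : `|'E' (fun x => phi (Z x)) - 'E' (fun x => q (Z x))| <= 2 * (e / 5).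
  have i1 : P'.-integrable setT (EFin \o (fun x => phi (Z x))).
    by apply: integ_bmeas; exact: bmeas_comp.
  have i2 : P'.-integrable setT (EFin \o (fun x => q (Z x))).
    by apply: integ_bmeas; exact: bmeas_comp.
  have i3 : P'.-integrable setT (EFin \o (fun x => (M%:R < `|Z x|)%R%:R : R)).
    by apply: integ_bmeas; exact: (bmeas_comp (bmeas_gt_abs M%:R)).
  rewrite -E_B//; apply: le_trans (E_abs _) _; first exact: integB.
  apply: le_trans (_ : 'E' (fun x => e / 5 + K * (M%:R < `|Z x|)%R%:R) <= _).
    apply: E_le => //.
    - by apply: integ_abs; exact: integB.
    - by apply: integD; [exact: integ_cst|exact: integZ].
  rewrite (E_D (integ_cst P' _) (integZ _ i3)) (E_Z _ i3) E_cst.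
  have : K * 'E' (fun x => (M%:R < `|Z x|)%R%:R) <= e / 5; last lra.
  rewrite mulrC -ler_pdivlMr//.
  have := hN M; rewrite /= sub0r normrN => /(_ _)/ltW/(le_trans (ler_norm _)); apply.
  by rewrite /M -addnS leq_addr.
have /cvgrPdist_le/(_ _ e5) := cvg_E_trigpoly mY mZ hcos tq.
apply: filterS => n hn; have h1 := dE n.
move: h1 dE' hn; rewrite !ler_norml => /andP[? ?] /andP[? ?] /andP[? ?]; apply/andP; split; lra.
Qed.

End trig_convergence.

(** * Powers of the Markov operator on bounded functions *)

Section Qop_power.
Context {dS} {S : measurableType dS} {R : realType}.
Variable Q : R.-pker S ~> S.

Lemma Qop_bound g (M : R) : bmeas g -> (forall x, `|g x| <= M) -> forall x, `|Qop Q g x| <= M.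
Proof.
move=> bg gM x; have ig := integ_bmeas (kprob Q x) bg.
apply: le_trans (E_abs ig) _; rewrite -[leRHS](E_cst (kprob Q x) M).
by apply: E_le => //; [exact: integ_abs|exact: integ_cst].
Qed.

Lemma Qop_lin a g g' : bmeas g -> bmeas g' ->
  Qop Q (fun x => g x + a * g' x) = (fun x => Qop Q g x + a * Qop Q g' x).
Proof.
move=> bg bg'; apply/funext => x.
have ig := integ_bmeas (kprob Q x) bg; have ig' := integ_bmeas (kprob Q x) bg'.
by have := E_D ig (integZ a ig'); rewrite (E_Z a ig').
Qed.

Lemma iter_Qop_bound m g (M : R) : bmeas g -> (forall x, `|g x| <= M) ->
  forall x, `|iter m (Qop Q) g x| <= M.
Proof.
move=> bg gM; elim: m => [|m ih] //=; apply: Qop_bound => //; exact: bmeas_Qop.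
Qed.

Lemma iter_Qop_lin m a g g' : bmeas g -> bmeas g' ->
  iter m (Qop Q) (fun x => g x + a * g' x) =
  (fun x => iter m (Qop Q) g x + a * iter m (Qop Q) g' x).
Proof.
move=> bg bg'; elim: m => [|m ih] //=; rewrite ih Qop_lin//; exact: bmeas_Qop.
Qed.

End Qop_power.

Lemma abs_expRN_sub {R : realType} (a b : R) : 0 <= a -> a <= b ->
  `|expR (- a) - expR (- b)| <= b - a.
Proof.
move=> a0 ab.
rewrite ger0_norm ?subr_ge0 ?ler_expR ?lerN2//.
have -> : - b = - a + (a - b) by ring.
rewrite expRD -[X in X - _]mulr1 -mulrBr.
have h1 : expR (- a) <= 1 by rewrite -expR0 ler_expR; lra.
have h2 := expR_ge1Dx (a - b).
have h3 : expR (a - b) <= 1 by rewrite -expR0 ler_expR; lra.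
have h4 := expR_ge0 (- a); nra.
Qed.

Lemma ler_dist_quarters {R : realType} (x y z w e : R) :
  `|y - z| <= e / 4 + e / 4 -> `|z - w| <= e / 4 -> `|x - y| <= e / 4 -> `|w - x| <= e.
Proof.
by rewrite !ler_norml => /andP[? ?] /andP[? ?] /andP[? ?]; apply/andP; split; lra.
Qed.

(** * Central limit theorem for the deviations *)

Section path_clt.
Context {dS} {S : measurableType dS} {R : realType}.
Variables (Q : R.-pker S ~> S) (mu : probability (traj S) R) (pi : probability S R).
Hypothesis Hmu : markov_traj Q mu.
Hypothesis pi_law : forall A, measurable A -> pi A = mu ((fun p : traj S => p 0%N) @^-1` A).
Notation "''E' F" := (Rintegral mu setT F) (at level 10, F at level 9) : ring_scope.
Notation integ F := (mu.-integrable setT (EFin \o F)).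
Notation theta n := (iter n (@pshift _ S)).
Variable f : S -> R.
Hypotheses (mf : measurable_fun setT f) (sf : sqint mu (fun p => f (p 0%N))).
Variable h : nat -> S * S -> R.
Hypothesis mh : forall n, (0 < n)%N -> measurable_fun setT (h n).
Hypothesis sh : forall n, (0 < n)%N -> sqint mu (fun p => h n (p n, p 0%N)).
Hypothesis oh : forall n, (0 < n)%N -> forall psi : S * S -> R, bmeas psi ->
  'E (fun p => (psum f n p - h n (p n, p 0%N)) * psi (p n, p 0%N)) = 0.
Hypothesis erg : totally_ergodic pi Q.

Local Notation dev := (dev f h).
Local Notation bs m := (bsum (dev m) (theta m)).
Local Notation ad m := ('E (fun p => dev m p ^+ 2)).
Local Notation sqint_dev := (sqint_dev Hmu mf sf sh).
Local Notation sqint_bs := (sqint_bs Hmu mf sf sh).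

Let mcoord0 : measurable_fun setT (fun p : traj S => p 0%N) := @measurable_coord _ S 0.

Let E_pi (g : S -> R) : measurable_fun setT g -> \int[pi]_x g x = 'E (fun p => g (p 0%N)).
Proof. by move=> mg; rewrite (E_law mcoord0 pi_law mg). Qed.

Let nrm_pi (g : S -> R) : measurable_fun setT g -> nrm pi g = nrm mu (fun p => g (p 0%N)).
Proof. by move=> mg; rewrite /nrm E_pi//; exact: measurable_funX. Qed.

(** Total ergodicity enters here: the mean ergodic theorem is applied to [Q^m]. The contraction and
    the invariance of the mean are read on the path law, whose coordinate 0 has law [pi]. *)
Lemma cesaro_Qop_cvg m (g : S -> R) (e : R) : (0 < m)%N -> bmeas g -> 0 < e ->
  exists n, nrm pi (fun x => cesaro_mean (iter m (Qop Q)) n g x - \int[pi]_x g x) < e.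
Proof.
move=> m0 bg e0; apply: mean_ergodic_theorem => //.
- by move=> g' bg'; exact: bmeas_Qop.
- by move=> g' M bg' hM x; exact: iter_Qop_bound.
- by move=> a g1 g2 b1 b2; exact: iter_Qop_lin.
- move=> g' bg'; have bK := bmeas_Qop Q m bg'.
  by rewrite !nrm_pi; [exact: (Qopn_contract Hmu)|case: bg'|case: bK].
- move=> g' bg'; have bK := bmeas_Qop Q m bg'.
  rewrite !E_pi; [|by case: bg'|by case: bK].
  have := Qopn_adj Hmu m bg' (bmeas_cst 1).
  by under eq_Rintegral do rewrite mulr1; under [in RHS]eq_Rintegral do rewrite mulr1.
- move=> g' bg'; apply: erg => //; first by case: bg'.
  have /integrableP[_] := sqint_sqr (sqint_bmeas pi bg').
  by under eq_integral do rewrite /= ger0_norm ?sqr_ge0//.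
Qed.

(* The conditional variance of a block of [L] deviations given its past is [L] times a Cesaro
   mean of the powers of [Q^m], so ergodicity of [Q^m] makes it nearly deterministic. *)
Lemma block_variance m (eps : R) : (0 < m)%N -> 0 < eps ->
  exists2 L, (0 < L)%N & forall A : traj S -> R, bmeas A -> (forall p, `|A p| <= 1) ->
    `|'E (fun p => (bs m L p ^+ 2 - L%:R * ad m) * A (theta (L * m) p))| <= L%:R * eps.
Proof.
move=> m0 eps0.
have e3 : 0 < eps / 3 by rewrite divr_gt0.
pose Z p := dev m p ^+ 2.
have iZ : integ Z by exact: sqint_sqr (sqint_dev m0).
(* The squared deviation is only integrable; it is truncated because [cond_kernel] takes bounded
   functions. *)
have /cvgrPdist_lt/(_ _ e3) [k _ /(_ k (leqnn k))] := E_trunc_cvg iZ.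
rewrite /= sub0r normrN => hk.
pose F p := trunc k (Z p).
have {}hk : 'E (fun p => `|Z p - F p|) <= eps / 3 by apply/ltW; exact: le_lt_trans (ler_norm _) hk.
have bF : bmeas F by apply: bmeas_trunc; exact: integ_measurable iZ.
have dF : depends m F.
  by move=> p q pq; rewrite /F /Z (depends_dev f h pq).
have [kap bkap hkap] := cond_kernel Hmu bF dF.
have [n hn] := cesaro_Qop_cvg m0 bkap e3.
exists n.+1 => // A bA A1.
set L := n.+1.
have iF := integ_bmeas mu bF.
have EFkap : 'E F = 'E (fun p => kap (p 0%N)).
  have := hkap _ (bmeas_cst 1).
  by under eq_Rintegral do rewrite mulr1; under [in RHS]eq_Rintegral do rewrite mulr1.
have iA : integ A by exact: integ_bmeas.
have bAs j : bmeas (fun p => A (theta j p)) by exact: bmeas_shiftn.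
have ZF B : bmeas B -> (forall p, `|B p| <= 1) ->
    `|'E (fun p => Z p * B p) - 'E (fun p => F p * B p)| <= eps / 3.
  move=> bB B1; rewrite -E_B; [|exact: integMb..].
  have -> : 'E (fun p => Z p * B p - F p * B p) = 'E (fun p => (Z p - F p) * B p).
    by apply: eq_Rintegral => p _; rewrite mulrBl.
  have i : integ (fun p => Z p - F p) by exact: integB.
  apply: le_trans (E_abs (integMb i bB)) _; apply: le_trans hk.
  apply: E_le; [exact/integ_abs/integMb|exact: integ_abs|].
  by move=> p; rewrite normrM ler_piMr.
have Z1 : `|ad m - 'E F| <= eps / 3.
  have := ZF _ (bmeas_cst 1) (fun p => _).
  under eq_Rintegral do rewrite mulr1; under [X in _ - X]eq_Rintegral do rewrite mulr1.
  by apply; rewrite normr1.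
(* Given the coordinates from [j.+1 * m] on, the conditional mean of [F] is [kap] after [j]
   applications of [Q^m], read at coordinate [j.+1 * m]. *)
have Fj j : 'E (fun p => F p * A (theta (j.+1 * m) p)) =
    'E (fun p => iter j (iter m (Qop Q)) kap (p 0%N) * A p).
  have := hkap _ (bAs (j * m)%N); rewrite (Qopn_adj Hmu)// => e1.
  transitivity ('E (fun p => F p * A (theta (j * m) (theta m p)))).
    by apply: eq_Rintegral => p _; rewrite -iterD -mulSnr.
  by rewrite e1; apply: eq_Rintegral => p _; rewrite iterM.
have bc : bmeas (cesaro_mean (iter m (Qop Q)) n kap).
  by apply: bmeas_cesaro => // g' bg'; exact: bmeas_Qop.
have sumF : \sum_(j < L) 'E (fun p => F p * A (theta (j.+1 * m) p)) =
    L%:R * 'E (fun p => cesaro_mean (iter m (Qop Q)) n kap (p 0%N) * A p).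
  have bit j : bmeas (fun p : traj S => iter j (iter m (Qop Q)) kap (p 0%N) * A p).
    apply: bmeasM => //; apply: (bmeas_coord 0); rewrite -iterM; exact: bmeas_Qop.
  rewrite -E_Z; last by apply: integ_bmeas; apply: bmeasM => //; exact: (bmeas_coord 0).
  under eq_bigr do rewrite Fj.
  rewrite -(@E_sum _ _ _ mu _ _ (fun (j : 'I_L) p => iter j (iter m (Qop Q)) kap (p 0%N) * A p)).
    apply: eq_Rintegral => p _; rewrite /cesaro_mean -mulr_suml !mulrA divff ?mul1r//.
    by rewrite pnatr_eq0.
  by move=> j; exact: integ_bmeas.
have cA : `|'E (fun p => cesaro_mean (iter m (Qop Q)) n kap (p 0%N) * A p) - 'E F * 'E A| <= eps / 3.
  rewrite -E_Z// -E_B; [|apply: integ_bmeas; apply: bmeasM => //; exact: (bmeas_coord 0)|exact: integZ].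
  pose c x := cesaro_mean (iter m (Qop Q)) n kap x - 'E F.
  have bcc : bmeas c by apply: bmeasB => //; exact: bmeas_cst.
  have sc : sqint mu (fun p => c (p 0%N)) by exact/sqint_bmeas/(bmeas_coord 0).
  have -> : 'E (fun p => cesaro_mean (iter m (Qop Q)) n kap (p 0%N) * A p - 'E F * A p) =
     'E (fun p => c (p 0%N) * A p) by apply: eq_Rintegral => p _; rewrite mulrBl.
  apply: le_trans (E_CS_nrm sc (sqint_bmeas mu bA)) _.
  have nc : nrm mu (fun p => c (p 0%N)) <= eps / 3.
    rewrite -nrm_pi; last by case: bcc.
    by rewrite /c EFkap -E_pi ?ltW//; case: bkap.
  have nA : nrm mu A <= 1 by apply: nrm_le_bound => //; exact: sqint_bmeas.
  by rewrite -[leRHS]mulr1; apply: ler_pM => //; exact: nrm_ge0.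
have EA : 'E (fun p => A (theta (L * m) p)) = 'E A by apply: (E_shiftn Hmu); case: bA.
have A1' : `|'E A| <= 1.
  apply: le_trans (E_abs iA) _; rewrite -[leRHS](E_cst mu 1).
  by apply: E_le => //; [exact: integ_abs|exact: integ_cst].
have L0 : 0 < L%:R :> R by rewrite ltr0n.
(* Three errors, each at most [L * eps / 3]: truncation inside each block, the Cesaro mean against
   its expectation, and the truncated mean against [ad m]. *)
have -> : 'E (fun p => (bs m L p ^+ 2 - L%:R * ad m) * A (theta (L * m) p)) =
   \sum_(j < L) ('E (fun p => Z p * A (theta (j.+1 * m) p)) - 'E (fun p => F p * A (theta (j.+1 * m) p)))
   + L%:R * ('E (fun p => cesaro_mean (iter m (Qop Q)) n kap (p 0%N) * A p) - 'E F * 'E A)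
   + L%:R * (('E F - ad m) * 'E A).
  transitivity ('E (fun p => bs m L p ^+ 2 * A (theta (L * m) p)) - L%:R * ad m * 'E A).
    have i1 : integ (fun p => bs m L p ^+ 2 * A (theta (L * m) p)).
      by apply: integMb => //; exact: sqint_sqr (sqint_bs _ m0).
    have i2 := integ_bmeas mu (bAs (L * m)%N).
    rewrite -EA -(E_Z _ i2) -(E_B i1 (integZ _ i2)).
    by apply: eq_Rintegral => p _; rewrite mulrBl.
  rewrite (E_bs_sqr Hmu mf sf sh oh)// sumrB sumF; ring.
apply: le_trans (ler_normD _ _) _.
have -> : L%:R * eps = L%:R * (eps / 3) + L%:R * (eps / 3) + L%:R * (eps / 3) by field.
apply: lerD; last first.
  rewrite normrM (gtr0_norm L0) ler_wpM2l ?(ltW L0)// normrM distrC.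
  by rewrite -[leRHS]mulr1; apply: ler_pM.
apply: le_trans (ler_normD _ _) _; apply: lerD; last first.
  by rewrite normrM (gtr0_norm L0) ler_wpM2l ?(ltW L0).
apply: le_trans (ler_norm_sum _ _ _) _.
rewrite mulr_natl -[X in _ *+ X](card_ord L) -sumr_const; apply: ler_sum => j _.
by apply: ZF.
Qed.

Variable c : R.
Hypothesis ad_le : forall m, (0 < m)%N -> ad m / m%:R <= c.
Hypothesis ad_near : forall e, 0 < e -> exists2 m, (0 < m)%N & c - e < ad m / m%:R.

(** Both second moments and the cross term are explicit, since the pairing of [dev n] with the block
    sum is exactly [k * ad m]. The two objects carry their own normalisations so that [bs] has the
    scale of its own limit theorem. *)
Lemma dev_bs_dist m k n : (0 < m)%N -> (0 < k)%N -> (k * m <= n)%N ->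
  'E (fun p => (dev n p / Num.sqrt n%:R - bs m k p / Num.sqrt (k * m)%:R) ^+ 2) <=
  c - ad m / m%:R + 2 * c * ((n - k * m)%N%:R / n%:R).
Proof.
move=> m0 k0 kmn.
have km0 : (0 < k * m)%N by rewrite muln_gt0 k0.
have n0 : (0 < n)%N by exact: leq_trans kmn.
have n0' : 0 < n%:R :> R by rewrite ltr0n.
have m0' : 0 < m%:R :> R by rewrite ltr0n.
have k0' : 0 < k%:R :> R by rewrite ltr0n.
have km0' : 0 < (k * m)%:R :> R by rewrite ltr0n.
set a : R := Num.sqrt n%:R; set b : R := Num.sqrt (k * m)%:R.
have a0 : 0 < a by rewrite sqrtr_gt0.
have b0 : 0 < b by rewrite sqrtr_gt0.
have a2 : a ^+ 2 = n%:R by rewrite sqr_sqrtr// ltW.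
have b2 : b ^+ 2 = k%:R * m%:R by rewrite sqr_sqrtr ?ltW// natrM.
have sd := sqint_dev n0; have sb := sqint_bs k m0.
have -> : 'E (fun p => (dev n p / a - bs m k p / b) ^+ 2) =
  ad n / a ^+ 2 + (k%:R * ad m) / b ^+ 2 - 2 * (k%:R * ad m) / (a * b).
  have i1 : integ (fun p => (a ^+ 2)^-1 * dev n p ^+ 2) by exact/integZ/sqint_sqr.
  have i2 : integ (fun p => (b ^+ 2)^-1 * bs m k p ^+ 2) by exact/integZ/sqint_sqr.
  have i3 : integ (fun p => (- 2 / (a * b)) * (dev n p * bs m k p)) by exact/integZ/sqintM.
  transitivity ('E (fun p => (a ^+ 2)^-1 * dev n p ^+ 2 + (b ^+ 2)^-1 * bs m k p ^+ 2
      + (- 2 / (a * b)) * (dev n p * bs m k p))).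
    apply: eq_Rintegral => p _; field; rewrite !gt_eqF//.
  rewrite E_D ?E_D//; last exact: integD.
  rewrite (E_Z _ (sqint_sqr sd)) (E_Z _ (sqint_sqr sb)) (E_Z _ (sqintM sd sb)).
  rewrite (E_bs_sqr1 Hmu mf sf sh oh)// (E_dev_bs Hmu mf sf mh sh oh)//.
  field; rewrite !gt_eqF//.
have ab : b <= a by rewrite ler_sqrt ?ler_nat// ltW.
have adm0 : 0 <= ad m by apply: E_ge0 => p; exact: sqr_ge0.
have admc := ad_le m0; have adnc := ad_le n0.
have -> : k%:R * ad m / b ^+ 2 = ad m / m%:R by rewrite b2; field; rewrite !gt_eqF.
have -> : 2 * (k%:R * ad m) / (a * b) = 2 * (ad m / m%:R) * (b / a).
  have -> : k%:R = b ^+ 2 / m%:R by rewrite b2; field; rewrite gt_eqF.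
  by field; rewrite !gt_eqF.
have q0 : 0 <= ad m / m%:R by rewrite divr_ge0// ltW.
have c0 : 0 <= c by exact: le_trans admc.
have -> : (n - k * m)%N%:R / n%:R = 1 - (b / a) ^+ 2.
  by rewrite natrB// exprMn exprVn a2 b2 natrM; field; rewrite gt_eqF.
have r1 : b / a <= 1 by rewrite ler_pdivrMr// mul1r.
have r0 : 0 <= b / a by rewrite divr_ge0// ltW.
rewrite a2; move: (ad m / m%:R) (b / a) admc q0 r1 r0 => q r admc q0 r1 r0.
(* With [q = ad m / m] and [r^2 = k m / n] the expanded square is at most [c - q + 2 q (1 - r)], and
   [1 - r <= 1 - r^2] for [r] in [[0, 1]]. *)
have : q * (1 - r) <= c * (1 - r ^+ 2).
  by apply: ler_pM => //; nra.
lra.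
Qed.

Lemma dev_clt (t th : R) :
  'E (fun p => cos (t * (dev n p / Num.sqrt n%:R) + th)) @[n --> \oo] -->
  expR (- (t ^+ 2 * c / 2)) * cos th.
Proof.
apply/cvgrPdist_le => e e0.
have e4 : 0 < e / 4 by rewrite divr_gt0.
pose T2 : R := t ^+ 2 + 1.
have t2 : 0 <= t ^+ 2 by exact: sqr_ge0.
have T20 : 0 < T2 by rewrite /T2; lra.
(* The first entry gives [2 t^2 del <= (e / 4)^2] for the mean square distance to the block sums,
   the second [t^2 del <= e / 4] for replacing [ad m / m] by [c]. [T2] exceeds [t^2] by 1 to avoid a
   zero divisor. *)
pose del : R := Num.min ((e / 4) ^+ 2 / (2 * T2)) (e / 4 / T2).
have del0 : 0 < del by rewrite lt_min !divr_gt0// ?mulr_gt0// exprn_gt0.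
have [m m0 hm] := ad_near del0.
have m0' : 0 < m%:R :> R by rewrite ltr0n.
have eps0 : 0 < e / 4 / T2 by rewrite divr_gt0.
have [L L0 hL] := block_variance m0 eps0.
pose M := (L * m)%N.
have M0 : (0 < M)%N by rewrite muln_gt0 L0.
have M0' : 0 < M%:R :> R by rewrite ltr0n.
have L0' : 0 < L%:R :> R by rewrite ltr0n.
have adm0 : 0 <= ad m by apply: E_ge0 => p; exact: sqr_ge0.
have c0 : 0 <= c by apply: le_trans (ad_le m0); rewrite divr_ge0// ltW.
have V0 : 0 <= L%:R * ad m by rewrite mulr_ge0// ltW.
have Et (F : traj S -> R) : measurable_fun setT F -> 'E (fun p => F (theta M p)) = 'E F.
  by move=> mF; exact: (E_shiftn Hmu).
have or A : bmeas A -> 'E (fun p => bs m L p * A (theta M p)) = 0.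
  by move=> bA; exact: (E_bs_orth Hmu mf sf sh oh L m0 bA).
(* One increment is a whole group of [L] blocks, its past is the path shifted by [M = L m], and the
   division of [t] by [sqrt M] restores the scale of single steps. *)
have [N0 hN0] := step_clt (measurable_iter_pshift M) Et (sqint_bs L m0) V0 or hL
   (t / Num.sqrt M%:R) th e4.
(* The first summand forces more than [N0] groups; the second makes the incomplete group of fewer
   than [M] steps cost at most [del]. *)
pose n0 := (N0.+1 * M + (Num.truncn (2 * c * M%:R / del)).+1)%N.
exists n0 => // n /= hn.
pose N := (n %/ M)%N.
have Nn : (N * M <= n)%N by exact: leq_trunc_div.
have NN0 : (N0 < N)%N.
  by rewrite /N leq_divRL//; apply: leq_trans hn; exact: leq_addr.
have nn0 : 0 < n%:R :> R.
  by rewrite ltr0n; apply: leq_trans hn; rewrite /n0 addnS.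
have N0' : 0 < N%:R :> R by rewrite ltr0n; exact: leq_ltn_trans NN0.
have rM : (n - N * M < M)%N by rewrite /N {1}(divn_eq n M) addKn ltn_mod.
have hd : 2 * c * ((n - N * M)%N%:R / n%:R) <= del.
  apply: le_trans (_ : 2 * c * (M%:R / n%:R) <= _).
    by rewrite ler_wpM2l ?mulr_ge0// ler_pM2r ?invr_gt0// ler_nat ltnW.
  rewrite mulrA ler_pdivrMr// -ler_pdivrMl// mulrC.
  apply: ltW; apply: lt_le_trans (truncnS_gt _) _; rewrite ler_nat.
  by apply: leq_trans hn; exact: leq_addl.
have := hN0 N (ltnW NN0).
have kN : (N * L * m = N * M)%N by rewrite -mulnA.
have -> : 'E (fun p => cos (t / Num.sqrt M%:R / Num.sqrt N%:R * bsum (bs m L) (theta M) N p + th)) =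
  'E (fun p => cos (t * (bs m (N * L) p / Num.sqrt (N * L * m)%:R) + th)).
  apply: eq_Rintegral => p _; congr (cos (_ + _)).
  rewrite kN -bsumM natrM sqrtrM ?ler0n//.
  have -> : iter L (theta m) = theta M by apply/funext => q; rewrite /M iterM.
  by field; rewrite !gt_eqF// sqrtr_gt0.
have -> : (t / Num.sqrt M%:R) ^+ 2 = t ^+ 2 / M%:R.
  by rewrite exprMn exprVn sqr_sqrtr// ltW.
have -> : t ^+ 2 / M%:R * (L%:R * ad m) / 2 = t ^+ 2 * (ad m / m%:R) / 2.
  by rewrite /M natrM; field; rewrite !gt_eqF.
have -> : t ^+ 2 / M%:R / 2 * (L%:R * (e / 4 / T2)) = t ^+ 2 / 2 * (e / 4 / T2) / m%:R.
  by rewrite /M natrM; field; rewrite !gt_eqF.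
have k1 : t ^+ 2 / 2 * (e / 4 / T2) / m%:R <= e / 4.
  have m1 : 1 <= m%:R :> R by rewrite ler1n.
  apply: le_trans (_ : t ^+ 2 / 2 * (e / 4 / T2) <= _).
    by rewrite ler_pdivrMr// ler_peMr// mulr_ge0 ?divr_ge0// ltW.
  have -> : t ^+ 2 / 2 * (e / 4 / T2) = t ^+ 2 / 2 / T2 * (e / 4) by field; rewrite gt_eqF.
  by rewrite ler_piMl ?(ltW e4)// ler_pdivrMr// mul1r /T2; lra.
have cm : c - ad m / m%:R <= del by lra.
have k2 : `|expR (- (t ^+ 2 * (ad m / m%:R) / 2)) * cos th - expR (- (t ^+ 2 * c / 2)) * cos th| <= e / 4.
  rewrite -mulrBl normrM; apply: le_trans (_ : t ^+ 2 * del <= _).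
    apply: le_trans (ler_piMr (normr_ge0 _) (cos_max _)) _.
    apply: le_trans (abs_expRN_sub _ _) _.
    - by rewrite divr_ge0// mulr_ge0// divr_ge0// ltW.
    - by rewrite ler_pM2r ?invr_gt0// ler_wpM2l// ad_le.
    - have := ad_le m0; have : t ^+ 2 * (c - ad m / m%:R) <= t ^+ 2 * del by rewrite ler_wpM2l.
      have : 0 <= t ^+ 2 * (c - ad m / m%:R) by rewrite mulr_ge0// subr_ge0 ad_le.
      lra.
  have : del <= e / 4 / T2 by rewrite /del ge_min lexx orbT.
  rewrite ler_pdivlMr// /T2; nra.
have n00 : (0 < n)%N by rewrite -(ltr0n R).
have NL0 : (0 < N * L)%N by rewrite muln_gt0 L0 andbT; exact: leq_ltn_trans NN0.
have k3 : `|'E (fun p => cos (t * (dev n p / Num.sqrt n%:R) + th)) -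
    'E (fun p => cos (t * (bs m (N * L) p / Num.sqrt (N * L * m)%:R) + th))| <= e / 4.
  pose W p := dev n p / Num.sqrt n%:R - bs m (N * L) p / Num.sqrt (N * L * m)%:R.
  have s1 : sqint mu (fun p => dev n p / Num.sqrt n%:R).
    by have := sqintZ (Num.sqrt n%:R)^-1 (sqint_dev n00); congr sqint; apply/funext => p; rewrite mulrC.
  have s2 : sqint mu (fun p => bs m (N * L) p / Num.sqrt (N * L * m)%:R).
    by have := sqintZ (Num.sqrt (N * L * m)%:R)^-1 (sqint_bs (N * L) m0);
    congr sqint; apply/funext => p; rewrite mulrC.
  have sW : sqint mu W by exact: sqintB.
  have bcos (F : traj S -> R) : sqint mu F -> integ (fun p => cos (t * F p + th)).
    move=> [mF _]; apply: integ_bmeas; apply: (bmeas_comp (F := fun x => cos (t * x + th))) => //.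
    by split; [exact: measurable_cos_lin|exists 1 => x; exact: cos_max].
  rewrite -E_B; [|exact: (bcos _ s1)|exact: (bcos _ s2)].
  apply: le_trans (E_abs (integB (bcos _ s1) (bcos _ s2))) _.
  apply: le_trans (_ : 'E (fun p => `|t| * `|W p|) <= _).
    apply: E_le.
    - by apply: integ_abs; exact: integB (bcos _ s1) (bcos _ s2).
    - by apply/integZ/integ_abs/sqint_integ.
    move=> p; apply: le_trans (cos_lip _ _) _.
    by rewrite opprD addrACA subrr addr0 -mulrBr normrM.
  rewrite E_Z; last by apply/integ_abs/sqint_integ.
  apply: le_trans (ler_wpM2l (normr_ge0 t) (E_abs_nrm sW)) _.
  rewrite -(@ler_pXn2r _ 2)// ?nnegrE ?mulr_ge0 ?nrm_ge0 ?(ltW e0)//.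
  rewrite exprMn nrm_sqr real_normK ?num_real//.
  have := @dev_bs_dist m (N * L) n m0 NL0; rewrite kN => /(_ Nn) hW.
  (* One [del] from the gap between [ad m / m] and [c], one from the incomplete group. *)
  have {}hW : 'E (fun p => W p ^+ 2) <= 2 * del.
    by rewrite /W kN; apply: le_trans hW _; lra.
  apply: le_trans (ler_wpM2l t2 hW) _.
  have : del <= (e / 4) ^+ 2 / (2 * T2) by rewrite /del ge_min lexx.
  rewrite ler_pdivlMr ?mulr_gt0//; apply: le_trans.
  rewrite mulrCA [leRHS]mulrCA ler_wpM2l// mulrC ler_wpM2l ?(ltW del0)//.
  by rewrite /T2 lerDl.
by move=> k4; exact: ler_dist_quarters (le_trans k4 (lerD k1 (lexx _))) k2 k3.
Qed.

End path_clt.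

(** * Transfer to the chain *)

Section conditional_expectation.
Context {d d'} {Omega : measurableType d} {T : measurableType d'} {R : realType}.
Variables (P : probability Omega R) (X : Omega -> R) (Y : Omega -> T) (g : T -> R).
Notation "''E' F" := (Rintegral P setT F) (at level 10, F at level 9) : ring_scope.
Notation integ F := (P.-integrable setT (EFin \o F)).
Hypotheses (mY : measurable_fun setT Y) (Hg : cexp_version P X Y g).

Lemma cexp_orth (psi : T -> R) : integ X -> bmeas psi ->
  'E (fun w => (X w - g (Y w)) * psi (Y w)) = 0.
Proof.
case: Hg => mg [ig hB] iX bpsi.
have ig' : integ (fun w => g (Y w)) by [].
apply: (cond_bounded (Z := fun w => X w - g (Y w))) => //; first exact: integB.
move=> B mB.
have bB : bmeas (fun w => \1_B (Y w) : R) by exact: (bmeas_comp (bmeas_indic mB)).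
have -> : 'E (fun w => (X w - g (Y w)) * \1_B (Y w)) =
    'E (fun w => X w * \1_B (Y w) - g (Y w) * \1_B (Y w)).
  by apply: eq_Rintegral => w _; rewrite mulrBl.
rewrite (E_B (integMb iX bB) (integMb ig' bB)).
have e w : \1_B (Y w) = \1_(Y @^-1` B) w :> R by rewrite !indicE.
under eq_Rintegral do rewrite e.
under [X in _ - X]eq_Rintegral do rewrite e.
by rewrite !E_indic hB// subrr.
Qed.

(** A version is only assumed integrable. Testing against its own truncation shows that the squared
    norm of the truncation equals its pairing with [X], so that norm is at most the norm of [X]. *)
Lemma cexp_sqint : sqint P X -> sqint P (fun w => g (Y w)).
Proof.
move=> sX; have iX := sqint_integ sX; case: (Hg) => mg [ig hB].
have mgY : measurable_fun setT (fun w => g (Y w)) by exact: measurableT_comp.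
suff H k : 'E (fun w => trunc k (g (Y w)) ^+ 2) <= nrm P X ^+ 2.
  by have [] := sqint_of_trunc mgY H.
have bt := bmeas_trunc k mg.
have btY : bmeas (fun w => trunc k (g (Y w))) by exact: (bmeas_comp bt).
have st := sqint_bmeas P btY.
have := cexp_orth iX bt.
have -> : 'E (fun w => (X w - g (Y w)) * trunc k (g (Y w))) =
    'E (fun w => X w * trunc k (g (Y w)) - trunc k (g (Y w)) ^+ 2).
  apply: eq_Rintegral => w _; rewrite mulrBl; congr (_ - _).
  by rewrite /trunc; case: ifP; rewrite ?mulr0 ?expr0n.
rewrite E_B; [|exact: integMb|exact: sqint_sqr].
move/eqP; rewrite subr_eq0 => /eqP e.
rewrite -nrm_sqr ler_pXn2r ?nnegrE ?nrm_ge0//.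
apply: ler_of_sqr; rewrite ?nrm_ge0// nrm_sqr -e.
exact: le_trans (ler_norm _) (E_CS_nrm sX st).
Qed.

End conditional_expectation.

Lemma exists_law {d d'} {T : measurableType d} {T' : measurableType d'} {R : realType}
    (P : probability T R) (X : T -> T') : measurable_fun setT X ->
  exists P' : probability T' R, forall A, measurable A -> P' A = P (X @^-1` A).
Proof. by move=> mX; exists (distribution P (mfun_Sub (mem_set mX))). Qed.

(** * The law of the backward trajectory *)

Section past.
Context {d dS} {Omega : measurableType d} {S : measurableType dS} {R : realType}.
Variables (P : probability Omega R) (xi : int -> Omega -> S) (Q : R.-pker S ~> S).
Hypotheses (mc : markov_chain P xi Q) (st : stationary P xi).

(* Read backwards from time [n]: [xi_n] is coordinate [0] and [xi_0] is coordinate [n], so that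
   by stationarity the law does not depend on [n]. *)
Definition past (n : nat) (w : Omega) : traj S := fun k => xi (n%:Z - k%:Z) w.

Lemma measurable_past n : measurable_fun setT (past n).
Proof. by case: mc => mxi _; apply: measurable_to_traj => k; exact: mxi. Qed.

Lemma past0 n w : past n w 0%N = xi n%:Z w.
Proof. by rewrite /past subr0. Qed.

Lemma pastn n w : past n w n = xi 0 w.
Proof. by rewrite /past subrr. Qed.

Lemma pshift_past n w : pshift (past n.+1 w) = past n w.
Proof.
apply/funext => k; rewrite /pshift /past; congr (xi _ w).
lia.
Qed.

Lemma psum_past (f : S -> R) n w : psum f n (past n w) = partial_sum xi f n w.
Proof.
rewrite /psum /partial_sum big_add1 /= big_mkord (reindex_inj rev_ord_inj) /=.
apply: eq_bigr => k _; congr (f (xi _ w)).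
by have := ltn_ord k; lia.
Qed.

(** [stationary] speaks of forward blocks; the reflection [k -> m - k] turns a backward cylinder at
    any [n] into the same forward event started at time 0. *)
Lemma P_past_cyl n m (B : nat -> set S) : (forall k, measurable (B k)) ->
  P (past n @^-1` cyl m B) = P (past 0 @^-1` cyl m B).
Proof.
move=> mB.
have E j : P (past j @^-1` cyl m B) =
    P [set w | forall k : nat, (k <= m)%N -> B (m - k)%N (xi k%:Z w)].
  rewrite -(st (j%:Z - m%:Z) m (B := fun k => B (m - k)%N))//; congr (P _).
  apply/seteqP; split => w /= h k km.
    have := h _ (leq_subr k m); rewrite /past.
    by have -> : j%:Z - (m - k)%N%:Z = j%:Z - m%:Z + k%:Z by lia.
  have := h _ (leq_subr k m); rewrite subKn//.
  by have -> : j%:Z - m%:Z + (m - k)%N%:Z = j%:Z - k%:Z by lia.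
by rewrite !E.
Qed.

Lemma P_past n (A : set (traj S)) : measurable A -> P (past n @^-1` A) = P (past 0 @^-1` A).
Proof.
move=> mA.
have mpre (j : nat) (B : set (traj S)) : measurable B -> measurable (past j @^-1` B).
  by move=> mB; rewrite -[X in measurable X]setTI; exact: measurable_past.
have key (j : nat) (B : set (traj S)) : measurable B ->
    \int[P]_w (1 * \1_B (past j w)) = fine (P (past j @^-1` B)).
  move=> mB; have := E_indic P (fun=> 1) (past j @^-1` B).
  rewrite integral_cst ?mul1e; last exact: mpre.
  by move=> <-; apply: eq_Rintegral => w _; rewrite !indicE.
rewrite -[LHS]fineK ?fin_num_measure//; last exact: mpre.
rewrite -[RHS]fineK ?fin_num_measure//; last exact: mpre.
rewrite -!key//; congr EFin.
refine (@eq_pi_system _ _ _ P _ (traj S) (@cylinders _ S) (fun=> 1) (fun=> 1)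
  (past n) (past 0) \1_A _ _ _ _ _ _ _ _ _) => //.
- exact: cylinders_setI.
- exact: cylinders_setT.
- exact: integ_cst.
- exact: integ_cst.
- exact: measurable_past.
- exact: measurable_past.
- exact: bmeas_indic.
move=> _ [m [B [mB ->]]]; have mC := measurable_cyl m mB.
by rewrite !key// P_past_cyl.
Qed.

(** The Markov clause is read on the path from time 1: its newest state is [xi 1] and the rest is
    the path from time 0, which is [markov_chain] at [n = 0]. *)
Lemma exists_path_law : exists mu : probability (traj S) R,
  markov_traj Q mu /\ forall n A, measurable A -> mu A = P (past n @^-1` A).
Proof.
have [mu hmu] := exists_law P (measurable_past 0).
have law n A : measurable A -> mu A = P (past n @^-1` A).
  by move=> mA; rewrite P_past// hmu.
exists mu; split=> //; split.
  move=> A mA; rewrite (law 0%N)// (law 1%N); last first.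
    by rewrite -[X in measurable X]setTI; exact: measurable_pshift.
  by congr (P _); apply/seteqP; split => w /=; rewrite pshift_past.
move=> B m Bs mB mBs.
have mC : measurable (cyl m Bs : set (traj S)) by exact: measurable_cyl.
have mQ : measurable_fun setT (fun p : traj S => Q (p 0%N) B).
  by apply: (measurableT_comp (measurable_kernel Q B mB)); exact: measurable_coord.
rewrite (law 1%N); last first.
  apply: measurableI.
    by rewrite -[X in measurable X]setTI; exact: measurable_coord.
  by rewrite -[X in measurable X]setTI; exact: measurable_pshift.
have := proj2 mc 0 m B Bs mB mBs; rewrite /= => h.
transitivity (P ([set w | B (xi (0 + 1) w)] `&`
    [set w | forall k : nat, (k <= m)%N -> Bs k (xi (0 - k%:Z) w)])).
  congr (P _); apply/seteqP; split => w /=.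
    by rewrite pshift_past past0 => -[? h']; split=> // k km; exact: h'.
  by rewrite pshift_past past0 => -[? h']; split=> // k km; exact: h'.
rewrite {}h [RHS]integral_mkcond (ge0_integral_law (measurable_past 0) (law 0%N)).
- rewrite integral_mkcond; apply: eq_integral => w _; rewrite !patchE.
  have -> : (w \in [set w | forall k : nat, (k <= m)%N -> Bs k (xi (0 - k%:Z) w)]) =
      (past 0 w \in (cyl m Bs : set (traj S))) by apply/idP/idP; rewrite !inE.
  by rewrite past0.
- by apply/(measurable_restrictT _ mC); exact: measurable_funTS.
- by move=> p; rewrite patchE; case: ifP.
Qed.

End past.

Lemma partial_sums_le_nneseries {R : realType} (u : nat -> \bar R) (v : nat -> R) N :
  (forall n, (0 < n)%N -> u n = (v n)%:E) -> (forall n, 0 <= v n) ->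
  (\sum_(1 <= n <oo) u n < +oo)%E ->
  \sum_(1 <= n < N) v n <= fine (\sum_(1 <= n <oo) u n)%E.
Proof.
move=> uv v0 fin.
have u0 n : (1 <= n)%N -> xpredT n -> (0 <= u n)%E by move=> n0 _; rewrite uv// lee_fin.
have f : (\sum_(1 <= n <oo) u n)%E \is a fin_num.
  by rewrite ge0_fin_numE//; apply: nneseries_ge0 => n n1 _; exact: u0.
rewrite -lee_fin fineK// -sumEFin; apply: le_trans (nneseries_lim_ge N u0).
by rewrite le_eqVlt; apply/orP; left; apply/eqP/eq_big_nat => n /andP[n1 _]; rewrite uv.
Qed.

Theorem theorem2 (R : realType) (d dS : measure_display)
  (Omega : measurableType d) (S : measurableType dS)
  (P : probability Omega R) (xi : int -> Omega -> S)
  (Q : R.-pker S ~> S) (pi : probability S R) (f : S -> R) :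
  markov_chain P xi Q ->
  stationary P xi ->
  (forall A, measurable A -> pi A = P (xi 0 @^-1` A)) ->
  L2_0 pi f ->
  (exists g0 gn : nat -> S -> R,
     (forall n, (0 < n)%N -> cexp_version P (partial_sum xi f n) (xi 0) (g0 n)) /\
     (forall n, (0 < n)%N -> cexp_version P (partial_sum xi f n) (xi n%:Z) (gn n)) /\
     (\sum_(1 <= n <oo)
        ((\int[P]_w ((g0 n (xi 0 w)) ^+ 2)%:E) * ((n%:R ^+ 2)^-1)%:E) < +oo)%E /\
     (\sum_(1 <= n <oo)
        ((\int[P]_w ((gn n (xi n%:Z w)) ^+ 2)%:E) * ((n%:R ^+ 2)^-1)%:E) < +oo)%E) ->
  exists sigma2 : R, 0 <= sigma2 /\
    (fun n : nat => fine (\int[P]_w ((partial_sum xi f n w) ^+ 2)%:E)%E / n%:R)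
      @ \oo --> sigma2 /\
    (totally_ergodic pi Q ->
     forall h : nat -> S * S -> R,
       (forall n, (0 < n)%N ->
          cexp_version P (partial_sum xi f n) (fun w => (xi 0 w, xi n%:Z w)) (h n)) ->
       exists eta2 : R,
         (fun n : nat => fine (\int[P]_w ((h n (xi 0 w, xi n%:Z w)) ^+ 2)%:E)%E / n%:R)
           @ \oo --> eta2 /\
         conv_in_dist_normal P
           (fun n w => (partial_sum xi f n w - h n (xi 0 w, xi n%:Z w)) / Num.sqrt n%:R)
           (sigma2 - eta2)).
Proof.
move=> mc st pi_xi0 [mf [f2 _]] [g0 [gn [cg0 [cgn [sum0 sumn]]]]].
have [mu [Hmu law]] := exists_path_law mc st.
have mp n : measurable_fun setT (past xi n) := measurable_past mc n.
have mxi n : measurable_fun setT (xi n) by case: mc.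
have mco k : measurable_fun setT (fun p : traj S => p k) := @measurable_coord _ S k.
have EL n (F : traj S -> R) : measurable_fun setT F ->
    \int[mu]_p F p = \int[P]_w F (past xi n w).
  by move=> mF; exact: (E_law (mp n) (law n)).
have pi_law A : measurable A -> pi A = mu ((fun p : traj S => p 0%N) @^-1` A).
  move=> mA; rewrite pi_xi0// (law 0%N); last by rewrite -[X in measurable X]setTI; exact: mco.
  by congr (P _); apply/seteqP; split => w /=; rewrite past0.
have sf : sqint mu (fun p => f (p 0%N)).
  apply/(sqint_law (mco 0%N) pi_law mf); split=> //; apply/integrableP; split.
    by apply/measurable_EFinP; exact: measurable_funX.
  by under eq_integral do rewrite /= ger0_norm ?sqr_ge0//.
have sp := sqint_psum Hmu mf sf.
have mpsum n : measurable_fun setT (psum f n : traj S -> R) by case: (sp n).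
have sX n : sqint P (partial_sum xi f n).
  have := proj1 (sqint_law (mp n) (law n) (mpsum n)) (sp n).
  by congr sqint; apply/funext => w; rewrite psum_past.
have iX n := sqint_integ (sX n).
have mg0 n : (0 < n)%N -> measurable_fun setT (g0 n) by move=> /cg0 [].
have mgn n : (0 < n)%N -> measurable_fun setT (gn n) by move=> /cgn [].
have sg0P n : (0 < n)%N -> sqint P (fun w => g0 n (xi 0 w)).
  by move=> n0; exact: (cexp_sqint (mxi 0) (cg0 n n0) (sX n)).
have sgnP n : (0 < n)%N -> sqint P (fun w => gn n (xi n%:Z w)).
  by move=> n0; exact: (cexp_sqint (mxi n%:Z) (cgn n n0) (sX n)).
have mc0 (g : S -> R) : measurable_fun setT g ->
    measurable_fun setT (fun p : traj S => g (p 0%N)).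
  by move=> mg; exact: measurableT_comp.
have sg0 n : (0 < n)%N -> sqint mu (fun p => g0 n (p 0%N)).
  (* The path from time 0 has [xi 0] as coordinate 0. The orthogonality relations below use the path
     from time [n], on which [xi 0] is coordinate [n] and the partial sum is [psum]. *)
  move=> n0; apply/(sqint_law (mp 0%N) (law 0%N) (mc0 _ (mg0 n n0))).
  by have := sg0P n n0; congr sqint; apply/funext => w; rewrite past0.
have sgn n : (0 < n)%N -> sqint mu (fun p => gn n (p 0%N)).
  move=> n0; apply/(sqint_law (mp n) (law n) (mc0 _ (mgn n n0))).
  by have := sgnP n n0; congr sqint; apply/funext => w; rewrite past0.
have og0 n : (0 < n)%N -> forall a : S -> R, bmeas a ->
    \int[mu]_p ((psum f n p - g0 n (p n)) * a (p n)) = 0.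
  move=> n0 a ba; rewrite (EL n); last first.
    apply: measurable_funM; last by apply: measurableT_comp => //; case: ba.
    by apply: measurable_funB => //; apply: measurableT_comp => //; exact: mg0.
  have := cexp_orth (mxi 0) (cg0 n n0) (iX n) ba; rewrite -[RHS]/0 => {1}<-.
  by apply: eq_Rintegral => w _; rewrite psum_past pastn.
have ogn n : (0 < n)%N -> forall a : S -> R, bmeas a ->
    \int[mu]_p ((psum f n p - gn n (p 0%N)) * a (p 0%N)) = 0.
  move=> n0 a ba; rewrite (EL n); last first.
    apply: measurable_funM; last by apply: measurableT_comp => //; case: ba.
    by apply: measurable_funB => //; apply: measurableT_comp => //; exact: mgn.
  have := cexp_orth (mxi n%:Z) (cgn n n0) (iX n) ba; rewrite -[RHS]/0 => {1}<-.
  by apply: eq_Rintegral => w _; rewrite psum_past past0.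
pose V n := \int[mu]_p psum f n p ^+ 2.
have VE n : fine (\int[P]_w ((partial_sum xi f n w) ^+ 2)%:E)%E = V n.
  rewrite /V (EL n); last exact: measurable_funX.
  by apply: eq_Rintegral => w _; rewrite psum_past.
have alE n : (0 < n)%N -> (\int[P]_w ((g0 n (xi 0 w)) ^+ 2)%:E = (al mu g0 n ^+ 2)%:E)%E.
  move=> n0; rewrite (E_EFin (sqint_sqr (sg0P n n0))) /al nrm_sqr (EL 0%N).
    by congr EFin; apply: eq_Rintegral => w _; rewrite past0.
  by apply: measurable_funX; exact: mc0 (mg0 n n0).
have beE n : (0 < n)%N -> (\int[P]_w ((gn n (xi n%:Z w)) ^+ 2)%:E = (be mu gn n ^+ 2)%:E)%E.
  move=> n0; rewrite (E_EFin (sqint_sqr (sgnP n n0))) /be nrm_sqr (EL n).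
    by congr EFin; apply: eq_Rintegral => w _; rewrite past0.
  by apply: measurable_funX; exact: mc0 (mgn n n0).
have cV : cvgn (fun n => V n / n%:R).
  apply: (@almost_additive_cvg _ V (al mu g0) (be mu gn)).
  - by move=> n; exact: nrm_ge0.
  - by move=> n; exact: nrm_ge0.
  - by move=> m n m0 n0; exact: (E_psum2_add Hmu mf sf mg0 sg0 sgn og0 ogn).
  - by move=> m n m0 n0; apply: (al_subadd Hmu mf sf mg0 sg0 og0).
  - by move=> m n m0 n0; apply: (be_subadd Hmu mf sf mgn sgn ogn).
  move=> N; under eq_bigr do rewrite mulrDl.
  rewrite big_split /=; apply: lerD.
    apply: partial_sums_le_nneseries sum0 => n.
      by move=> n0; rewrite alE// -EFinM.
    by rewrite divr_ge0// sqr_ge0.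
  apply: partial_sums_le_nneseries sumn => n.
    by move=> n0; rewrite beE// -EFinM.
  by rewrite divr_ge0// sqr_ge0.
have [s2 cs2] : exists s2 : R, V n / n%:R @[n --> \oo] --> s2 by move/cvg_ex: cV.
have V0 n : 0 <= V n by apply: E_ge0 => p; exact: sqr_ge0.
have s20 : 0 <= s2.
  rewrite -(cvg_lim _ cs2)//; apply: limr_ge; first exact: cV.
  by apply: nearW => n; rewrite divr_ge0.
exists s2; split=> //; split; first by under eq_fun do rewrite VE.
move=> erg h ch.
have mpair n : measurable_fun setT (fun w => (xi 0 w, xi n%:Z w)).
  by apply/measurable_fun_pairP; split=> /=; exact: mxi.
have mh n : (0 < n)%N -> measurable_fun setT (h n) by move=> /ch [].
have mpr n := @measurable_pair _ S n.
have shP n : (0 < n)%N -> sqint P (fun w => h n (xi 0 w, xi n%:Z w)).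
  by move=> n0; exact: (cexp_sqint (mpair n) (ch n n0) (sX n)).
have mhp n : (0 < n)%N -> measurable_fun setT (fun p : traj S => h n (p n, p 0%N)).
  by move=> n0; apply: (measurableT_comp (mh n n0)); exact: mpr.
have sh n : (0 < n)%N -> sqint mu (fun p => h n (p n, p 0%N)).
  move=> n0; apply/(sqint_law (mp n) (law n) (mhp n n0)).
  by have := shP n n0; congr sqint; apply/funext => w; rewrite past0 pastn.
have oh n : (0 < n)%N -> forall psi : S * S -> R, bmeas psi ->
    \int[mu]_p ((psum f n p - h n (p n, p 0%N)) * psi (p n, p 0%N)) = 0.
  move=> n0 psi bpsi; rewrite (EL n); last first.
    apply: measurable_funM; last by apply: (measurableT_comp _ (mpr n)); case: bpsi.
    by apply: measurable_funB => //; exact: mhp.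
  have := cexp_orth (mpair n) (ch n n0) (iX n) bpsi; rewrite -[RHS]/0 => {1}<-.
  by apply: eq_Rintegral => w _; rewrite psum_past past0 pastn.
pose ad n := \int[mu]_p dev f h n p ^+ 2.
pose H n := \int[mu]_p h n (p n, p 0%N) ^+ 2.
have Vad n : (0 < n)%N -> V n = ad n + H n by exact: (E_psum_dev Hmu mf sf mh sh oh).
have H0 n : 0 <= H n by apply: E_ge0 => p; exact: sqr_ge0.
have ad0 n : 0 <= ad n by apply: E_ge0 => p; exact: sqr_ge0.
have [C hC] : exists C, forall n, V n / n%:R <= C.
  have /cvg_seq_bounded [M [_ hM]] := cV; exists (M + 1) => n.
  apply: le_trans (ler_norm _) _; apply: hM => //; rewrite ltrDl//.
(* Nothing is assumed about [h 0], so the value at 0 is set by hand to keep the sequence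
   superadditive. *)
pose x n := if (0 < n)%N then ad n else 0.
have x0 n : 0 <= x n by rewrite /x; case: ifP.
have xC n : x n <= C * n%:R.
  rewrite /x; case: ifP => n0; last by move/negbT: n0; rewrite -eqn0Ngt => /eqP ->; rewrite mulr0.
  have := hC n; rewrite ler_pdivrMr ?ltr0n// => hn.
  by apply: le_trans hn; rewrite Vad// lerDl.
have xs m k n : (0 < m)%N -> (k * m <= n)%N -> k%:R * x m <= x n.
  move=> m0 km; have [->|k0] := posnP k; first by rewrite mul0r.
  rewrite /x m0 ifT; first exact: (dev_superadd Hmu mf sf mh sh oh m0 km).
  by apply: leq_trans km; rewrite muln_gt0 k0.
have [c [cx xle xnear]] := superadditive_cvg x0 xC xs.
have adle m : (0 < m)%N -> ad m / m%:R <= c by move=> m0; have := xle m m0; rewrite /x m0.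
have adnear e : 0 < e -> exists2 m, (0 < m)%N & c - e < ad m / m%:R.
  by move=> /xnear [m m0 hm]; exists m => //; move: hm; rewrite /x m0.
have c0 : 0 <= c by apply: le_trans (adle 1%N isT); rewrite divr_ge0.
(* By orthogonality the second moment of [h n] is [V n - ad n]; the variance of the limit is then
   [s2 - (s2 - c) = c]. *)
exists (s2 - c); split.
  have : V n / n%:R - x n / n%:R @[n --> \oo] --> s2 - c by exact: cvgB.
  apply: cvg_trans; apply: near_eq_cvg; exists 1%N => // n /= n0.
  rewrite /x n0 -mulrBl Vad// addrAC subrr add0r; congr (_ / _).
  rewrite /H (EL n); last by apply: measurable_funX; exact: mhp.
  by apply: eq_Rintegral => w _; rewrite past0 pastn.
have -> : s2 - (s2 - c) = c by ring.
move=> phi cphi phiB.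
have bphi : bmeas phi by case: phiB => B hB; exact: bmeas_cont cphi hB.
rewrite normal_expectE//.
pose Y n (p : traj S) := dev f h n p / Num.sqrt n%:R.
have sY n : sqint mu (Y n).
  (* At [n = 0] the inverse of [sqrt 0] is 0, so [Y 0] vanishes whatever [h 0] is. *)
  have [->|n0] := posnP n.
    have := sqint_bmeas mu (bmeas_cst 0); congr sqint; apply/funext => p.
    by rewrite /Y sqrtr0 invr0 mulr0.
  have := sqintZ (Num.sqrt n%:R)^-1 (sqint_dev Hmu mf sf sh n0).
  by congr sqint; apply/funext => p; rewrite mulrC.
have YC n : \int[mu]_p Y n p ^+ 2 <= c.
  have [->|n0] := posnP n.
    rewrite /Y; under eq_Rintegral do rewrite sqrtr0 invr0 mulr0 expr0n.
    by rewrite E_cst.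
  have := adle n n0; congr (_ <= _); rewrite /ad mulrC -(E_Z _ (sqint_sqr (sqint_dev Hmu mf sf sh n0))).
  by apply: eq_Rintegral => p _; rewrite /Y exprMn exprVn sqr_sqrtr// mulrC.
have mZ : measurable_fun setT (fun y : R => Num.sqrt c * y) by exact: measurable_funM.
have hcos t th : \int[mu]_p cos (t * Y n p + th) @[n --> \oo] -->
    \int[normal_prob 0 1]_y cos (t * (Num.sqrt c * y) + th).
  rewrite normal_prob_cos//.
  exact: (dev_clt Hmu pi_law mf sf mh sh oh erg adle adnear).
have lim := cvg_E_of_trig (P' := normal_prob 0 1 : probability _ R) sY YC mZ hcos cphi phiB.
have -> : (fun n => \int[P]_w (phi ((partial_sum xi f n w - h n (xi 0 w, xi n%:Z w)) / Num.sqrt n%:R))%:E)%E =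
   (fun n => (\int[mu]_p phi (Y n p))%:E).
  apply/funext => n.
  have bY : bmeas (fun p => phi (Y n p)) by apply: bmeas_comp => //; case: (sY n).
  rewrite (EL n); last by case: bY.
  rewrite -E_EFin; last by apply: integ_bmeas; exact: (bmeas_comp bY).
  by apply: eq_integral => w _; rewrite /Y /dev psum_past past0 pastn.
by apply: cvg_EFin; [exact: nearW|exact: lim].
Qed.
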